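(* Let $n\ge 3$ and $1\le i\le n-1$. Let $\Phi_i:\mathcal{K}^n\to\mathcal{K}^n$ be a continuous, translation invariant, $\mathrm{SO}(n)$ equivariant, even Minkowski valuation of degree $i$ whose spherical Crofton distribution is non-negative and normalized such that $\Phi_iB^n=\kappa_{n-1}B^n$. If $K\in\mathcal{K}^n$ has non-empty interior, then $$W_{n-i}(K)^n \;\ge\; \frac{\kappa_n^{n+1}}{\kappa_{n-1}^n}\,V_n(\Phi_i^\circ K)^{-1}\;\ge\; A_{n-i}(K)^n .$$ There is equality in the left hand inequality if and only if $\Phi_iK$ is a Euclidean ball. Equality holds in the right hand inequality if and only if $K$ is of constant $i$-brightness, or $i=1$ and $\Phi_1=\frac{\kappa_{n-1}}{2}(-\mathrm{Id}+\mathrm{Id})$, or $i=n-1$ and $\Phi_{n-1}=\Pi_{n-1}$.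
   Context: $\mathcal{K}^n$ is the set of convex bodies (non-empty compact convex sets) in $\mathbb{R}^n$, with the Hausdorff metric; $h(K,u)=\max\{\langle u,x\rangle : x\in K\}$ is the support function; $B^n$ is the Euclidean unit ball, $V_n$ is volume and $\kappa_j=V_j(B^j)$. For a convex body $L$ with the origin in its interior, $L^\circ=\{x\in\mathbb{R}^n: h(L,x)\le 1\}$, and $\Phi_i^\circ K:=(\Phi_iK)^\circ$. A map $\Phi:\mathcal{K}^n\to\mathcal{K}^n$ is a Minkowski valuation if $\Phi(K)+\Phi(L)=\Phi(K\cup L)+\Phi(K\cap L)$ (Minkowski addition) whenever $K,L,K\cup L\in\mathcal{K}^n$ and $K \cap L \neq \emptyset$. Translation invariant: $\Phi(K+x)=\Phi(K)$; $\mathrm{SO}(n)$ equivariant: $\Phi(\vartheta K)=\vartheta\Phi(K)$; even: $\Phi(-K)=\Phi(K)$; of degree $i$: $\Phi(\lambda K)=\lambda^i\Phi(K)$ for $\lambda>0$. $\mathrm{Gr}_{i,n}$ is the Grassmannian of $i$-dimensional linear subspaces of $\mathbb{R}^n$, $dE$ its invariant probability measure, and $V_i(K|E)$ is the $i$-dimensional volume of the orthogonal projection of $K$ onto $E$. The quermassintegrals and the affine quermassintegrals are $$W_{n-i}(K)=\frac{\kappa_n}{\kappa_i}\int_{\mathrm{Gr}_{i,n}}V_i(K|E)\,dE,\qquad A_{n-i}(K)=\frac{\kappa_n}{\kappa_i}\left(\int_{\mathrm{Gr}_{i,n}}V_i(K|E)^{-n}\,dE\right)^{-1/n}.$$ $K$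 is of constant $i$-brightness if $E\mapsto V_i(K|E)$ is constant on $\mathrm{Gr}_{i,n}$. The map $-\mathrm{Id}+\mathrm{Id}$ is $K\mapsto (-K)+K$, and $\Pi_{n-1}$ is the projection body map, $h(\Pi_{n-1}K,u)=V_{n-1}(K|u^\perp)$ for $u\in\mathbb{S}^{n-1}$. Spherical Crofton distribution: fix $\overline{E}\in\mathrm{Gr}_{i,n}$ and let $\mathrm{O}(i)\times\mathrm{O}(n-i)$ be its stabilizer in $\mathrm{O}(n)$. For every continuous, translation invariant, $\mathrm{SO}(n)$ equivariant, even Minkowski valuation $\Phi_i$ of degree $i$ there is a unique $\mathrm{O}(i)\times\mathrm{O}(n-i)$ invariant distribution $\delta$ on $\mathbb{S}^{n-1}$, called its spherical Crofton distribution, such that $h(\Phi_iK,\cdot)=V_i(K|\,\cdot\,)\ast\delta$ for every $K\in\mathcal{K}^n$, that is, for all $g\in C^\infty(\mathbb{S}^{n-1})$, $$\int_{\mathbb{S}^{n-1}}h(\Phi_iK,u)\,g(u)\,d\sigma(u)=\int_{\mathrm{SO}(n)}V_i(K|\tau\overline{E})\,\langle\delta,g\circ\tau\rangle\,d\tau,$$ where $\sigma$ and $d\tau$ are the invariant probability measures on $\mathbb{S}^{n-1}$ and $\mathrm{SO}(n)$. $\delta$ is non-negative if $\langle\delta,g\rangle\ge 0$ for all $g\ge0$ (so that $\delta$ is a measure). *)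

(* Defs.v *)
From HB Require Import structures.
From mathcomp Require Export all_boot all_order all_algebra.
From mathcomp Require Export all_classical all_reals all_analysis.
Export Order.TTheory GRing.Theory Num.Theory.
Export numFieldNormedType.Exports.

Set Implicit Arguments.
Unset Strict Implicit.
Unset Printing Implicit Defensive.

#[global] Open Scope classical_set_scope.
#[global] Open Scope ring_scope.

(* Conventions. R^n is 'rV[R]_n with the Euclidean structure below; the library
   norm of 'rV[R]_n is the sup norm, used only through the topology it induces.
   A linear map t : 'M[R]_n acts on a row vector x by x *m t. *)

Section Euclidean.
Context {R : realType} {n : nat}.
Implicit Types (x u : 'rV[R]_n) (K L : set 'rV[R]_n) (t : 'M[R]_n).

Definition dot u x : R := \sum_(j < n) u 0 j * x 0 j.

Definition enorm x : R := Num.sqrt (dot x x).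

Definition eball : set 'rV[R]_n := [set x | enorm x <= 1].

Definition sphere : set 'rV[R]_n := [set u | enorm u = 1].

Definition translate K x : set 'rV[R]_n := [set y + x | y in K].

Definition dilate (a : R) K : set 'rV[R]_n := [set a *: x | x in K].

Definition minkowski_add K L : set 'rV[R]_n :=
  [set x + y | x in K & y in L].

Definition mximage K t : set 'rV[R]_n := [set x *m t | x in K].

Definition convex_body K : Prop :=
  [/\ K !=set0, compact K & convex_set (K : set (convex_lmodType 'rV[R]_n))].

Definition support_fun K u : R := sup [set dot u x | x in K].

Definition hausdorff_dist K L : R :=
  inf [set r : R | [/\ 0 <= r,
    K `<=` minkowski_add L (dilate r eball) &
    L `<=` minkowski_add K (dilate r eball)]].

Definition polar K : set 'rV[R]_n := [set x | support_fun K x <= 1].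

Definition euclidean_ball K : Prop :=
  exists (c : 'rV[R]_n) (r : R), 0 < r /\ K = translate (dilate r eball) c.

Definition orthogonal : set 'M[R]_n := [set t | t *m t^T = 1%:M].

Definition SO : set 'M[R]_n := [set t | orthogonal t /\ \det t = 1].

End Euclidean.

Arguments eball : clear implicits.
Arguments sphere : clear implicits.
Arguments orthogonal : clear implicits.
Arguments SO : clear implicits.

(* The n-fold product of the Lebesgue measure on the line, as the iterated
   integral that defines the product measure. It is the Lebesgue measure on
   Borel sets, the only sets to which it is applied. *)
Fixpoint lebesgue_rV (R : realType) (n : nat) : set 'rV[R]_n -> \bar R :=
  match n return set 'rV[R]_n -> \bar R with
  | 0 => fun A => ((0 \in A)%:R)%:E
  | m.+1 => fun A =>
      (\int[@lebesgue_measure R]_t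
         lebesgue_rV [set y : 'rV[R]_m | A (row_mx (t%:M : 'rV[R]_1) y)])%E
  end.

Definition vol {R : realType} {n : nat} (A : set 'rV[R]_n) : R :=
  fine (lebesgue_rV A).

Definition kappa (R : realType) (j : nat) : R := vol (eball R j).

(* A linear subspace E of dimension i is represented by the matrix of the
   orthogonal projection onto E. The subspace E t has projection t^T *m E *m t
   when t is orthogonal. *)
Definition Gr (R : realType) (i n : nat) : set 'M[R]_n :=
  [set E | [/\ E^T = E, E *m E = E & \rank E = i]].

Definition Gr_act {R : realType} {n : nat} (t E : 'M[R]_n) : 'M[R]_n :=
  t^T *m E *m t.

Arguments Gr : clear implicits.

(* The rows of F form an orthonormal basis of E. *)
Definition orthonormal_basis {R : realType} {i n : nat} (E : 'M[R]_n)
    (F : 'M[R]_(i, n)) : Prop :=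
  F *m F^T = 1%:M /\ F^T *m F = E.

(* V_i(K|E): the i-dimensional volume of K|E in coordinates with respect to an
   orthonormal basis of E (the choice of the basis is immaterial). *)
Definition proj_vol {R : realType} {n : nat} (i : nat) (K : set 'rV[R]_n)
    (E : 'M[R]_n) : R :=
  let F : 'M[R]_(i, n) := xget 0 [set F | orthonormal_basis E F] in
  vol [set y *m F^T | y in mximage K E].

Definition constant_brightness {R : realType} {n : nat} (i : nat)
    (K : set 'rV[R]_n) : Prop :=
  exists c : R, forall E, Gr R i n E -> proj_vol i K E = c.

(* Z is the projection body of K; 1 - u^T u is the projection onto the
   hyperplane orthogonal to the unit vector u. *)
Definition is_projection_body {R : realType} {n : nat}
    (K Z : set 'rV[R]_n) : Prop :=
  convex_body Z /\
  forall u, sphere R n u ->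
    support_fun Z u = proj_vol n.-1 K (1%:M - u^T *m u).

Definition borel_mx (R : realType) (m n : nat) :=
  g_sigma_algebraType (@open 'M[R]_(m, n)).

Section Invariant_measures.
Context {R : realType} {n : nat}.

Definition SO_invariant_measure (mu : probability (borel_mx R n n) R) : Prop :=
  mu (SO R n) = 1%E /\
  forall t (A : set (borel_mx R n n)), SO R n t -> measurable A ->
    mu [set s | A (t *m s)] = mu A /\ mu [set s | A (s *m t)] = mu A.

Definition sphere_invariant_measure (sigma : probability (borel_mx R 1 n) R) :
    Prop :=
  sigma (sphere R n) = 1%E /\
  forall t (A : set (borel_mx R 1 n)), SO R n t -> measurable A ->
    sigma [set u | A (u *m t)] = sigma A.

Definition Gr_invariant_measure (i : nat)
    (nu : probability (borel_mx R n n) R) : Prop :=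
  nu (Gr R i n) = 1%E /\
  forall t (A : set (borel_mx R n n)), SO R n t -> measurable A ->
    nu [set E | A (Gr_act t E)] = nu A.

(* W_{n-i} and A_{n-i}, where nu is the invariant measure on Gr R i n. *)
Definition quermassintegral (i : nat) (nu : probability (borel_mx R n n) R)
    (K : set 'rV[R]_n) : R :=
  kappa R n / kappa R i * \int[nu]_(E in Gr R i n) proj_vol i K E.

Definition affine_quermassintegral (i : nat)
    (nu : probability (borel_mx R n n) R) (K : set 'rV[R]_n) : R :=
  kappa R n / kappa R i *
  (\int[nu]_(E in Gr R i n) (proj_vol i K E) ^- n) `^ (- (n%:R)^-1).

End Invariant_measures.

Section Minkowski_valuations.
Context {R : realType} {n : nat}.
Implicit Types (Phi : set 'rV[R]_n -> set 'rV[R]_n) (K L : set 'rV[R]_n).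

(* A map on convex bodies is a map on sets that preserves convex bodies; its
   values on other sets play no role. *)
Definition body_map Phi : Prop :=
  forall K, convex_body K -> convex_body (Phi K).

Definition hausdorff_continuous Phi : Prop :=
  forall K, convex_body K -> forall e : R, 0 < e ->
  exists2 d : R, 0 < d & forall L, convex_body L ->
    hausdorff_dist K L < d -> hausdorff_dist (Phi K) (Phi L) < e.

Definition minkowski_valuation Phi : Prop :=
  forall K L, convex_body K -> convex_body L -> convex_body (K `|` L) ->
    K `&` L !=set0 ->
    minkowski_add (Phi K) (Phi L) =
    minkowski_add (Phi (K `|` L)) (Phi (K `&` L)).

Definition translation_invariant Phi : Prop :=
  forall K x, convex_body K -> Phi (translate K x) = Phi K.

Definition SO_equivariant Phi : Prop :=
  forall K t, convex_body K -> SO R n t ->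
    Phi (mximage K t) = mximage (Phi K) t.

Definition even_map Phi : Prop :=
  forall K, convex_body K -> Phi (dilate (-1) K) = Phi K.

Definition homogeneous (i : nat) Phi : Prop :=
  forall K (a : R), convex_body K -> 0 < a ->
    Phi (dilate a K) = dilate (a ^+ i) (Phi K).

End Minkowski_valuations.

Section Distributions.
Context {R : realType} {n : nat}.
Implicit Types (g f : 'rV[R]_n -> R) (x : 'rV[R]_n).

(* Functions on the sphere are represented by functions on R^n, of which only
   the restriction to the sphere is used. Smoothness and derivatives refer to
   the extension of that restriction to R^n \ {0} that is homogeneous of
   degree 0. *)
Definition homogeneous_ext g x : R := g ((enorm x)^-1 *: x).

Fixpoint partials (s : seq 'I_n) f : 'rV[R]_n -> R :=
  if s is j :: s' then fun x => 'D_(delta_mx 0 j) (partials s' f) x else f.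

Definition sphere_smooth g : Prop :=
  forall (s : seq 'I_n) x, x != 0 ->
    {for x, continuous (partials s (homogeneous_ext g))} /\
    forall j, derivable (partials s (homogeneous_ext g)) x (delta_mx 0 j).

(* The continuity clause is continuity for the usual Frechet topology on smooth
   functions on the sphere, defined by the C^k norms. It implies that delta g
   depends only on the restriction of g to the sphere. *)
Definition sphere_distribution (delta : ('rV[R]_n -> R) -> R) : Prop :=
  (forall (a : R) g f, sphere_smooth g -> sphere_smooth f ->
     delta (fun x => a * g x + f x) = a * delta g + delta f) /\
  exists (k : nat) (C : R), forall g (M : R), sphere_smooth g ->
    (forall (s : seq 'I_n) u, (size s <= k)%N -> sphere R n u ->
       `|partials s (homogeneous_ext g) u| <= M) ->
    `|delta g| <= C * M.

Definition nonneg_distribution (delta : ('rV[R]_n -> R) -> R) : Prop :=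
  forall g, sphere_smooth g -> (forall u, sphere R n u -> 0 <= g u) ->
    0 <= delta g.

Definition stabilizer_invariant (E0 : 'M[R]_n)
    (delta : ('rV[R]_n -> R) -> R) : Prop :=
  forall t g, orthogonal R n t -> Gr_act t E0 = E0 -> sphere_smooth g ->
    delta (fun x => g (x *m t)) = delta g.

Definition spherical_crofton (i : nat)
    (mu : probability (borel_mx R n n) R)
    (sigma : probability (borel_mx R 1 n) R) (E0 : 'M[R]_n)
    (Phi : set 'rV[R]_n -> set 'rV[R]_n)
    (delta : ('rV[R]_n -> R) -> R) : Prop :=
  [/\ sphere_distribution delta,
      stabilizer_invariant E0 delta &
      forall K g, convex_body K -> sphere_smooth g ->
        \int[sigma]_(u in sphere R n) (support_fun (Phi K) u * g u) =
        \int[mu]_(t in SO R n)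
          (proj_vol i K (Gr_act t E0) * delta (fun x => g (x *m t)))].

End Distributions.

(* Main.v *)
(* Write h for the support function of Phi K, f(t) = V_i(K | t E0), and let
   c = kappa_(n-1) / kappa_i be the total mass of delta. All quantities become
   integrals of h over the sphere and of f over SO(n): V_n of the polar body is
   kappa_n times the integral J of h^-n, and the Crofton formula for the ball
   shows that averaging delta over SO(n) gives c times the measure sigma.

   The left inequality is Jensen's inequality for x^-n. For the right one,
   convexity of x^-n gives, with a = h / c,
     f(t)^-n - (n + 1) a(u t)^-n + n f(t) a(u t)^-(n+1) >= 0;
   integrating over u against delta >= 0 and over t, and using the Crofton
   formula with the test function a^-(n+1), yields that the integral J' of f^-n
   is at least c^n J.

   In the equality case delta is carried by the set Z of all u with
   a(u t) = f(t) for all t. If some u in Z is moved by the stabilizer of E0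
   along a continuous family of distances, then a is locally constant on the
   sphere, hence constant, and K has constant brightness. Otherwise i = 1 or
   i = n - 1 and Z lies in a pair of antipodal points, so delta is known, and
   Phi is the difference body or the projection body map. *)

From HB Require Import structures.
Require Import Defs.
From mathcomp Require Import ring lra measurable_realfun.

Set Implicit Arguments.
Unset Strict Implicit.
Unset Printing Implicit Defensive.

(** * Euclidean geometry, rotations and the Grassmannian *)

(** The distribution delta acts on smooth functions only, while a^-(n+1) is merely continuous, since
    support functions need not be smooth. Positivity bounds delta by its mass times the sup norm, so
    it extends to continuous functions through density of polynomials. The extension is kept as a
    positive linear functional and no representing measure is formed: that delta is carried by Z is
    expressed by the functional vanishing on continuous functions that vanish on Z, which follows
    from compactness, and pointwise statements about h come from testing the Crofton formula against
    continuous functions. Both equality cases rest on one quantitative inequality: the tangent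
    estimate for x^-n keeps the remainder (x - a)^2 / (a^2 x^n), whose integral has to vanish. The
    continuity estimate for f uses a ball inside the body; flat bodies enter only when Phi is
    identified, as limits of parallel bodies. Lebesgue measure is an iterated integral in
    coordinates, so its behaviour under rotations and dilations is derived from uniqueness of
    translation invariant measures. Integrals over the sphere and the Grassmannian are pulled back
    to SO(n). *)

Section Dot.
Context {R : realType} {n : nat}.
Implicit Types (u v w x y z : 'rV[R]_n) (t : 'M[R]_n).

Lemma dotE u x : u *m x^T = (dot u x)%:M.
Proof.
by apply/rowP => j; rewrite ord1 !mxE eqxx mulr1n; apply: eq_bigr => k _; rewrite mxE.
Qed.

Lemma dotC u x : dot u x = dot x u.
Proof. by apply: eq_bigr => j _; rewrite mulrC. Qed.

Lemma dotDl u v x : dot (u + v) x = dot u x + dot v x.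
Proof. by rewrite /dot -big_split; apply: eq_bigr => j _; rewrite mxE mulrDl. Qed.

Lemma dotZl a u x : dot (a *: u) x = a * dot u x.
Proof. by rewrite /dot mulr_sumr; apply: eq_bigr => j _; rewrite mxE mulrA. Qed.

Lemma dotDr u v x : dot x (u + v) = dot x u + dot x v.
Proof. by rewrite dotC dotDl !(dotC x). Qed.

Lemma dotZr a u x : dot x (a *: u) = a * dot x u.
Proof. by rewrite dotC dotZl (dotC x). Qed.

Lemma dotNl u x : dot (- u) x = - dot u x.
Proof. by rewrite -scaleN1r dotZl mulN1r. Qed.

Lemma dotNr u x : dot x (- u) = - dot x u.
Proof. by rewrite dotC dotNl (dotC x). Qed.

Lemma dotBl u v x : dot (u - v) x = dot u x - dot v x.
Proof. by rewrite dotDl dotNl. Qed.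

Lemma dotBr u v x : dot x (u - v) = dot x u - dot x v.
Proof. by rewrite dotDr dotNr. Qed.

Lemma dot0l x : dot 0 x = 0.
Proof. by rewrite /dot big1 // => j _; rewrite mxE mul0r. Qed.

Lemma dot0r x : dot x 0 = 0.
Proof. by rewrite dotC dot0l. Qed.

Lemma dot_ge0 x : 0 <= dot x x.
Proof. by apply: sumr_ge0 => j _; rewrite -expr2 sqr_ge0. Qed.

Lemma dot_eq0 x : (dot x x == 0) = (x == 0).
Proof.
apply/idP/eqP => [|->]; last by rewrite dot0l.
rewrite psumr_eq0 => [/allP h|j _]; last by rewrite -expr2 sqr_ge0.
apply/rowP => j; rewrite !mxE; apply/eqP.
by have := h j (mem_index_enum _); rewrite mulf_eq0 orbb.
Qed.

Lemma enorm_ge0 x : 0 <= enorm x.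
Proof. exact: sqrtr_ge0. Qed.

Lemma enorm_sqr x : enorm x ^+ 2 = dot x x.
Proof. by rewrite sqr_sqrtr// dot_ge0. Qed.

Lemma enorm_eq0 x : (enorm x == 0) = (x == 0).
Proof. by rewrite -dot_eq0 -enorm_sqr sqrf_eq0. Qed.

Lemma enorm0 : enorm (0 : 'rV[R]_n) = 0.
Proof. by apply/eqP; rewrite enorm_eq0. Qed.

Lemma enorm_gt0 x : (0 < enorm x) = (x != 0).
Proof. by rewrite lt_def enorm_ge0 andbT enorm_eq0. Qed.

Lemma enormZ a x : enorm (a *: x) = `|a| * enorm x.
Proof. by rewrite /enorm dotZl dotZr mulrA -expr2 sqrtrM ?sqr_ge0// sqrtr_sqr. Qed.

Lemma enormN x : enorm (- x) = enorm x.
Proof. by rewrite -scaleN1r enormZ normrN1 mul1r. Qed.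

Lemma enormB x y : enorm (x - y) = enorm (y - x).
Proof. by rewrite -opprB enormN. Qed.

Lemma cauchy_schwarz u x : `|dot u x| <= enorm u * enorm x.
Proof.
rewrite -(@ler_pXn2r _ 2) ?nnegrE ?mulr_ge0 ?enorm_ge0// exprMn !enorm_sqr real_normK ?num_real//.
have [->|x0] := eqVneq x 0; first by rewrite !dot0r expr0n mulr0.
have x_gt0 : 0 < dot x x by rewrite lt_def dot_ge0 dot_eq0 x0.
have := dot_ge0 (dot x x *: u - dot u x *: x).
rewrite dotBl !dotBr !dotZl !dotZr (dotC x u).
set A := dot u u; set B := dot x x; set C := dot u x.
move=> H; have : 0 <= B * (A * B - C ^+ 2) by apply: le_trans H _; lra.
by rewrite pmulr_rge0// subr_ge0.
Qed.

Lemma dot_le u x : dot u x <= enorm u * enorm x.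
Proof. exact: le_trans (ler_norm _) (cauchy_schwarz _ _). Qed.

Lemma enormD x y : enorm (x + y) <= enorm x + enorm y.
Proof.
rewrite -(@ler_pXn2r _ 2) ?nnegrE ?addr_ge0 ?enorm_ge0// sqrrD !enorm_sqr.
rewrite dotDl !dotDr (dotC y x).
by have := dot_le x y; rewrite mulr2n; lra.
Qed.

Lemma coord_le x j : `|x 0 j| <= enorm x.
Proof.
rewrite -(@ler_pXn2r _ 2) ?nnegrE ?enorm_ge0// enorm_sqr real_normK ?num_real//.
rewrite /dot (bigD1 j)//= -expr2 lerDl sumr_ge0// => k _.
by rewrite -expr2 sqr_ge0.
Qed.

Lemma enorm_le_norm x : enorm x <= n%:R * `|x|.
Proof.
rewrite -(@ler_pXn2r _ 2) ?nnegrE ?enorm_ge0 ?mulr_ge0// enorm_sqr.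
apply: (@le_trans _ _ (n%:R * `|x| ^+ 2)).
  rewrite /dot (le_trans (ler_sum _ (fun j _ => _ : _ <= `|x| ^+ 2)))//.
    move=> j _; rewrite -expr2 -real_normK ?num_real// ler_pXn2r ?nnegrE//.
    rewrite [leRHS]/Num.norm/= mx_normrE; apply/bigmax_geP; right.
    by exists (0, j).
  by rewrite sumr_const card_ord mulr_natl.
rewrite exprMn ler_wpM2r ?sqr_ge0//.
by rewrite -natrX ler_nat; case: n => // k; rewrite expnS leq_pmulr// expn_gt0.
Qed.

Lemma norm_le_enorm x : `|x| <= enorm x.
Proof.
rewrite [leLHS]/Num.norm/= mx_normrE; apply/bigmax_leP; split; first exact: enorm_ge0.
by move=> [i j] _ /=; rewrite ord1 coord_le.
Qed.

(** For a unit vector u, the reflection in the hyperplane orthogonal to u. Rotations with a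
    prescribed effect on vectors are built as products of two of these. *)
Definition refl u : 'M[R]_n := 1%:M - 2 *: (u^T *m u).

Lemma mul_refl u x : x *m refl u = x - (2 * dot x u) *: u.
Proof.
rewrite /refl mulmxBr mulmx1 -scalemxAr mulmxA dotE mul_scalar_mx scalerA.
by [].
Qed.

End Dot.

Lemma dot_mulmx {R : realType} {m n : nat} (u : 'rV[R]_m) (x : 'rV[R]_n) (t : 'M[R]_(m, n)) :
  dot (u *m t) x = dot u (x *m t^T).
Proof.
suff : (dot (u *m t) x)%:M = (dot u (x *m t^T))%:M :> 'M[R]_1.
  by move=> /matrixP/(_ 0 0); rewrite !mxE eqxx !mulr1n.
by rewrite -!dotE trmx_mul trmxK mulmxA.
Qed.

Section Orthogonal.
Context {R : realType} {n : nat}.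
Implicit Types (u v w x y z : 'rV[R]_n) (t s E : 'M[R]_n).

Lemma orthogonal_trmx t : orthogonal R n t -> orthogonal R n t^T.
Proof. by rewrite /orthogonal/= trmxK => /mulmx1C. Qed.

Lemma orthogonalC t : orthogonal R n t -> t^T *m t = 1%:M.
Proof. by move=> /orthogonal_trmx; rewrite /orthogonal/= trmxK. Qed.

Lemma orthogonalM s t : orthogonal R n s -> orthogonal R n t -> orthogonal R n (s *m t).
Proof.
rewrite /orthogonal/= => hs ht.
by rewrite trmx_mul mulmxA -(mulmxA s) ht mulmx1.
Qed.

Lemma orthogonal1 : orthogonal R n 1%:M.
Proof. by rewrite /orthogonal/= trmx1 mulmx1. Qed.

Lemma orthogonal_dot t u x : orthogonal R n t -> dot (u *m t) (x *m t) = dot u x.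
Proof. by move=> ht; rewrite dot_mulmx -mulmxA ht mulmx1. Qed.

Lemma orthogonal_enorm t x : orthogonal R n t -> enorm (x *m t) = enorm x.
Proof. by move=> ht; rewrite /enorm orthogonal_dot. Qed.

Lemma SO_orthogonal t : SO R n t -> orthogonal R n t.
Proof. by case. Qed.

Lemma SO1 : SO R n 1%:M.
Proof. by split; [exact: orthogonal1|rewrite det1]. Qed.

Lemma SOM s t : SO R n s -> SO R n t -> SO R n (s *m t).
Proof.
by move=> [os ds] [ot dt]; split; [exact: orthogonalM|rewrite det_mulmx ds dt mulr1].
Qed.

Lemma SO_trmx t : SO R n t -> SO R n t^T.
Proof. by move=> [ot dt]; split; [exact: orthogonal_trmx|rewrite det_tr]. Qed.

Lemma SO_sphere t u : SO R n t -> sphere R n u -> sphere R n (u *m t).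
Proof. by move=> [ot _]; rewrite /sphere/= orthogonal_enorm. Qed.

Lemma dot_sphere u : sphere R n u -> dot u u = 1.
Proof. by rewrite /sphere/= -enorm_sqr => ->; rewrite expr1n. Qed.

Lemma sphereP u : dot u u = 1 -> sphere R n u.
Proof. by rewrite /sphere/= /enorm => ->; rewrite sqrtr1. Qed.

Lemma sphere_neq0 u : sphere R n u -> u != 0.
Proof. by rewrite /sphere/= -enorm_gt0 => ->. Qed.

Lemma sphere_normalize x : x != 0 -> sphere R n ((enorm x)^-1 *: x).
Proof.
move=> x0; rewrite /sphere/= enormZ ger0_norm ?invr_ge0 ?enorm_ge0//.
by rewrite mulVf// enorm_eq0.
Qed.

Lemma sphereN u : sphere R n u -> sphere R n (- u).
Proof. by rewrite /sphere/= enormN. Qed.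

Lemma refl_tr u : (refl u)^T = refl u.
Proof. by rewrite /refl raddfB/= trmx1 linearZ/= trmx_mul trmxK. Qed.

Lemma refl_orthogonal u : sphere R n u -> orthogonal R n (refl u).
Proof.
move=> /dot_sphere hu; rewrite /orthogonal/= refl_tr; apply/row_matrixP => j.
rewrite !rowE mulmxA !mul_refl mulmx1 dotBl dotZl hu -addrA -opprD -scalerDl.
by rewrite (_ : 2 * _ + _ = 0); [rewrite scale0r subr0|ring].
Qed.

(** Matrix determinant lemma: two block triangular factorizations of [A] compare the n x n
    determinant of 1 - 2 u^T u with the 1 x 1 determinant of 1 - 2 u u^T. *)
Lemma refl_det u : sphere R n u -> \det (refl u) = -1.
Proof.
move=> hu; have := dotE u u; rewrite (dot_sphere hu) => huu.
pose A := block_mx (1%:M : 'M[R]_1) u (2 *: u^T) (1%:M : 'M[R]_n).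
have E1 : A = block_mx 1%:M 0 (2 *: u^T) 1%:M *m block_mx 1%:M u 0 (refl u).
  rewrite mulmx_block ?(mul1mx, mul0mx, mulmx1, mulmx0) !addr0.
  by rewrite -scalemxAl /refl addrC subrK.
have E2 : A = block_mx 1%:M u 0 1%:M *m block_mx (1%:M - u *m (2 *: u^T)) 0 (2 *: u^T) 1%:M.
  by rewrite mulmx_block ?(mul1mx, mul0mx, mulmx1, mulmx0) ?add0r subrK.
have : \det A = \det A by [].
rewrite {1}E1 E2 !det_mulmx !det_lblock !det_ublock !det1 !mul1r !mulr1.
move=> ->; rewrite -scalemxAr huu det_mx11 !mxE eqxx mulr1n; ring.
Qed.

Lemma reflM_SO u v : sphere R n u -> sphere R n v -> SO R n (refl u *m refl v).
Proof.
move=> hu hv; split; first by apply: orthogonalM; exact: refl_orthogonal.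
by rewrite det_mulmx !refl_det// mulrNN mulr1.
Qed.

Lemma kernel_unit k (A : 'M[R]_(n, k)) : (\rank A < n)%N ->
  exists2 z, sphere R n z & z *m A = 0.
Proof.
move=> hA; have : kermx A != 0 by rewrite -mxrank_eq0 mxrank_ker subn_eq0 -ltnNge.
move=> /rowV0Pn[v /sub_kermxP vA v0].
exists ((enorm v)^-1 *: v); first exact: sphere_normalize.
by rewrite -scalemxAl vA scaler0.
Qed.

(** Equal norms give 2 <x, x - y> = |x - y|^2, so reflecting x along x - y subtracts exactly x -
    y. *)
Lemma refl_swap x y : enorm x = enorm y -> x != y ->
  x *m refl ((enorm (x - y))^-1 *: (x - y)) = y.
Proof.
move=> hxy xy; have d0 : x - y != 0 by rewrite subr_eq0.
have e0 : enorm (x - y) != 0 by rewrite enorm_eq0.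
have hx : dot x x = dot y y by rewrite -!enorm_sqr hxy.
rewrite mul_refl dotZr scalerA.
rewrite (_ : _ * _ = 1) ?scale1r ?subKr//.
have : enorm (x - y) ^+ 2 = 2 * dot x (x - y).
  by rewrite enorm_sqr dotBl !dotBr -hx (dotC y x); ring.
rewrite [X in X = 1](_ : _ = (2 * dot x (x - y)) / enorm (x - y) ^+ 2); last first.
  by field.
by move=> <-; rewrite divff// sqrf_eq0.
Qed.

Lemma refl_fix u x : dot x u = 0 -> x *m refl u = x.
Proof. by move=> h; rewrite mul_refl h mulr0 scale0r subr0. Qed.

Lemma perp_unit x : (2 <= n)%N -> exists2 z, sphere R n z & dot x z = 0.
Proof.
move=> hn; have [|z hz zx] := @kernel_unit 1 x^T.
  by apply: leq_ltn_trans (rank_leq_col _) _.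
exists z => //; rewrite dotC; have := dotE z x; rewrite zx => /matrixP/(_ 0 0).
by rewrite !mxE eqxx mulr1n.
Qed.

Lemma perp_unit2 x y : (3 <= n)%N ->
  exists z, [/\ sphere R n z, dot x z = 0 & dot y z = 0].
Proof.
move=> hn; have [|z hz zx] := @kernel_unit (1 + 1) (row_mx x^T y^T).
  by apply: leq_ltn_trans (rank_leq_col _) _.
exists z; split=> //; rewrite dotC; move: zx; rewrite mul_mx_row -[RHS]row_mx0.
  move=> /eq_row_mx[]; rewrite dotE => /matrixP/(_ 0 0).
  by rewrite !mxE eqxx mulr1n.
move=> /eq_row_mx[_]; rewrite dotE => /matrixP/(_ 0 0).
by rewrite !mxE eqxx mulr1n.
Qed.

(** The reflection exchanging x and y has determinant -1; a second one along some z orthogonal to y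
    repairs the sign and fixes y. *)
Lemma SO_sphere_trans x y : (2 <= n)%N -> sphere R n x -> sphere R n y ->
  exists2 t, SO R n t & x *m t = y.
Proof.
move=> hn hx hy; have [->|xy] := eqVneq x y.
  by exists 1%:M; [exact: SO1|rewrite mulmx1].
have [z hz yz] := perp_unit y hn.
exists (refl ((enorm (x - y))^-1 *: (x - y)) *m refl z).
  by apply: reflM_SO => //; apply: sphere_normalize; rewrite subr_eq0.
by rewrite mulmxA refl_swap ?hx ?hy// refl_fix.
Qed.

(** Once v sits at v', the reflection taking the image of w to w' fixes v', because both have the
    same inner product with v'. The correcting reflection must fix v' and w', which is where three
    dimensions are used. *)
Lemma SO_sphere_trans2 v w v' w' : (3 <= n)%N ->
  sphere R n v -> sphere R n w -> sphere R n v' -> sphere R n w' ->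
  dot v w = dot v' w' -> exists t, [/\ SO R n t, v *m t = v' & w *m t = w'].
Proof.
move=> hn hv hw hv' hw' hd; have hn2 : (2 <= n)%N by exact: ltnW.
have [t1 ht1 vt1] := SO_sphere_trans hn2 hv hv'.
have hd1 : dot v' (w *m t1) = dot v' w'.
  by rewrite -hd -vt1 orthogonal_dot//; exact: SO_orthogonal.
have [e|ne] := eqVneq (w *m t1) w'; first by exists t1.
have [z [hz vz wz]] := perp_unit2 v' w' hn.
pose r := refl ((enorm (w *m t1 - w'))^-1 *: (w *m t1 - w')).
exists (t1 *m (r *m refl z)); split.
- apply: SOM => //; apply: reflM_SO => //.
  by apply: sphere_normalize; rewrite subr_eq0.
- rewrite !mulmxA vt1 [_ *m r]refl_fix ?refl_fix//.
  by rewrite dotZr dotBr hd1 subrr mulr0.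
- rewrite !mulmxA [_ *m r]refl_swap ?refl_fix//.
  by rewrite orthogonal_enorm ?hw ?hw'//; exact: SO_orthogonal.
Qed.

(* Gram-Schmidt: peel off a unit vector of the row space of E. *)
Lemma projection_basis E : E^T = E -> E *m E = E ->
  exists F : 'M[R]_(\rank E, n), orthonormal_basis E F.
Proof.
suff H m : forall E, (\rank E <= m)%N -> E^T = E -> E *m E = E ->
    exists k (F : 'M[R]_(k, n)), orthonormal_basis E F.
  move=> hT hE; have [k [F [F1 F2]]] := H _ E (leqnn _) hT hE.
  suff hk : k = \rank E by subst k; exists F.
  have : \rank F = k.
    apply/eqP; rewrite eqn_leq rank_leq_row/=.
    by rewrite -[leqLHS](mxrank1 R) -F1 mxrankM_maxl.
  move=> <-; apply/eqP; rewrite eqn_leq -F2 mxrankM_maxr andbT.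
  by rewrite -{1}[F]mul1mx -F1 -mulmxA mxrankM_maxr.
elim: m => [|m IH] {}E hr hT hE.
  have E0 : E = 0 by apply/eqP; rewrite -mxrank_eq0 -leqn0.
  exists 0%N, 0; split; last by rewrite mulmx0 E0.
  by apply/matrixP; case.
have [E0|En0] := eqVneq E 0.
  exists 0%N, 0; split; last by rewrite mulmx0 E0.
  by apply/matrixP; case.
have /rowV0Pn[v /submxP[w vw] v0] := En0.
pose u := (enorm v)^-1 *: v; have hu : sphere R n u by exact: sphere_normalize.
have uE : u *m E = u by rewrite /u -scalemxAl vw -mulmxA hE.
have EuT : E *m u^T = u^T by rewrite -{1}hT -trmx_mul uE.
have uuT : u *m u^T = 1%:M by rewrite dotE dot_sphere.
pose E' := E - u^T *m u.
have uE' : u *m E' = 0 by rewrite mulmxBr uE mulmxA uuT mul1mx subrr.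
have E'T : E'^T = E' by rewrite /E' raddfB/= hT trmx_mul trmxK.
have E'u : E' *m u^T = 0 by rewrite -E'T -trmx_mul uE' trmx0.
have E'E' : E' *m E' = E'.
  rewrite {1}/E' mulmxBl -mulmxA uE' mulmx0 subr0 /E' mulmxBr hE mulmxA EuT.
  by [].
have E'E : E' *m E = E' by rewrite mulmxBl hE -mulmxA uE.
have lt : (\rank E' < \rank E)%N.
  apply: rank_ltmx; rewrite ltmxE -{1}E'E submxMl/=.
  apply/negP => /submxP[D ED]; have /eqP := sphere_neq0 hu; apply.
  by rewrite -[u]trmxK -EuT ED -mulmxA E'u mulmx0 trmx0.
have [k [F [F1 F2]]] := IH E' (leq_trans lt hr) E'T E'E'.
have uF : u *m F^T = 0.
  have FE : F = F *m E' by rewrite -F2 mulmxA F1 mul1mx.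
  by rewrite {1}FE trmx_mul E'T mulmxA uE' mul0mx.
exists (1 + k)%N, (col_mx u F); split.
  rewrite tr_col_mx mul_col_mx !mul_mx_row uuT uF F1 -[F *m u^T]trmxK trmx_mul trmxK uF.
  by rewrite trmx0 -block_mxEv -scalar_mx_block.
by rewrite tr_col_mx mul_row_col F2 addrC subrK.
Qed.

Lemma orthonormal_basisE k E (F : 'M[R]_(k, n)) : orthonormal_basis E F -> F = F *m E.
Proof. by move=> [F1 F2]; rewrite -F2 mulmxA F1 mul1mx. Qed.

Lemma rank_proj_compl E : E *m E = E -> \rank (1%:M - E) = (n - \rank E)%N.
Proof.
move=> hE; rewrite -mxrank_ker; apply/eqP; rewrite eqn_leq !mxrankS//.
  have /sub_kermxP h := submx_refl (kermx E).
  by rewrite -{1}[kermx E]mulmx1 -[X in (X <= _)%MS]subr0 -h -mulmxBr submxMl.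
by apply/sub_kermxP; rewrite mulmxBl mul1mx hE subrr.
Qed.

End Orthogonal.

Section Grassmannian.
Context {R : realType} {i n : nat}.
Implicit Types (E : 'M[R]_n) (F : 'M[R]_(i, n)) (t s : 'M[R]_n).

Lemma Gr_basis E : Gr R i n E -> exists F, orthonormal_basis E F.
Proof. by case=> hT hE hr; have := projection_basis hT hE; rewrite hr. Qed.

Lemma Gr_compl E : Gr R i n E -> Gr R (n - i) n (1%:M - E).
Proof.
case=> hT hE hr; split; last by rewrite rank_proj_compl// hr.
  by rewrite raddfB/= trmx1 hT.
by rewrite mulmxBr mulmx1 !mulmxBl !mul1mx hE subrr subr0.
Qed.

Lemma Gr_act_Gr t E : orthogonal R n t -> Gr R i n E -> Gr R i n (Gr_act t E).
Proof.
move=> ht [hT hE hr]; split.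
- by rewrite /Gr_act !trmx_mul trmxK hT mulmxA.
- by rewrite /Gr_act !mulmxA -(mulmxA (t^T *m E) t) ht mulmx1 -(mulmxA t^T E E) hE.
- rewrite /Gr_act mxrankMfree ?row_free_unit; last first.
    by have [] := mulmx1_unit ht.
  rewrite -mxrank_tr trmx_mul trmxK hT mxrankMfree//.
  by rewrite row_free_unit; have [] := mulmx1_unit ht.
Qed.

Lemma Gr_actM s t E : Gr_act (s *m t) E = Gr_act t (Gr_act s E).
Proof. by rewrite /Gr_act trmx_mul !mulmxA. Qed.

Lemma orthonormal_basis_act t E F : orthonormal_basis E F -> orthogonal R n t ->
  orthonormal_basis (Gr_act t E) (F *m t).
Proof.
move=> [F1 F2] ht; split; first by rewrite trmx_mul mulmxA -(mulmxA F) ht mulmx1.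
by rewrite trmx_mul mulmxA -(mulmxA _ F^T) F2.
Qed.

Lemma Gr_act_refl E u : E^T = E -> sphere R n u -> u *m E = u \/ u *m E = 0 ->
  Gr_act (refl u) E = E.
Proof.
move=> hT hu huE.
have h : refl u *m E = E *m refl u.
  rewrite /refl mulmxBl mulmxBr mul1mx mulmx1 -scalemxAl -scalemxAr; congr (_ - _ *: _).
  have EuT : E *m u^T = (u *m E)^T by rewrite trmx_mul hT.
  rewrite -mulmxA [RHS]mulmxA EuT.
  by case: huE => ->; rewrite ?trmx0 ?mul0mx ?mulmx0.
by rewrite /Gr_act refl_tr h -mulmxA -{2}(refl_tr u) refl_orthogonal// mulmx1.
Qed.

(** Matching orthonormal bases of E and its complement with those of E' and its complement gives an
    orthogonal matrix; if its determinant is -1, a reflection that stabilizes E is applied first. *)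
Lemma SO_Gr_trans E E' : (0 < n)%N -> Gr R i n E -> Gr R i n E' ->
  exists2 t, SO R n t & Gr_act t E = E'.
Proof.
move=> n0 hE hE'.
have [F [F1 F2]] := Gr_basis hE; have [F' [F1' F2']] := Gr_basis hE'.
have [hT hEE hr] := hE; have [hT' hEE' hr'] := hE'.
have cT : (1%:M - E)^T = 1%:M - E by rewrite raddfB/= trmx1 hT.
have cE : (1%:M - E) *m (1%:M - E) = 1%:M - E.
  by rewrite mulmxBr mulmx1 !mulmxBl !mul1mx hEE subrr subr0.
have cT' : (1%:M - E')^T = 1%:M - E' by rewrite raddfB/= trmx1 hT'.
have cE' : (1%:M - E') *m (1%:M - E') = 1%:M - E'.
  by rewrite mulmxBr mulmx1 !mulmxBl !mul1mx hEE' subrr subr0.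
have [G [G1 G2]] := projection_basis cT cE.
have := projection_basis cT' cE'.
(* The rank in the type of [G'] is rewritten into that of [G], so that the product of [G^T] and [G']
   is well typed. *)
rewrite rank_proj_compl// hr' -hr -rank_proj_compl// => -[G' [G1' G2']].
have FG : F *m G^T = 0.
  rewrite (orthonormal_basisE (conj F1 F2)) (orthonormal_basisE (conj G1 G2)) trmx_mul cT.
  by rewrite -mulmxA (mulmxA E) mulmxBr mulmx1 hEE subrr mul0mx mulmx0.
have FG' : F' *m G'^T = 0.
  rewrite (orthonormal_basisE (conj F1' F2')) (orthonormal_basisE (conj G1' G2')) trmx_mul cT'.
  by rewrite -mulmxA (mulmxA E') mulmxBr mulmx1 hEE' subrr mul0mx mulmx0.
have GF' : G' *m F'^T = 0 by rewrite -[G' *m _]trmxK trmx_mul trmxK FG' trmx0.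
pose t := F^T *m F' + G^T *m G'.
have ot : orthogonal R n t.
  rewrite /orthogonal/= /t raddfD/= !trmx_mul !trmxK mulmxDl !mulmxDr.
  rewrite !mulmxA -!(mulmxA F^T) -!(mulmxA G^T) F1' G1' FG' GF'.
  by rewrite !mul0mx !mulmx0 !mul1mx addr0 add0r F2 G2 addrC subrK.
have tE : Gr_act t E = E'.
  have Ft : F *m t = F'.
    by rewrite mulmxDr !mulmxA F1 FG mul0mx addr0 mul1mx.
  by rewrite /Gr_act -F2 mulmxA -mulmxA Ft -trmx_mul Ft.
have : \det t ^+ 2 = 1 by rewrite expr2 -{2}det_tr -det_mulmx ot det1.
move=> /eqP; rewrite sqrf_eq1 => /orP[]/eqP dt; first by exists t.
(* A unit vector of E serves, and any unit vector when E = 0. *)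
have [u [hu huE]] : exists u, sphere R n u /\ (u *m E = u \/ u *m E = 0).
  have [E0|/rowV0Pn[v /submxP[w vw] v0]] := eqVneq E 0.
    have [u hu _] := @kernel_unit R n 1 0 (eq_ind_r (fun k => (k < n)%N) n0 (mxrank0 _ _ _)).
    by exists u; rewrite E0 mulmx0; split=> //; right.
  exists ((enorm v)^-1 *: v); split; first exact: sphere_normalize.
  by left; rewrite -scalemxAl vw -mulmxA hEE.
exists (refl u *m t); last by rewrite Gr_actM (Gr_act_refl hT hu huE).
split; first by apply: orthogonalM => //; exact: refl_orthogonal.
by rewrite det_mulmx refl_det// dt mulrNN mulr1.
Qed.

End Grassmannian.

(** * Topology and measurability of matrices *)

Section Continuity.
Context {R : realType}.

Lemma mx_continuous_at (T : topologicalType) m n (f : T -> 'M[R]_(m, n)) x :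
  (forall i j, {for x, continuous (fun y => f y i j)}) -> {for x, continuous f}.
Proof.
move=> h A [P hP PA]; suff : \forall y \near x, forall i j, P i j (f y i j).
  by apply: filterS => y; exact: PA.
apply: filter_forall => i; apply: filter_forall => j.
exact: (h i j).
Qed.

Lemma sum_continuous_at (T : topologicalType) (I : Type) (r : seq I) (f : I -> T -> R) x :
  (forall i, {for x, continuous (f i)}) -> {for x, continuous (fun y => \sum_(i <- r) f i y)}.
Proof.
move=> h; elim: r => [|i r IH].
  by rewrite (_ : (fun y => _) = cst 0); [exact: cst_continuous|apply/funext => y; rewrite big_nil].
rewrite (_ : (fun y => _) = (f i \+ (fun y => \sum_(i <- r) f i y))).
  by apply: continuousD; [exact: h|exact: IH].
by apply/funext => y; rewrite big_cons.
Qed.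

Lemma mulmx_continuous_at (T : topologicalType) a b c (f : T -> 'M[R]_(a, b))
   (g : T -> 'M[R]_(b, c)) x :
  {for x, continuous f} -> {for x, continuous g} -> {for x, continuous (fun y => f y *m g y)}.
Proof.
move=> cf cg; apply: mx_continuous_at => i j.
rewrite (_ : (fun y => _) = (fun y => \sum_k f y i k * g y k j)); last first.
  by apply/funext => y; rewrite mxE.
apply: sum_continuous_at => k.
apply: (@continuousM _ _ (fun y => f y i k) (fun y => g y k j)).
  exact: (continuous_comp cf (@coord_continuous _ _ _ i k _)).
exact: (continuous_comp cg (@coord_continuous _ _ _ k j _)).
Qed.

Lemma mulmx_continuousl a b c (A : 'M[R]_(a, b)) : continuous (fun B : 'M[R]_(b, c) => A *m B).
Proof.
move=> x; apply: (@mulmx_continuous_at _ a b c (cst A) id).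
  exact: cst_continuous.
exact: cvg_id.
Qed.

Lemma trmx_continuous a b : continuous (@trmx R a b).
Proof.
move=> x; apply: mx_continuous_at => i j.
rewrite (_ : (fun y => _) = (fun y : 'M[R]_(a, b) => y j i)).
  exact: coord_continuous.
by apply/funext => y; rewrite mxE.
Qed.

Lemma dot_continuous_at (T : topologicalType) n (f g : T -> 'rV[R]_n) x :
  {for x, continuous f} -> {for x, continuous g} -> {for x, continuous (fun y => dot (f y) (g y))}.
Proof.
move=> cf cg; apply: sum_continuous_at => k.
apply: (@continuousM _ _ (fun y => f y 0 k) (fun y => g y 0 k)).
  exact: (continuous_comp cf (@coord_continuous _ _ _ 0 k _)).
exact: (continuous_comp cg (@coord_continuous _ _ _ 0 k _)).
Qed.

Lemma enorm_continuous n : continuous (@enorm R n).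
Proof.
move=> x; apply: (@continuous_comp _ _ _ (fun y => dot y y) Num.sqrt); last exact: sqrt_continuous.
by apply: dot_continuous_at; exact: cvg_id.
Qed.

Lemma det_continuous n : continuous (fun A : 'M[R]_n => \det A).
Proof.
move=> x; rewrite /determinant.
apply: sum_continuous_at => s.
set g := fun y : 'M[R]_n => \prod_i y i (perm.fun_of_perm s i).
apply: (@continuousM R _ (fun=> (-1) ^+ perm.odd_perm s) g); first exact: cst_continuous.
rewrite /g {g}.
elim: (index_enum _) => [|i r IH].
  by rewrite (_ : (fun y => _) = cst 1); [exact: cst_continuous|apply/funext => y; rewrite big_nil].
rewrite (_ : (fun y => _) = ((fun y : 'M[R]_n => y i (perm.fun_of_perm s i)) \* (fun y => \prod_(i <- r) y i (perm.fun_of_perm s i)))).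
  by apply: continuousM; [exact: coord_continuous|exact: IH].
by apply/funext => y; rewrite big_cons.
Qed.

Lemma closed_eq_mx (T : topologicalType) a b (f g : T -> 'M[R]_(a, b)) :
  continuous f -> continuous g -> closed [set x | f x = g x].
Proof.
move=> cf cg.
rewrite (_ : [set x | _] = [set x | `|f x - g x| = 0]).
  apply: (@closed_comp _ _ (fun x => `|f x - g x|) [set x | x = 0]); last exact: closed_eq.
  move=> x _; apply: continuous_comp; last exact: norm_continuous.
  by apply: continuousB; [exact: cf|exact: cg].
apply/seteqP; split=> x /= => [->|/eqP]; first by rewrite subrr normr0.
by rewrite normr_eq0 subr_eq0 => /eqP.
Qed.

End Continuity.

Section Compactness.
Context {R : realType} {n : nat}.

Lemma eball_compact : compact (eball R n).
Proof.
apply: bounded_closed_compact.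
  exists 1; split; first exact: num_real.
  move=> r r1 x /= hx; apply: le_trans (ltW r1); apply: le_trans hx.
  exact: norm_le_enorm.
apply: (@closed_comp _ _ (@enorm R n) [set x | x <= 1]); last exact: closed_le.
by move=> x _; exact: enorm_continuous.
Qed.

Lemma sphere_closed : closed (sphere R n).
Proof.
apply: (@closed_comp _ _ (@enorm R n) [set x | x = 1]); last exact: closed_eq.
by move=> x _; exact: enorm_continuous.
Qed.

Lemma sphere_compact : compact (sphere R n).
Proof.
apply: subclosed_compact eball_compact _; first exact: sphere_closed.
by move=> x; rewrite /sphere/eball/= => ->.
Qed.

Lemma vec_mx_continuous m : continuous (@vec_mx R m n).
Proof.
move=> x; apply: mx_continuous_at => i j.
rewrite (_ : (fun y => _) = (fun y : 'rV[R]_(m * n) => y 0 (mxvec_index i j))).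
  exact: coord_continuous.
by apply/funext => y; rewrite mxE.
Qed.

Lemma orthogonal_closed : closed (orthogonal R n).
Proof.
apply: closed_eq_mx => x; last exact: cst_continuous.
by apply: mulmx_continuous_at; [exact: cvg_id|exact: trmx_continuous].
Qed.

Lemma orthogonal_entry t (i j : 'I_n) : orthogonal R n t -> `|t i j| <= 1.
Proof.
move=> ht; have : dot (row i t) (row i t) = 1.
  have /matrixP/(_ i i) := ht; rewrite !mxE eqxx mulr1n => <-.
  by apply: eq_bigr => k _; rewrite !mxE.
by move=> /sphereP h; have := coord_le (row i t) j; rewrite h mxE.
Qed.

(** A closed subset of the image under [vec_mx] of the cube [-1, 1]^(n * n) of row vectors, which is
    compact as a product of segments. *)
Lemma orthogonal_compact : compact (orthogonal R n).
Proof.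
pose B := [set v : 'rV[R]_(n * n) | forall j, v 0 j \in `[-1, 1]].
have cB : compact B.
  by apply: (@rV_compact R _ (fun=> `[-1, 1]%classic)) => _; exact: segment_compact.
apply: (@subclosed_compact _ _ (vec_mx @` B)).
- exact: orthogonal_closed.
- apply: continuous_compact => //; apply: continuous_subspaceT.
  exact: vec_mx_continuous.
- move=> t ht /=; exists (mxvec t); last exact: mxvecK.
  by move=> k; case/mxvec_indexP: k => i j; rewrite mxvecE in_itv/= -ler_norml orthogonal_entry.
Qed.

Lemma SO_closed : closed (SO R n).
Proof.
apply: closedI; first exact: orthogonal_closed.
apply: (@closed_comp _ _ (fun A : 'M[R]_n => \det A) [set x | x = 1]); last exact: closed_eq.
by move=> x _; exact: det_continuous.
Qed.

Lemma SO_compact : compact (SO R n).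
Proof.
by apply: subclosed_compact SO_closed orthogonal_compact _ => t [].
Qed.

End Compactness.

Section Measurability.
Context {R : realType}.

Lemma open_measurable_mx m n (A : set 'M[R]_(m, n)) :
  open A -> measurable (A : set (borel_mx R m n)).
Proof. exact: sub_sigma_algebra. Qed.

Lemma closed_measurable_mx m n (A : set 'M[R]_(m, n)) :
  closed A -> measurable (A : set (borel_mx R m n)).
Proof. by move/closed_openC/open_measurable_mx/measurableC; rewrite setCK. Qed.

Definition countable_basis (T : topologicalType) (I : countType) (B : I -> set T) :=
  (forall i, open (B i)) /\
  forall (U : set T) x, open U -> U x -> exists i, B i x /\ B i `<=` U.

Lemma mx_countable_basis m n :
  exists B : 'M[rat]_(m, n) * nat -> set 'M[R]_(m, n), countable_basis B.
Proof.
exists (fun qk => ball (map_mx ratr qk.1 : 'M[R]_(m, n)) (qk.2.+1%:R^-1)); split.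
  by move=> i; exact: ball_open.
move=> U x oU Ux.
have /nbhs_ballP[e /= e0 eU] : nbhs x U by exact: open_nbhs_nbhs.
have /ltr_add_invr[k] : 0 < e / 2 by rewrite divr_gt0.
rewrite add0r => ke.
have /choice[q hq] (ij : 'I_m * 'I_n) : exists q : rat,
    `|x ij.1 ij.2 - ratr q| < k.+1%:R^-1 :> R.
  have : x ij.1 ij.2 - k.+1%:R^-1 < x ij.1 ij.2 + k.+1%:R^-1.
    by rewrite ltrD2l gtrN ?invr_gt0.
  move=> /rat_in_itvoo[q]; rewrite in_itv/= => /andP[q1 q2].
  by exists q; rewrite ltr_distlC q1 q2.
have k0 : 0 < k.+1%:R^-1 :> R by rewrite invr_gt0.
exists (\matrix_(i, j) q (i, j), k); split=> /=.
  split=> // i j; rewrite !mxE /ball/= distrC; exact: (hq (i, j)).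
move=> y [_ hy]; apply: eU; split=> // i j.
have := hy i j; have := hq (i, j); rewrite !mxE /ball/= => h1 h2.
rewrite (_ : x i j - y i j = (x i j - ratr (q (i, j))) + (ratr (q (i, j)) - y i j)); last by ring.
apply: le_lt_trans (ler_normD _ _) _.
by rewrite [ltRHS]splitr ltrD//; apply: lt_trans ke.
Qed.

Lemma R_countable_basis : exists B : rat * nat -> set R, countable_basis B.
Proof.
exists (fun qk => ball (ratr qk.1 : R) (qk.2.+1%:R^-1)); split.
  by move=> i; exact: ball_open.
move=> U x oU Ux.
have /nbhs_ballP[e /= e0 eU] : nbhs x U by exact: open_nbhs_nbhs.
have /ltr_add_invr[k] : 0 < e / 2 by rewrite divr_gt0.
rewrite add0r => ke.
have : x - k.+1%:R^-1 < x + k.+1%:R^-1 by rewrite ltrD2l gtrN ?invr_gt0.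
move=> /rat_in_itvoo[q]; rewrite in_itv/= => /andP[q1 q2].
exists (q, k); split=> /=.
  by rewrite /ball/= distrC ltr_distlC q1 q2.
move=> y; rewrite /ball/= => hy; apply: eU; rewrite /ball/=.
rewrite (_ : x - y = (x - ratr q) + (ratr q - y)); last by ring.
apply: le_lt_trans (ler_normD _ _) _.
rewrite [ltRHS]splitr ltrD//; last exact: lt_trans ke.
by apply: lt_trans ke; rewrite ltr_distlC q1 q2.
Qed.

(** With countable bases an open set of the product is a countable union of rectangles, hence lies
    in the product of the Borel sigma-algebras. In the applications [j1] and [j2] are identities;
    they separate the measurable structure from the topological one on the same carrier. *)
Lemma open_prod_measurable d1 d2 (S1 : measurableType d1) (S2 : measurableType d2)
    (T1 T2 : topologicalType) (I1 I2 : countType)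
    (B1 : I1 -> set T1) (B2 : I2 -> set T2) (j1 : S1 -> T1) (j2 : S2 -> T2)
    (W : set (T1 * T2)) :
  countable_basis B1 -> countable_basis B2 ->
  (forall U, open U -> measurable (j1 @^-1` U)) ->
  (forall U, open U -> measurable (j2 @^-1` U)) ->
  open W -> measurable [set s : S1 * S2 | W (j1 s.1, j2 s.2)].
Proof.
move=> [oB1 hB1] [oB2 hB2] m1 m2 oW.
(* Basic rectangles not contained in W are replaced by the empty set, so that the union runs over
   the whole countable index type. *)
pose F (k : I1 * I2) : set (S1 * S2) :=
  if pselect (B1 k.1 `*` B2 k.2 `<=` W) then (j1 @^-1` B1 k.1) `*` (j2 @^-1` B2 k.2) else set0.
rewrite (_ : [set s | _] = \bigcup_k F k).
  apply: countable_bigcupT_measurable => // k; rewrite /F; case: pselect => [h|h] //=.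
  by apply: measurableX; [apply: m1; exact: oB1|apply: m2; exact: oB2].
apply/seteqP; split=> [[x y] /= Wxy|[x y] [k _]]; last first.
  by rewrite /F; case: pselect => //= h [/= hx hy]; exact: (h (_, _)).
have : nbhs (j1 x, j2 y) W by exact: open_nbhs_nbhs.
move=> [[P Q] /= []]; rewrite !nbhsE => -[U [oU Ux] UP] [V [oV Vy] VQ] PQW.
have [k1 [k1x k1U]] := hB1 _ _ oU Ux; have [k2 [k2y k2V]] := hB2 _ _ oV Vy.
exists (k1, k2) => //; rewrite /F; case: pselect => //= h; exfalso; apply: h.
by move=> [a b] /= [ha hb]; apply: PQW; split=> /=; [apply/UP/k1U|apply/VQ/k2V].
Qed.

Lemma measurable_fun_open d (S : measurableType d) m n (f : S -> borel_mx R m n) :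
  (forall U : set 'M[R]_(m, n), open U -> measurable (f @^-1` U)) -> measurable_fun setT f.
Proof.
move=> h; apply: measurability => // _ [U oU <-]; rewrite setTI.
exact: h.
Qed.

Lemma mx2_measurable a b c d p q (phi : 'M[R]_(a, b) -> 'M[R]_(c, d) -> 'M[R]_(p, q)) :
  continuous (fun z : 'M[R]_(a, b) * 'M[R]_(c, d) => phi z.1 z.2) -> forall A : set (borel_mx R p q), measurable A ->
  measurable [set z : borel_mx R a b * borel_mx R c d | A (phi z.1 z.2)].
Proof.
move=> cphi A mA.
have [B1 hB1] := mx_countable_basis a b; have [B2 hB2] := mx_countable_basis c d.
rewrite -[X in measurable X]setTI.
apply: (@measurable_fun_open _ _ p q (fun z : borel_mx R a b * borel_mx R c d => phi z.1 z.2)) => // U oU.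
apply: (@open_prod_measurable _ _ (borel_mx R a b) (borel_mx R c d) _ _ _ _ _ _ id id
   ((fun z : 'M[R]_(a, b) * 'M[R]_(c, d) => phi z.1 z.2) @^-1` U) hB1 hB2).
- by move=> V; exact: open_measurable_mx.
- by move=> V; exact: open_measurable_mx.
- by apply: open_comp oU => z _; exact: cphi.
Qed.

Lemma mx_measurable a b p q (phi : 'M[R]_(a, b) -> 'M[R]_(p, q)) : continuous phi ->
  forall A : set (borel_mx R p q), measurable A ->
  measurable ([set x | A (phi x)] : set (borel_mx R a b)).
Proof.
move=> cphi A mA; rewrite -[X in measurable X]setTI.
apply: (@measurable_fun_open _ _ p q (phi : borel_mx R a b -> borel_mx R p q)) => // U oU.
by apply: open_measurable_mx; apply: open_comp oU => z _; exact: cphi.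
Qed.

End Measurability.

(** * Lebesgue measure on row vectors *)

Section SigmaFinitePack.
Context d (T : measurableType d) (R : realType) (m : {measure set T -> \bar R}).
Hypothesis hm : sigma_finite setT m.

Let sf_measure : set T -> \bar R := m.
HB.instance Definition _ := Measure.on sf_measure.
HB.instance Definition _ := Measure_isSigmaFinite.Build _ _ _ sf_measure hm.

(** Tonelli takes a bundled sigma-finite measure; this bundles a proof of sigma-finiteness and
    exposes nothing but the values. *)
Lemma sigma_finite_pack :
  exists m' : {sigma_finite_measure set T -> \bar R}, forall A, m' A = m A.
Proof. by exists sf_measure. Qed.

End SigmaFinitePack.

Lemma tonelli_set d1 d2 (T1 : measurableType d1) (T2 : measurableType d2) (R : realType)
    (m1 : {sigma_finite_measure set T1 -> \bar R})
    (m2 : {sigma_finite_measure set T2 -> \bar R}) (A : set (T1 * T2)) :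
  measurable A ->
  (\int[m1]_x m2 [set y | A (x, y)] = \int[m2]_y m1 [set x | A (x, y)])%E.
Proof.
move=> mA.
have := product_measure_unique (m' := (m1 \x^ m2)%E) (@product_measure2E _ _ _ _ _ m1 m2) mA.
rewrite /product_measure1 /product_measure2 /= => h.
transitivity (\int[m1]_x m2 (xsection A x))%E.
  by apply: eq_integral => x _; rewrite xsectionE.
rewrite (h (sigma_finiteT m2)); apply: eq_integral => y _ /=.
by rewrite ysectionE.
Qed.

Lemma pushforward_pack d d' (T : measurableType d) (T' : measurableType d') (R : realType)
    (m : {measure set T -> \bar R}) (f : T -> T') : measurable_fun setT f ->
  exists m' : {measure set T' -> \bar R}, forall A, m' A = m (f @^-1` A).
Proof.
move=> mf; pose m' : {measure set T' -> \bar R} := pushforward m f.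
by exists (m' mf).
Qed.

Lemma lebesgue_measure_shift (R : realType) (a : R) (A : set (measurableTypeR R)) :
  measurable A -> lebesgue_measure [set x | A (x + a)] = lebesgue_measure A.
Proof.
move=> mA.
have mf : measurable_fun setT (fun x : measurableTypeR R => x + a : measurableTypeR R).
  by apply: continuous_measurable_fun => x; apply: continuousD; [exact: cvg_id|exact: cst_continuous].
have [nu nuE] := pushforward_pack (@lebesgue_measure R) mf.
suff H X : ocitv X -> lebesgue_measure X = nu X.
  by rewrite (lebesgue_measure_unique H mA) nuE.
case=> -[x y] _ <-; rewrite nuE/=.
rewrite (_ : _ @^-1` _ = `]x - a, y - a]%classic).
  rewrite !lebesgue_measure_itv/=.
  rewrite !lte_fin ltrBlDr subrK; case: ifP => // _.
  by rewrite -!EFinD; congr EFin; ring.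
by apply/seteqP; split=> z /=; rewrite !in_itv/= lerBrDr ltrBlDr.
Qed.

Section Lebesgue_rV.
Context {R : realType}.

(** Product sets, whose iterated integral is explicit. They exhaust the space, giving
    sigma-finiteness, and they fix the constant in the scaling law. *)
Definition cube n (r : R) : set 'rV[R]_n := [set x | forall j, `|x 0 j| <= r].

Lemma row_scalar_l m (t : R) (y : 'rV[R]_m) :
  (row_mx (t%:M : 'rV[R]_1) y : 'rV[R]_m.+1) 0 ord0 = t.
Proof.
rewrite (_ : ord0 = lshift m (0 : 'I_1) :> 'I_(1 + m)); last exact: val_inj.
by rewrite (@row_mxEl R 1 1 m) mxE eqxx mulr1n.
Qed.

Lemma row_scalar_r m (t : R) (y : 'rV[R]_m) k :
  (row_mx (t%:M : 'rV[R]_1) y : 'rV[R]_m.+1) 0 (lift ord0 k) = y 0 k.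
Proof.
rewrite (_ : lift ord0 k = rshift 1 k :> 'I_(1 + m)); last exact: val_inj.
by rewrite (@row_mxEr R 1 1 m).
Qed.

Lemma ord_shiftP m (j : 'I_m.+1) : j = ord0 \/ exists k, j = lift ord0 k.
Proof. by case: (unliftP ord0 j) => [k|] ->; [right; exists k|left]. Qed.

Lemma cube_row_mx m r (t : R) : 0 <= r ->
  [set y : 'rV[R]_m | @cube m.+1 r (row_mx (t%:M : 'rV[R]_1) y)] =
  if `|t| <= r then @cube m r else set0.
Proof.
move=> r0; case: ifPn => ht; apply/seteqP; split=> y //=.
- by move=> h j; have := h (lift ord0 j); rewrite row_scalar_r.
- by move=> h j; case: (ord_shiftP j) => [->|[k ->]]; rewrite ?row_scalar_l ?row_scalar_r.
- by move=> h; have := h ord0; rewrite row_scalar_l (negPf ht).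
Qed.

Lemma lebesgue_rV0 n : lebesgue_rV (set0 : set 'rV[R]_n) = 0%E.
Proof.
elim: n => [|n IH] /=; first by rewrite in_set0.
by apply: integral0_eq => x _; exact: IH.
Qed.

Lemma lebesgue_rV_cube n r : 0 <= r -> lebesgue_rV (@cube n r) = ((2 * r) ^+ n)%:E.
Proof.
move=> r0; elim: n => [|n IH] /=.
  by rewrite mem_set ?expr0//= => -[].
under eq_integral do rewrite cube_row_mx//.
transitivity (\int[@lebesgue_measure R]_t (((2 * r) ^+ n)%:E * (\1_(`[- r, r]%classic) t)%:E))%E.
  apply: eq_integral => t _; rewrite indicE mem_setE in_itv/= -ler_norml.
  by case: ifP => _; rewrite ?mule1 ?mule0 ?lebesgue_rV0.
rewrite ge0_integralZl//; last 2 first.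
  by apply/measurable_EFinP; apply: measurable_indic.
  by rewrite lee_fin exprn_ge0// mulr_ge0.
rewrite integral_indic// setIT/= lebesgue_measure_itv/= lte_fin.
case: ifPn => [h|]; first by rewrite -EFinD -EFinM exprSr; congr (_ * _)%:E; ring.
rewrite -leNgt => h; have -> : r = 0 by lra.
by rewrite mule0 mulr0 exprS mul0r.
Qed.

Lemma cube_closed n r : closed (@cube n r).
Proof.
rewrite (_ : cube _ = \bigcap_(j in [set: 'I_n]) [set x | `|x 0 j| <= r]); last first.
  by apply/seteqP; split=> x /= h j //=; exact: h.
apply: closed_bigI => j _.
apply: (@closed_comp _ _ (fun x : 'rV[R]_n => `|x 0 j|) [set x | x <= r]); last exact: closed_le.
move=> x _; apply: (@continuous_comp _ _ _ (fun x : 'rV[R]_n => x 0 j)).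
  exact: coord_continuous.
exact: norm_continuous.
Qed.

Lemma bigcup_cube n : \bigcup_k (@cube n k%:R) = setT.
Proof.
apply/seteqP; split=> // x _.
exists (Num.truncn `|x|).+1 => // j /=.
apply: le_trans _ (ltW (truncnS_gt _)).
rewrite [leRHS]/Num.norm/= mx_normrE; apply/bigmax_geP; right.
by exists (0, j).
Qed.

Lemma row_mx_measurable m : measurable_fun setT
  (fun p : measurableTypeR R * borel_mx R 1 m =>
    (row_mx (p.1%:M : 'rV[R]_1) p.2 : borel_mx R 1 m.+1)).
Proof.
have [B1 hB1] := @R_countable_basis R; have [B2 hB2] := @mx_countable_basis R 1 m.
apply: measurable_fun_open => U oU.
apply: (@open_prod_measurable _ _ (measurableTypeR R) (borel_mx R 1 m) _ _ _ _ _ _ id id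
   ((fun p : R * 'rV[R]_m => row_mx (p.1%:M : 'rV[R]_1) p.2 : 'rV[R]_m.+1) @^-1` U) hB1 hB2).
- by move=> V; exact: open_measurable.
- by move=> V; exact: open_measurable_mx.
- apply: open_comp oU => p _; apply: (@mx_continuous_at R _ 1 m.+1) => i j.
  rewrite [i]ord1; case: (ord_shiftP j) => [->|[k ->]].
    rewrite (_ : (fun y => _) = fst); first exact: cvg_fst.
    by apply/funext => y; rewrite row_scalar_l.
  rewrite (_ : (fun y => _) = (fun y : 'rV[R]_m => y 0 k) \o snd).
    by apply: continuous_comp; [exact: cvg_snd|exact: coord_continuous].
  by apply/funext => y; rewrite row_scalar_r.
Qed.

(** By induction, the product with the line pushed forward along [row_mx] has the iterated integral
    as its values. Sigma-finiteness, which the next product requires, comes from the cubes. *)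
Lemma lebesgue_rV_measure n :
  exists lam : {sigma_finite_measure set (borel_mx R 1 n) -> \bar R},
    forall A, measurable A -> lam A = lebesgue_rV A.
Proof.
suff [lam hlam] : exists lam : {measure set (borel_mx R 1 n) -> \bar R},
    forall A, measurable A -> lam A = lebesgue_rV A.
  have [|lam' h] := @sigma_finite_pack _ _ _ lam; last by exists lam' => A mA; rewrite h hlam.
  exists (fun k => cube k%:R); first by rewrite bigcup_cube.
  move=> k; have mk : measurable (@cube n k%:R : set (borel_mx R 1 n)).
    by apply: closed_measurable_mx; exact: cube_closed.
  by split=> //; rewrite hlam// lebesgue_rV_cube// ltry.
elim: n => [|n [lam hlam]].
  exists (dirac (0 : borel_mx R 1 0)) => A mA.
  by rewrite /= /dirac indicE.
have [|lam' hlam'] := @sigma_finite_pack _ _ _ lam.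
  exists (fun k => cube k%:R); first by rewrite bigcup_cube.
  move=> k; have mk : measurable (@cube n k%:R : set (borel_mx R 1 n)).
    by apply: closed_measurable_mx; exact: cube_closed.
  by split=> //; rewrite hlam// lebesgue_rV_cube// ltry.
pose psi (p : measurableTypeR R * borel_mx R 1 n) : borel_mx R 1 n.+1 :=
  row_mx (p.1%:M : 'rV[R]_1) p.2.
have mpsi : measurable_fun setT psi := @row_mx_measurable n.
pose m0 : {measure set (measurableTypeR R * borel_mx R 1 n) -> \bar R} := (@lebesgue_measure R \x lam')%E.
have [m1 m1E] := pushforward_pack m0 mpsi.
exists m1 => A mA; rewrite m1E /m0 /= /product_measure1.
apply: eq_integral => t _ /=.
have mX : measurable (psi @^-1` A) by rewrite -[X in measurable X]setTI; exact: mpsi.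
rewrite hlam' hlam; last exact: measurable_xsection.
by rewrite xsectionE.
Qed.

Definition lebesgue_mx n : {sigma_finite_measure set (borel_mx R 1 n) -> \bar R} :=
  projT1 (cid (lebesgue_rV_measure n)).

Lemma lebesgue_mxE n (A : set (borel_mx R 1 n)) : measurable A -> lebesgue_rV A = lebesgue_mx n A.
Proof. by move=> mA; rewrite /lebesgue_mx; case: cid => lam /= ->. Qed.

Lemma measurable_translate n (b : 'rV[R]_n) (A : set (borel_mx R 1 n)) : measurable A ->
  measurable ([set x | A (x + b)] : set (borel_mx R 1 n)).
Proof.
apply: (@mx_measurable R 1 n 1 n (fun x => x + b)) => x.
by apply: (@continuousD R 'rV[R]_n _ id (cst b)); [exact: cvg_id|exact: cst_continuous].
Qed.

Lemma measurable_mulmx_preimage m n p (t : 'M[R]_(n, p)) (A : set (borel_mx R m p)) : measurable A ->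
  measurable ([set x | A (x *m t)] : set (borel_mx R m n)).
Proof.
apply: (@mx_measurable R m n m p (fun x => x *m t)) => x.
by apply: mulmx_continuous_at; [exact: cvg_id|exact: cst_continuous].
Qed.

(** Induction on the iterated integral: the sections absorb the translation in the last n
    coordinates, and shift invariance on the line absorbs the first one. *)
Lemma lebesgue_mx_translate n (b : 'rV[R]_n) (A : set (borel_mx R 1 n)) : measurable A ->
  lebesgue_mx n [set x | A (x + b)] = lebesgue_mx n A.
Proof.
move=> mA; rewrite -!lebesgue_mxE//; last exact: measurable_translate.
elim: n => [|n IH] in b A mA *.
  by rewrite (_ : [set x | _] = A)//; apply/funext => x /=; congr A; rewrite !thinmx0.
rewrite /=; pose b1 := b 0 ord0; pose b2 : 'rV[R]_n := \row_j b 0 (lift ord0 j).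
pose G (t : measurableTypeR R) := lebesgue_rV [set y | A (row_mx (t%:M : 'rV_1) y)].
have msec t : measurable ([set y | A (row_mx (t%:M : 'rV_1) y)] : set (borel_mx R 1 n)).
  have mX : measurable ((fun p : measurableTypeR R * borel_mx R 1 n =>
    (row_mx (p.1%:M : 'rV[R]_1) p.2 : borel_mx R 1 n.+1)) @^-1` A).
    by rewrite -[X in measurable X]setTI; exact: row_mx_measurable.
  by have := measurable_xsection t mX; rewrite xsectionE.
transitivity (\int[@lebesgue_measure R]_t G (t + b1)%R)%E.
  apply: eq_integral => t _; rewrite /G -[RHS](IH b2); last exact: msec.
  congr lebesgue_rV.
  apply/funext => y /=; congr A; apply/rowP => j; rewrite [LHS]mxE.
  by case: (ord_shiftP j) => [->|[k ->]]; rewrite !(row_scalar_l, row_scalar_r)// !mxE.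
have mG : measurable_fun setT G.
  have mX : measurable ((fun p : measurableTypeR R * borel_mx R 1 n =>
    (row_mx (p.1%:M : 'rV[R]_1) p.2 : borel_mx R 1 n.+1)) @^-1` A).
    by rewrite -[X in measurable X]setTI; exact: row_mx_measurable.
  have := measurable_fun_xsection (lebesgue_mx n) mX.
  congr measurable_fun; apply/funext => t /=.
  by rewrite /G lebesgue_mxE// xsectionE.
have mf : measurable_fun setT (fun x : measurableTypeR R => x + b1 : measurableTypeR R).
  by apply: continuous_measurable_fun => x; apply: continuousD; [exact: cvg_id|exact: cst_continuous].
have G0 t : (0 <= G t)%E by rewrite /G lebesgue_mxE.
have := @ge0_integral_pushforward _ _ _ _ _ _ mf (@lebesgue_measure R) setT G measurableT mG (fun y _ => G0 y).
rewrite preimage_setT => <-.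
apply: eq_measure_integral => B mB _; rewrite /pushforward.
exact: lebesgue_measure_shift.
Qed.

Lemma lincomb_measurable_preimage m n (a b : R) (A : set (borel_mx R m n)) : measurable A ->
  measurable [set p : borel_mx R m n * borel_mx R m n | A (a *: p.1 + b *: p.2)].
Proof.
apply: (@mx2_measurable R m n m n m n (fun x y => a *: x + b *: y)) => p.
by apply: cvgD; apply: cvgZr; [exact: cvg_fst|exact: cvg_snd].
Qed.

(* Tonelli for (x, y) |-> 1_A x 1_B (y - x), with the substitution x |-> x + y
   in between. *)
Lemma translation_invariant_proportional n
    (rho : {sigma_finite_measure set (borel_mx R 1 n) -> \bar R}) :
  (forall (b : 'rV[R]_n) (A : set (borel_mx R 1 n)), measurable A ->
     rho [set x | A (x + b)] = rho A) ->
  forall A B : set (borel_mx R 1 n), measurable A -> measurable B ->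
  (rho A * lebesgue_mx n B = lebesgue_mx n A * rho [set x | B (- x)%R])%E.
Proof.
move=> hrho A B mA mB; pose lam := @lebesgue_mx n.
have mN : measurable ([set x | B (- x)] : set (borel_mx R 1 n)).
  have := @measurable_mulmx_preimage 1 n n (- 1%:M) B mB.
  by under eq_fun do rewrite mulmxN mulmx1.
pose S := [set p : borel_mx R 1 n * borel_mx R 1 n | A p.1 /\ B ((-1) *: p.1 + 1 *: p.2)].
pose S' := [set p : borel_mx R 1 n * borel_mx R 1 n | A (1 *: p.1 + 1 *: p.2) /\ B (- p.1)].
have mS : measurable S.
  apply: measurableI; last exact: lincomb_measurable_preimage.
  by rewrite -[X in measurable X]setTI; exact: measurable_fst.
have mS' : measurable S'.
  apply: measurableI; first exact: lincomb_measurable_preimage.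
  have := @lincomb_measurable_preimage 1 n (-1) 0 B mB.
  by congr measurable; apply/funext => p /=; rewrite scaleN1r scale0r addr0.
have E1 : (\int[rho]_x lam [set y | S (x, y)] = rho A * lam B)%E.
  transitivity (\int[rho]_x ((\1_A x)%:E * lam B))%E.
    apply: eq_integral => x _; rewrite indicE /S/=.
    have [/set_mem xA|/negP xA] := boolP (x \in A).
      rewrite mul1e -(lebesgue_mx_translate (- (x : 'rV[R]_n)) mB); congr (lam _).
      by apply/seteqP; split=> y /=; rewrite scaleN1r scale1r addrC// => -[].
    rewrite mul0e (_ : [set _ | _] = set0) ?measure0//.
    by apply/seteqP; split=> y //= -[] /mem_set.
  rewrite ge0_integralZr//; last by apply/measurable_EFinP; exact: measurable_indic.
  by rewrite integral_indic// setIT.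
have E2 : (\int[rho]_x lam [set y | S' (x, y)] = lam A * rho [set x | B (- x)%R])%E.
  transitivity (\int[rho]_x (lam A * (\1_[set x | B (- x)%R] x)%:E))%E.
    apply: eq_integral => x _; rewrite indicE /S'/=.
    have [/set_mem xA|/negP xA] := boolP (x \in _).
      rewrite mule1 -(lebesgue_mx_translate (x : 'rV[R]_n) mA); congr (lam _).
      by apply/seteqP; split=> y /=; rewrite !scale1r addrC// => -[].
    rewrite mule0 (_ : [set _ | _] = set0) ?measure0//.
    by apply/seteqP; split=> y //= -[_] /mem_set.
  rewrite ge0_integralZl//; last by apply/measurable_EFinP; exact: measurable_indic.
  by rewrite integral_indic// setIT.
rewrite -E1 -E2 (tonelli_set rho lam mS) (tonelli_set rho lam mS').
apply: eq_integral => y _.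
rewrite -(hrho (y : 'rV[R]_n) [set x | S (x, y)]); last first.
  by have := measurable_ysection y mS; rewrite ysectionE.
congr (rho _); apply/seteqP; split=> x /=; rewrite /S/S'/= !scale1r scaleN1r.
  by rewrite opprD subrK.
by rewrite opprD subrK.
Qed.

(** The pushforward under t is translation invariant, hence proportional to Lebesgue measure. The
    factor is not computed as a determinant but read off from a convenient B: the unit ball for
    orthogonal t, a cube for dilations. *)
Lemma lebesgue_mx_linear n (t : 'M[R]_n) (A B : set (borel_mx R 1 n)) :
  t \in unitmx -> measurable A -> measurable B ->
  (lebesgue_mx n [set x | A (x *m t)%R] * lebesgue_mx n B =
   lebesgue_mx n A * lebesgue_mx n [set x | B (- (x *m t))%R])%E.
Proof.
move=> ut mA mB.
have mf : measurable_fun setT (fun x : borel_mx R 1 n => x *m t : borel_mx R 1 n).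
  by move=> _ Y mY; rewrite setTI; exact: measurable_mulmx_preimage.
have [rho rhoE] := pushforward_pack (lebesgue_mx n) mf.
have [|rho' rho'E] := @sigma_finite_pack _ _ _ rho.
  (* Images of cubes under t, so that the preimages entering the pushforward are the cubes
     themselves. *)
  exists (fun k => [set x | @cube n k%:R (x *m invmx t)]).
    apply/seteqP; split=> // x _.
    have : setT (x *m invmx t) by [].
    by rewrite -bigcup_cube => -[k _ hk]; exists k.
  move=> k; have mk : measurable ([set x | @cube n k%:R (x *m invmx t)] : set (borel_mx R 1 n)).
    by apply: measurable_mulmx_preimage; apply: closed_measurable_mx; exact: cube_closed.
  split=> //; rewrite rhoE.
  rewrite (_ : _ @^-1` _ = @cube n k%:R); last first.
    by apply/funext => x /=; rewrite mulmxK.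
  rewrite -lebesgue_mxE ?lebesgue_rV_cube ?ltry//.
  by apply: closed_measurable_mx; exact: cube_closed.
have := @translation_invariant_proportional n rho' _ A B mA mB.
rewrite !rho'E !rhoE; apply => b C mC; rewrite !rho'E !rhoE.
rewrite -[RHS](lebesgue_mx_translate (b *m invmx t)); last exact: measurable_mulmx_preimage.
by congr (lebesgue_mx n _); apply/funext => x /=; rewrite mulmxDl mulmxKV.
Qed.

Lemma measurable_cube n r : measurable (@cube n r : set (borel_mx R 1 n)).
Proof. by apply: closed_measurable_mx; exact: cube_closed. Qed.

Lemma measurable_eball n : measurable (eball R n : set (borel_mx R 1 n)).
Proof.
apply: closed_measurable_mx; apply: compact_closed eball_compact.
exact: norm_hausdorff.
Qed.

Lemma lebesgue_mx_cube n r : 0 <= r -> lebesgue_mx n (cube r) = ((2 * r) ^+ n)%:E.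
Proof. by move=> r0; rewrite -lebesgue_mxE ?lebesgue_rV_cube//; exact: measurable_cube. Qed.

Lemma lebesgue_mx_eball_gt0 n : (0 < lebesgue_mx n (eball R n))%E.
Proof.
apply: (@lt_le_trans _ _ (lebesgue_mx n (cube (n.+1%:R^-1)))).
  by rewrite lebesgue_mx_cube ?invr_ge0// lte_fin exprn_gt0// mulr_gt0// invr_gt0.
apply: le_measure; rewrite ?inE; [exact: measurable_cube|exact: measurable_eball|].
move=> x hx; rewrite /eball/=; apply: le_trans (enorm_le_norm _) _.
apply: (@le_trans _ _ (n%:R * n.+1%:R^-1)).
  rewrite ler_wpM2l// [leLHS]/Num.norm/= mx_normrE; apply/bigmax_leP; split=> [|[i j] _ /=].
    by rewrite invr_ge0.
  by rewrite ord1; exact: hx.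
by rewrite ler_pdivrMr// mul1r ler_nat.
Qed.

Lemma lebesgue_mx_bounded_lty n (A : set (borel_mx R 1 n)) (r : R) : measurable A ->
  (forall x : 'rV[R]_n, A x -> enorm x <= r) -> (lebesgue_mx n A < +oo)%E.
Proof.
move=> mA hA; apply: (@le_lt_trans _ _ (lebesgue_mx n (cube `|r|))).
  apply: le_measure; rewrite ?inE//; first exact: measurable_cube.
  move=> x Ax j; apply: le_trans (coord_le _ _) _.
  by apply: le_trans (hA _ Ax) (ler_norm _).
by rewrite lebesgue_mx_cube// ltry.
Qed.

Lemma lebesgue_mx_orthogonal n t (A : set (borel_mx R 1 n)) :
  orthogonal R n t -> measurable A ->
  lebesgue_mx n [set x | A (x *m t)] = lebesgue_mx n A.
Proof.
move=> ot mA; have ut : t \in unitmx by have [] := mulmx1_unit ot.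
have := lebesgue_mx_linear ut mA (@measurable_eball n).
rewrite (_ : [set x | eball R n _] = eball R n); last first.
  by apply/funext => x; rewrite /eball/= enormN orthogonal_enorm.
have e0 := lebesgue_mx_eball_gt0 n.
have eoo : (lebesgue_mx n (eball R n) < +oo)%E.
  by apply: (@lebesgue_mx_bounded_lty n _ 1); first exact: measurable_eball.
have efin : lebesgue_mx n (eball R n) \is a fin_num by rewrite ge0_fin_numE.
move=> /(congr1 (fun z => z * ((fine (lebesgue_mx n (eball R n)))^-1)%:E)%E).
rewrite -!muleA -{1 3}(fineK efin) -!EFinM divff ?mule1//.
by rewrite gt_eqF// fine_gt0// e0 eoo.
Qed.

Lemma lebesgue_mx_scale n (a : R) (A : set (borel_mx R 1 n)) : 0 < a ->
  measurable A -> lebesgue_mx n [set x | A (a^-1 *: x)] = ((a ^+ n)%:E * lebesgue_mx n A)%E.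
Proof.
move=> a0 mA; have ai0 : 0 <= a^-1 by rewrite invr_ge0 ltW.
have ut : (a^-1)%:M \in @unitmx R n by rewrite unitmxE det_scalar unitfE expf_neq0// invr_eq0 gt_eqF.
have := lebesgue_mx_linear ut mA (@measurable_cube n 1).
rewrite (_ : [set x | cube 1 _] = cube a); last first.
  apply/funext => x /=; rewrite mul_mx_scalar; apply/propext; split=> h j.
    have := h j; rewrite !mxE normrN normrM (ger0_norm ai0).
    by rewrite mulrC ler_pdivrMr// mul1r.
  rewrite !mxE normrN normrM (ger0_norm ai0).
  by rewrite mulrC ler_pdivrMr// mul1r; exact: h.
rewrite !lebesgue_mx_cube//; last exact: ltW.
rewrite (_ : [set x | _] = [set x | A (a^-1 *: x)]); last first.
  by apply/funext => x /=; rewrite mul_mx_scalar.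
move=> /(congr1 (fun z => z * (((2 * 1) ^+ n)^-1)%:E)%E).
rewrite -!muleA -!EFinM divff ?mule1 ?expf_neq0 ?mulr1// => ->.
by rewrite muleC exprMn mulrAC divff ?mul1r// expf_neq0.
Qed.

End Lebesgue_rV.

Arguments lebesgue_mx {R} n.

(** * Invariant measures *)

Section Probability.
Context d (T : measurableType d) (R : realType) (P : probability T R).

Lemma full_setC (D : set T) : measurable D -> P D = 1%E -> P (~` D) = 0%E.
Proof. by move=> mD PD; rewrite probability_setC// PD subee. Qed.

Lemma full_setI (D A : set T) : measurable D -> P D = 1%E -> measurable A ->
  P (D `&` A) = P A.
Proof.
move=> mD PD mA; apply/eqP; rewrite eq_le; apply/andP; split.
  by apply: le_measure; rewrite ?inE//; exact: measurableI.
rewrite -[leRHS]adde0 -(full_setC mD PD).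
apply: (@le_trans _ _ (P ((D `&` A) `|` ~` D))).
  apply: le_measure; rewrite ?inE//.
    by apply: measurableU; [exact: measurableI|exact: measurableC].
  by move=> x Ax; have [Dx|nDx] := pselect (D x); [left|right].
by apply: measureU2; [exact: measurableI|exact: measurableC].
Qed.

Lemma full_integral_cst (D : set T) (F : T -> \bar R) (c : \bar R) :
  measurable D -> P D = 1%E -> (0 <= c)%E ->
  (forall x, D x -> F x = c) -> (forall x, ~ D x -> F x = 0%E) ->
  (\int[P]_x F x = c)%E.
Proof.
move=> mD PD c0 FD FnD.
transitivity (\int[P]_x (c * (\1_D x)%:E))%E.
  apply: eq_integral => x _; rewrite indicE.
  have [/set_mem Dx|/negP Dx] := boolP (x \in D); first by rewrite mule1 FD.
  by rewrite mule0 FnD// => /mem_set.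
rewrite ge0_integralZl//; last by apply/measurable_EFinP; exact: measurable_indic.
by transitivity (c * P D)%E; [rewrite integral_indic// setIT|rewrite PD mule1].
Qed.

Lemma bounded_integrable (D : set T) (F : T -> R) (M : R) : measurable D ->
  measurable_fun D F -> (forall x, D x -> `|F x| <= M) -> P.-integrable D (EFin \o F).
Proof.
move=> mD mF hM; apply: measurable_bounded_integrable => //.
  by apply: le_lt_trans (ltry 1); exact: probability_le1.
exists M; split; first exact: num_real.
by move=> r Mr x Dx; apply: le_trans (hM x Dx) (ltW Mr).
Qed.

End Probability.

(** Pulls integrals over the sphere or the Grassmannian back to SO(n). F is controlled on D2 only;
    the preimage of D2 contains D1, and since D1 has full measure the rest of it is negligible. *)
Lemma Rintegral_image d1 d2 (T1 : measurableType d1) (T2 : measurableType d2) (R : realType)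
    (P : probability T1 R) (Q : probability T2 R) (phi : T1 -> T2)
    (D1 : set T1) (D2 : set T2) (F : T2 -> R) (M : R) :
  measurable_fun setT phi -> (forall A, measurable A -> Q A = P (phi @^-1` A)) ->
  measurable D1 -> measurable D2 -> P D1 = 1%E ->
  (forall x, D1 x -> D2 (phi x)) ->
  measurable_fun D2 F -> (forall x, D2 x -> `|F x| <= M) ->
  \int[Q]_(y in D2) F y = \int[P]_(x in D1) F (phi x).
Proof.
move=> mphi QE mD1 mD2 PD1 sub mF hM; rewrite /Rintegral; congr fine.
have mD : measurable (phi @^-1` D2) by rewrite -[X in measurable X]setTI; exact: mphi.
have mFphi : measurable_fun (phi @^-1` D2) (F \o phi).
  apply: (@measurable_comp _ _ _ _ _ _ D2) => //.
    by move=> _ [x hx <-].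
  exact: measurable_funTS.
have intF : P.-integrable (phi @^-1` D2) (EFin \o (F \o phi)).
  by apply: (@bounded_integrable _ _ _ _ _ _ M) => // x; exact: hM.
transitivity (\int[pushforward P phi]_(y in D2) (F y)%:E)%E.
  by apply: eq_measure_integral => B mB _; exact: QE.
rewrite [LHS]integral_mkcond.
have mG : measurable_fun setT ((EFin \o F) \_ D2).
  by apply/(measurable_restrictT _ mD2); apply/measurable_EFinP.
rewrite (integral_pushforward mphi mG)//; last first.
  rewrite preimage_setT.
  rewrite (_ : _ \o phi = (EFin \o (F \o phi)) \_ (phi @^-1` D2)); last first.
    by apply/funext.
  by rewrite -integrable_mkcond.
rewrite preimage_setT.
transitivity (\int[P]_(x in phi @^-1` D2) (F (phi x))%:E)%E.
  rewrite [RHS]integral_mkcond; apply: eq_integral => x _.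
  by [].
rewrite [LHS](negligible_integral (measurableC mD1))//; last exact: full_setC.
have -> : phi @^-1` D2 `\` ~` D1 = D1; last by [].
by apply/seteqP; split=> x /=; [move=> [_ /contrapT]|move=> hx; split=> //; exact: sub].
Qed.

Section InvariantMeasures.
Context {R : realType} {n : nat}.
Variable mu : probability (borel_mx R n n) R.
Hypothesis hmu : SO_invariant_measure mu.

Lemma measurable_SO : measurable (SO R n : set (borel_mx R n n)).
Proof. by apply: closed_measurable_mx; exact: SO_closed. Qed.

Lemma measurable_sphere : measurable (sphere R n : set (borel_mx R 1 n)).
Proof. by apply: closed_measurable_mx; exact: sphere_closed. Qed.

(** By compactness finitely many translates of U cover SO(n); if U were null, invariance would make
    all of SO(n) null. *)
Lemma SO_measure_open_gt0 (U : set 'M[R]_n) t0 : open U -> SO R n t0 -> U t0 ->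
  (0 < mu (U : set (borel_mx R n n)))%E.
Proof.
move=> oU ht0 Ut0; rewrite lt_def measure_ge0 andbT; apply/eqP => mu0.
have := @SO_compact R n; rewrite compact_cover => /(_ _ (SO R n) (fun s => [set t | U (t0 *m s^T *m t)])).
case.
- move=> s _; apply: open_comp oU => t _.
  exact: mulmx_continuousl.
- move=> s hs; exists s => //=; rewrite -mulmxA orthogonalC ?mulmx1//.
  exact: SO_orthogonal.
move=> D hD cov.
pose F s : set (borel_mx R n n) := [set t | U (t0 *m s^T *m t)].
have mF s : measurable (F s).
  apply: (@mx_measurable R n n n n (fun t => t0 *m s^T *m t)); last exact: open_measurable_mx.
  exact: mulmx_continuousl.
have F0 s : SO R n s -> mu (F s) = 0%E.
  move=> hs; rewrite -mu0.
  have ht : SO R n (t0 *m s^T) by apply: SOM => //; exact: SO_trmx.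
  exact: (hmu.2 _ _ ht (open_measurable_mx oU)).1.
have key (r : seq 'M[R]_n) : (forall s, s \in r -> SO R n s) ->
    measurable (\big[setU/set0]_(s <- r) F s) /\ mu (\big[setU/set0]_(s <- r) F s) = 0%E.
  elim: r => [|s r IH] hr; first by rewrite big_nil measure0.
  have [|mr r0] := IH; first by move=> s' hs'; apply: hr; rewrite inE hs' orbT.
  rewrite big_cons; split; first exact: measurableU.
  apply/eqP; rewrite eq_le measure_ge0 andbT.
  have h : (mu (F s) + mu (\big[setU/set0]_(s <- r) F s) = 0)%E.
    by rewrite F0 ?add0e//; apply: hr; rewrite inE eqxx.
  by rewrite -h; exact: measureU2.
have [|mr r0] := key (finmap.enum_fset D).
  by move=> s hs; have := hD s hs; rewrite inE.
have : (mu (SO R n) <= 0)%E.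
  rewrite -r0; apply: le_measure; rewrite ?inE//; first exact: measurable_SO.
  move=> t ht; have [s /= hs Fst] := cov t ht.
  by rewrite -bigcup_seq; exists s.
by case: hmu => -> _; rewrite leNgt lte01.
Qed.

Lemma continuous_measurable_within m p (D : set 'M[R]_(m, p)) (F : 'M[R]_(m, p) -> R) :
  closed D -> {within D, continuous F} -> measurable_fun (D : set (borel_mx R m p)) F.
Proof.
move=> cD /continuousP cF; apply: (measurability _ (RGenOpens.measurableE R)).
move=> _ [_ [a [b ->] <-]].
have oab : open (`]a, b[%classic : set R) by exact: interval_open.
have /open_subspaceP[V oV VD] := cF _ oab.
rewrite setIC -VD; apply: measurableI; first exact: open_measurable_mx.
exact: closed_measurable_mx.
Qed.

Lemma continuous_compact_bounded (T : topologicalType) (D : set T) (F : T -> R) :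
  compact D -> {within D, continuous F} -> exists2 M, 0 < M & forall x, D x -> `|F x| <= M.
Proof.
move=> cD cF.
have /compact_bounded[M [_ hM]] := continuous_compact cF cD.
exists (`|M| + 1); first by rewrite ltr_wpDl.
move=> x Dx; apply: (hM (`|M| + 1)); first by rewrite ltr_pwDr// ler_norm.
by exists x.
Qed.

Lemma SO_integrable (F : 'M[R]_n -> R) : {within SO R n, continuous F} ->
  mu.-integrable (SO R n) (EFin \o F).
Proof.
move=> cF; have [M _ hM] := continuous_compact_bounded (@SO_compact R n) cF.
apply: (@bounded_integrable _ _ _ _ _ _ M) => //; first exact: measurable_SO.
by apply: continuous_measurable_within => //; exact: SO_closed.
Qed.

(** If F t > 0, then F exceeds F t / 2 near t, on a set of positive measure. This passes from
    equality of integrals to equality at every point. *)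
Lemma SO_continuous_eq0 (F : 'M[R]_n -> R) :
  {within SO R n, continuous F} -> (forall t, SO R n t -> 0 <= F t) ->
  \int[mu]_(t in SO R n) F t <= 0 -> forall t, SO R n t -> F t = 0.
Proof.
move=> cF F0 iF t ht; apply/eqP; rewrite eq_le F0// andbT leNgt; apply/negP => Ft.
have oab : open (`]F t / 2, +oo[%classic : set R) by exact: interval_open.
have /continuousP/(_ _ oab)/open_subspaceP[V oV VD] := cF.
have Vt : V t.
  suff : (V `&` SO R n) t by case.
  rewrite VD; split=> //=; rewrite in_itv/= andbT ltr_pdivrMr// ltr_pMr// ltr1n.
  by [].
have V0 := SO_measure_open_gt0 oV ht Vt.
have mV := open_measurable_mx oV; have mSO := measurable_SO.
have hint := SO_integrable cF.
suff : 0 < \int[mu]_(t in SO R n) F t by rewrite ltNge iF.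
apply: (@lt_le_trans _ _ (\int[mu]_(s in SO R n) (F t / 2 * \1_V s))).
  have iV : mu.-integrable (SO R n) (EFin \o (\1_V : borel_mx R n n -> R)).
    have mI := @measurable_indic _ (borel_mx R n n) R (SO R n) V mV.
    apply: (@bounded_integrable _ _ _ _ _ _ 1 mSO mI).
    by move=> x _; rewrite indicE; case: (_ \in _); rewrite ?normr1 ?normr0.
  rewrite RintegralZl// mulr_gt0 ?divr_gt0// /Rintegral integral_indic// fine_gt0//.
  have h := full_setI mSO hmu.1 mV; rewrite setIC.
  apply/andP; split; first by move: V0; rewrite -h.
  by apply: le_lt_trans (ltry 1); apply: probability_le1; exact: measurableI.
apply: le_Rintegral => //.
  have mI := @measurable_indic _ (borel_mx R n n) R (SO R n) V mV.
  apply: (@bounded_integrable _ _ _ _ _ _ (F t / 2) mSO).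
    by apply: measurable_funM.
  move=> x _; rewrite indicE; case: (_ \in _); rewrite ?mulr0 ?mulr1 ?normr0.
    by rewrite ger0_norm// divr_ge0// ltW.
  by rewrite divr_ge0// ltW.
move=> s hs; rewrite indicE; have [/set_mem sV|_] := boolP (s \in _); last by rewrite mulr0 F0.
rewrite mulr1; have : (V `&` SO R n) s by [].
by rewrite VD => -[/=]; rewrite in_itv/= andbT => /ltW.
Qed.

(** Tonelli on the pairs (t, u) with u t in A. The sections at fixed t have measure sigma A by
    invariance of sigma; those at fixed u have a measure independent of u by transitivity and
    invariance of mu. *)
Lemma sphere_measureE sigma (e : 'rV[R]_n) : (2 <= n)%N -> sphere_invariant_measure sigma ->
  sphere R n e -> forall A : set (borel_mx R 1 n), measurable A ->
  sigma A = mu [set t | A (e *m t)].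
Proof.
move=> hn [s1 sinv] he A mA.
pose X := [set p : borel_mx R n n * borel_mx R 1 n | SO R n p.1 /\ sphere R n p.2 /\ A (p.2 *m p.1)].
have mX : measurable X.
  apply: measurableI.
    have := @mx2_measurable R n n 1 n n n (fun t u => t) _ _ measurable_SO.
    by apply=> z; exact: cvg_fst.
  apply: measurableI.
    have := @mx2_measurable R n n 1 n 1 n (fun t u => u) _ _ measurable_sphere.
    by apply=> z; exact: cvg_snd.
  apply: (@mx2_measurable R n n 1 n 1 n (fun t u => u *m t)) => // z.
  by apply: mulmx_continuous_at; [exact: cvg_snd|exact: cvg_fst].
have mSO := measurable_SO; have mS := measurable_sphere; have mu1 := hmu.1.
have := tonelli_set mu sigma mX.
rewrite (full_integral_cst mSO mu1 (c := sigma A))//; last 2 first.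
- move=> t ht; rewrite -(sinv t A ht mA) -[RHS](full_setI mS s1).
    by congr (sigma _); apply/seteqP; split=> u /=; rewrite /X/= => -[]//.
  exact: measurable_mulmx_preimage.
- move=> t ht; rewrite (_ : [set y | _] = set0) ?measure0//.
  by apply/seteqP; split=> u //=; rewrite /X/= => -[].
move=> ->; apply: (full_integral_cst mS s1) => // u hu; last first.
  rewrite (_ : [set y | _] = set0) ?measure0//.
  by apply/seteqP; split=> t //=; rewrite /X/= => -[_ []].
have mE v : measurable ([set t | A (v *m t)] : set (borel_mx R n n)).
  apply: (@mx_measurable R n n 1 n (fun t => v *m t)) => // t.
  exact: mulmx_continuousl.
have [s hs <-] := SO_sphere_trans hn he hu.
rewrite -(hmu.2 s _ hs (mE e)).1 -[RHS](full_setI mSO mu1); last first.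
  apply: (@mx_measurable R n n 1 n (fun t => e *m (s *m t))) => // t.
  by apply: mulmx_continuous_at; [exact: cst_continuous|exact: mulmx_continuousl].
congr (mu _); apply/seteqP; split=> t /=; rewrite /X/= mulmxA.
  by move=> [ht [_ hA]].
by move=> [ht hA]; split=> //; split=> //; exact: SO_sphere.
Qed.

Lemma Gr_act_continuous_at (T : topologicalType) (f g : T -> 'M[R]_n) x :
  {for x, continuous f} -> {for x, continuous g} ->
  {for x, continuous (fun y => Gr_act (f y) (g y))}.
Proof.
move=> cf cg; apply: mulmx_continuous_at; last exact: cf.
apply: mulmx_continuous_at; last exact: cg.
exact: (continuous_comp cf (@trmx_continuous _ _ _ _)).
Qed.

Lemma Gr_act_continuous E : continuous (fun t : 'M[R]_n => Gr_act t E).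
Proof.
move=> t; apply: (@Gr_act_continuous_at _ id (cst E)); last exact: cst_continuous.
exact: cvg_id.
Qed.

Lemma measurable_Gr i (E0 : 'M[R]_n) : (0 < n)%N -> Gr R i n E0 ->
  measurable (Gr R i n : set (borel_mx R n n)).
Proof.
move=> n0 hE0; apply: closed_measurable_mx.
rewrite (_ : Gr R i n = (fun t => Gr_act t E0) @` SO R n).
  apply: compact_closed; first exact: norm_hausdorff.
  apply: continuous_compact SO_compact; apply: continuous_subspaceT.
  exact: Gr_act_continuous.
apply/seteqP; split=> E.
  by move=> hE; have [t ht <-] := SO_Gr_trans n0 hE0 hE; exists t.
by move=> [t ht <-]; apply: Gr_act_Gr => //; exact: SO_orthogonal.
Qed.

(** The double averaging of [sphere_measureE], with the transitive action on subspaces. *)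
Lemma Gr_measureE i nu (E0 : 'M[R]_n) : (0 < n)%N -> Gr_invariant_measure i nu ->
  Gr R i n E0 -> forall A : set (borel_mx R n n), measurable A ->
  nu A = mu [set t | A (Gr_act t E0)].
Proof.
move=> n0 [s1 sinv] he A mA.
have mS := measurable_Gr n0 he.
pose X := [set p : borel_mx R n n * borel_mx R n n | SO R n p.1 /\ Gr R i n p.2 /\ A (Gr_act p.1 p.2)].
have mX : measurable X.
  apply: measurableI.
    have := @mx2_measurable R n n n n n n (fun t u => t) _ _ measurable_SO.
    by apply=> z; exact: cvg_fst.
  apply: measurableI.
    have := @mx2_measurable R n n n n n n (fun t u => u) _ _ mS.
    by apply=> z; exact: cvg_snd.
  apply: (@mx2_measurable R n n n n n n (fun t u => Gr_act t u)) => // z.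
  by apply: Gr_act_continuous_at; [exact: cvg_fst|exact: cvg_snd].
have mSO := measurable_SO; have mu1 := hmu.1.
have mE (f : 'M[R]_n -> 'M[R]_n) E : continuous f ->
    measurable ([set t | A (Gr_act (f t) E)] : set (borel_mx R n n)).
  move=> cf; apply: (@mx_measurable R n n n n (fun t => Gr_act (f t) E)) => // t.
  by apply: Gr_act_continuous_at; [exact: cf|exact: cst_continuous].
have mE' t : measurable ([set E | A (Gr_act t E)] : set (borel_mx R n n)).
  apply: (@mx_measurable R n n n n (fun E => Gr_act t E)) => // E.
  by apply: (@Gr_act_continuous_at _ (cst t) id); [exact: cst_continuous|exact: cvg_id].
have := tonelli_set mu nu mX.
rewrite (full_integral_cst mSO mu1 (c := nu A))//; last 2 first.
- move=> t ht; rewrite -(sinv t A ht mA) -[RHS](full_setI mS s1)//.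
  by congr (nu _); apply/seteqP; split=> u /=; rewrite /X/= => -[]//.
- move=> t ht; rewrite (_ : [set y | _] = set0) ?measure0//.
  by apply/seteqP; split=> u //=; rewrite /X/= => -[].
move=> ->; apply: (full_integral_cst mS s1) => // u hu; last first.
  rewrite (_ : [set y | _] = set0) ?measure0//.
  by apply/seteqP; split=> t //=; rewrite /X/= => -[_ []].
have [s hs <-] := SO_Gr_trans n0 he hu.
have mE1 : measurable ([set t | A (Gr_act t E0)] : set (borel_mx R n n)).
  by apply: (mE id) => t; exact: cvg_id.
rewrite -(hmu.2 s _ hs mE1).1 -[RHS](full_setI mSO mu1); last first.
  by apply: mE => t; exact: mulmx_continuousl.
congr (mu _); apply/seteqP; split=> t /=; rewrite /X/= Gr_actM.
  by move=> [ht [_ hA]].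
move=> [ht hA]; split=> //; split=> //.
by apply: Gr_act_Gr he; exact: SO_orthogonal.
Qed.

(* Both sides are transformed by Tonelli to the integral over x of
   mu {t | h (x *m t) <= 1}; the distribution of x *m t is the invariant
   measure on the sphere of radius |x|. *)
Lemma sublevel_measureE sigma (h : 'rV[R]_n -> R) : (2 <= n)%N ->
  sphere_invariant_measure sigma -> continuous h ->
  (forall a x, 0 <= a -> h (a *: x) = a * h x) ->
  (forall u, sphere R n u -> 0 < h u) ->
  (lebesgue_mx n [set x | (h x <= 1)%R] =
   \int[sigma]_(u in sphere R n) (((h u) ^- n)%:E * lebesgue_mx n (eball R n)))%E.
Proof.
move=> hn hs hc hh hpos.
have mh : measurable ([set x | h x <= 1] : set (borel_mx R 1 n)).
  apply: closed_measurable_mx.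
  by apply: (@closed_comp _ _ h [set x | x <= 1]) => //; exact: closed_le.
have mSO := measurable_SO; have mS := measurable_sphere; have mu1 := hmu.1; have s1 := hs.1.
pose Y1 := [set p : borel_mx R n n * borel_mx R 1 n | SO R n p.1 /\ h (p.2 *m p.1) <= 1].
pose Y2 := [set p : borel_mx R 1 n * borel_mx R 1 n | sphere R n p.1 /\ h (enorm p.2 *: (p.1 : 'rV[R]_n)) <= 1].
have mY1 : measurable Y1.
  apply: measurableI.
    have := @mx2_measurable R n n 1 n n n (fun t u => t) _ _ mSO.
    by apply=> z; exact: cvg_fst.
  apply: (@mx2_measurable R n n 1 n 1 n (fun t u => u *m t)) mh => // z.
  by apply: mulmx_continuous_at; [exact: cvg_snd|exact: cvg_fst].
have mY2 : measurable Y2.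
  apply: measurableI.
    have := @mx2_measurable R 1 n 1 n 1 n (fun t u => t) _ _ mS.
    by apply=> z; exact: cvg_fst.
  apply: (@mx2_measurable R 1 n 1 n 1 n (fun u x => enorm x *: u)) mh => // z.
  apply: cvgZ; last exact: cvg_fst.
  by apply: (@continuous_comp _ _ _ snd (@enorm R n) z); [exact: cvg_snd|exact: enorm_continuous].
have := tonelli_set mu (lebesgue_mx n) mY1.
rewrite (full_integral_cst mSO mu1 (c := lebesgue_mx n [set x | h x <= 1]))//; last 2 first.
- move=> t ht; rewrite -(lebesgue_mx_orthogonal (SO_orthogonal ht) mh).
  by congr (lebesgue_mx n _); apply/seteqP; split=> x /=; rewrite /Y1/= => -[]//.
- move=> t ht; rewrite (_ : [set y | _] = set0) ?measure0//.
  by apply/seteqP; split=> u //=; rewrite /Y1/= => -[].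
move=> ->.
transitivity (\int[lebesgue_mx n]_x sigma [set u | Y2 (u, x)])%E.
  apply: eq_integral => x _.
  have [->|x0] := eqVneq (x : 'rV[R]_n) 0.
    rewrite (_ : [set _ | _] = SO R n); last first.
      apply/seteqP; split=> t; rewrite /Y1/=; first by case.
      by move=> ht; split=> //; rewrite mul0mx -(scale0r 0) hh// mul0r.
    rewrite (_ : [set u | Y2 _] = sphere R n) ?mu1 ?s1//.
    apply/seteqP; split=> t; rewrite /Y2/=; first by case.
    by move=> ht; split=> //; rewrite enorm0 hh// mul0r.
  pose e := (enorm x)^-1 *: (x : 'rV[R]_n); have he := sphere_normalize x0.
  have mY2x : measurable [set u | Y2 (u, x)].
    by have := measurable_ysection x mY2; rewrite ysectionE.
  have mY1x : measurable [set t | Y1 (t, x)].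
    by have := measurable_ysection x mY1; rewrite ysectionE.
  rewrite (sphere_measureE hn hs he mY2x) -[LHS](full_setI mSO mu1)//.
  rewrite -[RHS](full_setI mSO mu1); last first.
    apply: (@mx_measurable R n n 1 n (fun t => (enorm x)^-1 *: x *m t)) => // t.
    exact: mulmx_continuousl.
  have E t : enorm x *: ((enorm x)^-1 *: (x : 'rV[R]_n) *m t) = x *m t.
    by rewrite -scalemxAl scalerA divff ?scale1r// enorm_eq0.
  congr (mu _); apply/seteqP; split=> t /=; rewrite /Y1/Y2/= E; last by move=> [? [? ?]].
  by move=> [ht [_ ?]]; split=> //; split=> //; exact: SO_sphere.
rewrite -(tonelli_set sigma (lebesgue_mx n) mY2).
rewrite [RHS]integral_mkcond; apply: eq_integral => u _; rewrite /patch.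
case: ifPn => [/set_mem hu|/negP hu]; last first.
  rewrite (_ : [set y | _] = set0) ?measure0//.
  by apply/seteqP; split=> x //=; rewrite /Y2/= => -[] /mem_set.
have hu0 := hpos u hu.
have hi0 : 0 < (h u)^-1 by rewrite invr_gt0.
rewrite -exprVn -(lebesgue_mx_scale hi0 (@measurable_eball _ n)).
congr (lebesgue_mx n _); apply/seteqP; split=> x /=; rewrite /Y2/eball/= invrK enormZ gtr0_norm// hh ?enorm_ge0//.
  by rewrite mulrC => -[].
by rewrite mulrC.
Qed.

Lemma within_continuous_inv_expr (T : topologicalType) (D : set T) (F : T -> R) k :
  {within D, continuous F} -> (forall x, D x -> F x != 0) ->
  {within D, continuous (fun x => F x ^- k)}.
Proof.
move=> cF F0; rewrite continuous_subspace_in => x /set_mem Dx.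
apply: (@cvgV _ _ _ _ (fun x => F x ^+ k)); first by rewrite expf_neq0// F0.
apply: (@continuous_comp (subspace D) R R F (fun y => y ^+ k)); first exact: cF.
exact: exprn_continuous.
Qed.

Lemma sublevel_volE sigma (h : 'rV[R]_n -> R) : (2 <= n)%N ->
  sphere_invariant_measure sigma -> continuous h ->
  (forall a x, 0 <= a -> h (a *: x) = a * h x) ->
  (forall u, sphere R n u -> 0 < h u) ->
  vol [set x | h x <= 1] = kappa R n * \int[sigma]_(u in sphere R n) ((h u) ^- n).
Proof.
move=> hn hs hc hh hpos; have mS := measurable_sphere.
have mh : measurable ([set x | h x <= 1] : set (borel_mx R 1 n)).
  apply: closed_measurable_mx.
  by apply: (@closed_comp _ _ h [set x | x <= 1]) => //; exact: closed_le.
rewrite /vol /kappa /vol !lebesgue_mxE//; last exact: measurable_eball.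
rewrite (sublevel_measureE hn hs)//.
have cF : {within sphere R n, continuous (fun u => h u ^- n)}.
  apply: within_continuous_inv_expr; first exact: continuous_subspaceT.
  by move=> u /hpos /gt_eqF ->.
have mF := continuous_measurable_within (@sphere_closed R n) cF.
have [M _ hM] := continuous_compact_bounded (@sphere_compact R n) cF.
have iF := @bounded_integrable _ _ _ sigma _ _ _ mS mF hM.
rewrite ge0_integralZr//; last 2 first.
  exact/measurable_EFinP.
  by move=> u hu; rewrite lee_fin invr_ge0 exprn_ge0// ltW// hpos.
have I1 := integrable_fin_num mS iF.
have I2 : lebesgue_mx n (eball R n) \is a fin_num.
  rewrite ge0_fin_numE; last exact: measure_ge0.
  by apply: (@lebesgue_mx_bounded_lty _ n _ 1); first exact: measurable_eball.
by rewrite [RHS]mulrC (fineM I1 I2).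
Qed.

End InvariantMeasures.

(** * Convex bodies and support functions *)

Section ConvexBodies.
Context {R : realType} {n : nat}.
Implicit Types (K L : set 'rV[R]_n) (x y u v z : 'rV[R]_n).

Lemma convex_setP K : convex_set (K : set (convex_lmodType 'rV[R]_n)) <->
  forall x y (a : R), 0 <= a -> a <= 1 -> K x -> K y -> K (a *: x + (1 - a) *: y).
Proof.
split=> [h x y a a0 a1 Kx Ky|h x y a /set_mem Kx /set_mem Ky].
  have a01 : Itv.spec (@Itv.num_sem R) (Itv.Real `[0%Z, 1%Z]) a.
    by apply/and3P; split; rewrite ?num_real// /= in_itv/= a0 a1.
  have := h x y (Itv.mk a01); rewrite !inE => /(_ Kx Ky).
  by rewrite /conv/= /GRing.scale.
rewrite inE; exact: (h _ _ a%:num _ _ Kx Ky).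
Qed.

(** The form in which non-empty interior is used: a Euclidean ball, whereas the topology of row
    vectors comes from the sup norm. *)
Definition has_ball K := exists x0 (r : R), 0 < r /\ forall y, enorm y <= r -> K (x0 + y).

Lemma interior_has_ball K : K° !=set0 -> has_ball K.
Proof.
case=> x0 /nbhs_ballP[e /= e0 eK]; exists x0, (e / 2); split; first by rewrite divr_gt0.
move=> y hy; apply: eK; rewrite -ball_normE /ball_/= opprD addrA subrr add0r normrN.
by apply: le_lt_trans (norm_le_enorm _) _; apply: le_lt_trans hy _; rewrite ltr_pdivrMr// ltr_pMr// ltr1n.
Qed.

Lemma body_bounded K : convex_body K -> exists2 r, 0 < r & forall x, K x -> enorm x <= r.
Proof.
case=> _ cK _; have cN : {within K, continuous (@enorm R n)}.
  by apply: continuous_subspaceT; exact: enorm_continuous.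
have [M M0 hM] := continuous_compact_bounded cK cN.
by exists M => // x /hM; rewrite ger0_norm// enorm_ge0.
Qed.

Lemma support_fun_attained K u : convex_body K -> exists2 x, K x & support_fun K u = dot u x.
Proof.
case=> K0 cK _; have cD : {within K, continuous (dot u)}.
  apply: continuous_subspaceT => x.
  by apply: (@dot_continuous_at _ _ _ (cst u) id); [exact: cst_continuous|exact: cvg_id].
have [x /set_mem Kx hx] := compact_EVT_max K0 cK cD.
exists x => //; apply/eqP; rewrite eq_le; apply/andP; split.
  apply: ge_sup; first by exists (dot u x), x.
  by move=> _ [y Ky <-]; apply: hx; rewrite inE.
apply: ub_le_sup; last by exists x.
by exists (dot u x) => _ [y Ky <-]; apply: hx; rewrite inE.
Qed.

Lemma le_support_fun K u x : convex_body K -> K x -> dot u x <= support_fun K u.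
Proof.
move=> bK Kx; have [r _ hr] := body_bounded bK.
apply: ub_le_sup; last by exists x.
exists (enorm u * r) => _ [y Ky <-]; apply: le_trans (dot_le _ _) _.
by rewrite ler_wpM2l ?enorm_ge0// hr.
Qed.

Lemma support_fun_le K u c : convex_body K -> (forall x, K x -> dot u x <= c) ->
  support_fun K u <= c.
Proof. by move=> bK h; have [x Kx ->] := support_fun_attained u bK; exact: h. Qed.

Lemma support_funZ K a u : convex_body K -> 0 <= a ->
  support_fun K (a *: u) = a * support_fun K u.
Proof.
move=> bK a0; apply/eqP; rewrite eq_le; apply/andP; split.
  apply: support_fun_le => // x Kx; rewrite dotZl ler_wpM2l//.
  exact: le_support_fun.
have [x Kx ->] := support_fun_attained u bK.
by rewrite -dotZl; exact: le_support_fun.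
Qed.

Lemma support_fun_lipschitz K r : convex_body K -> (forall x, K x -> enorm x <= r) ->
  forall u v, `|support_fun K u - support_fun K v| <= r * enorm (u - v).
Proof.
move=> bK hr.
have H u v : support_fun K u - support_fun K v <= r * enorm (u - v).
  have [x Kx ->] := support_fun_attained u bK.
  have := le_support_fun v bK Kx.
  have : dot (u - v) x <= r * enorm (u - v).
    apply: le_trans (dot_le _ _) _; rewrite mulrC ler_wpM2r ?enorm_ge0//.
    exact: hr.
  by rewrite dotBl; lra.
by move=> u v; rewrite ler_norml H lerNl opprB enormB H.
Qed.

Lemma support_fun_continuous K : convex_body K -> continuous (support_fun K).
Proof.
move=> bK; have [r r0 hr] := body_bounded bK.
have hl := support_fun_lipschitz bK hr.
move=> u A /nbhs_ballP[e /= e0 eA].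
have rn : 0 < r * n.+1%:R by rewrite mulr_gt0.
have d0 : 0 < e / (r * n.+1%:R) by rewrite divr_gt0.
apply/nbhs_ballP; exists (e / (r * n.+1%:R)) => //= v.
rewrite -ball_normE /ball_/= => huv; apply: eA; rewrite /ball/=.
apply: le_lt_trans (hl _ _) _; apply: (@le_lt_trans _ _ (r * n.+1%:R * `|u - v|)).
  rewrite -mulrA (ler_wpM2l (ltW r0))//; apply: le_trans (enorm_le_norm _) _.
  by rewrite ler_wpM2r// ler_nat.
by rewrite mulrC -ltr_pdivlMr.
Qed.

(** The separating direction points from the nearest point y of K to x. *)
Lemma separation K x : convex_body K -> ~ K x ->
  exists2 u, sphere R n u & support_fun K u < dot u x.
Proof.
move=> bK nKx; have [K0 cK /convex_setP vK] := bK.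
have cD : {within K, continuous (fun y => enorm (x - y))}.
  apply: continuous_subspaceT => y.
  apply: (@continuous_comp _ _ _ (fun y => x - y) (@enorm R n)); last exact: enorm_continuous.
  by apply: (@continuousB R 'rV[R]_n _ (cst x) id); [exact: cst_continuous|exact: cvg_id].
have [y /set_mem Ky hy] := compact_EVT_min K0 cK cD.
have xy : x - y != 0 by rewrite subr_eq0; apply/eqP => xy; apply: nKx; rewrite xy.
have key z : K z -> dot (x - y) (z - y) <= 0.
  move=> Kz; rewrite leNgt; apply/negP => hpos.
  have d0 : 0 < dot (z - y) (z - y).
    rewrite lt_def dot_ge0 andbT dot_eq0; apply/eqP => h.
    by move: hpos; rewrite h dot0r ltxx.
  (* The parameter of the point closest to x on the line from y through z, capped at 1 to stay on
     the segment; the resulting point of K would be closer to x than y. *)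
  pose a := Num.min 1 (dot (x - y) (z - y) / dot (z - y) (z - y)).
  have a0 : 0 < a by rewrite lt_min ltr01 divr_gt0.
  have a1 : a <= 1 by rewrite ge_min lexx.
  have := hy (a *: z + (1 - a) *: y).
  rewrite inE => /(_ (vK z y a (ltW a0) a1 Kz Ky)).
  have -> : x - (a *: z + (1 - a) *: y) = (x - y) - a *: (z - y).
    rewrite scalerBl scale1r scalerBr !opprD !opprK !addrA.
    by rewrite (addrAC x).
  rewrite -(@ler_pXn2r _ 2) ?nnegrE ?enorm_ge0// !enorm_sqr.
  have E p q : dot (p - a *: q) (p - a *: q) = dot p p - 2 * a * dot p q + a ^+ 2 * dot q q :> R.
    by rewrite dotBl !dotBr !dotZl !dotZr (dotC q p); ring.
  rewrite E.
  have : a * dot (z - y) (z - y) <= dot (x - y) (z - y).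
    by rewrite -ler_pdivlMr// ge_min lexx orbT.
  set A := dot (x - y) (x - y); set B := dot (x - y) (z - y) in hpos *.
  set C := dot (z - y) (z - y) in d0 *.
  move=> h1 h2; have : a * (2 * B) <= a * (a * C) by lra.
  by rewrite ler_pM2l//; lra.
exists ((enorm (x - y))^-1 *: (x - y)); first exact: sphere_normalize.
rewrite support_funZ ?invr_ge0 ?enorm_ge0// dotZl ltr_pM2l ?invr_gt0 ?enorm_gt0//.
apply: (@le_lt_trans _ _ (dot (x - y) y)).
  by apply: support_fun_le => // z /key; rewrite dotBr subr_le0.
by rewrite -subr_gt0 -dotBr lt_def dot_ge0 dot_eq0 xy.
Qed.

Lemma support_fun_sub K L : convex_body K -> convex_body L ->
  (forall u, sphere R n u -> support_fun K u <= support_fun L u) -> K `<=` L.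
Proof.
move=> bK bL h x Kx; apply: contrapT => nLx.
have [u hu] := separation bL nLx; rewrite ltNge => /negP; apply.
by apply: le_trans (h u hu); exact: le_support_fun.
Qed.

Lemma support_fun_inj K L : convex_body K -> convex_body L ->
  (forall u, sphere R n u -> support_fun K u = support_fun L u) -> K = L.
Proof.
by move=> bK bL h; apply/seteqP; split; apply: support_fun_sub => // u hu; rewrite h.
Qed.

Lemma minkowski_add_body K L : convex_body K -> convex_body L -> convex_body (minkowski_add K L).
Proof.
move=> [[x Kx] cK /convex_setP vK] [[y Ly] cL /convex_setP vL]; split.
- by exists (x + y), x => //; exists y.
- rewrite (_ : minkowski_add K L = (fun p : 'rV[R]_n * 'rV[R]_n => p.1 + p.2) @` (K `*` L)).
    apply: continuous_compact; last exact: compact_setX.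
    apply: continuous_subspaceT => p.
    by apply: cvgD; [exact: cvg_fst|exact: cvg_snd].
  apply/seteqP; split=> z.
    by move=> [a Ka [b Lb <-]]; exists (a, b).
  by move=> [[a b] [/= Ka Lb] <-]; exists a => //; exists b.
- apply/convex_setP => _ _ a a0 a1 [x1 Kx1 [y1 Ly1 <-]] [x2 Kx2 [y2 Ly2 <-]].
  exists (a *: x1 + (1 - a) *: x2); first exact: vK.
  exists (a *: y1 + (1 - a) *: y2); first exact: vL.
  by rewrite !scalerDr addrACA.
Qed.

Lemma linear_image_compact m K (G : 'M[R]_(n, m)) : compact K -> compact [set x *m G | x in K].
Proof.
move=> cK; apply: continuous_compact => //; apply: continuous_subspaceT => x.
apply: (@mulmx_continuous_at _ _ 1 n m id (cst G)); last exact: cst_continuous.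
exact: cvg_id.
Qed.

Lemma dilate_body K a : convex_body K -> convex_body (dilate a K).
Proof.
move=> [[x Kx] cK /convex_setP vK]; split.
- by exists (a *: x), x.
- rewrite (_ : dilate a K = [set x *m a%:M | x in K]); first exact: linear_image_compact.
  by congr image; apply/funext => y; rewrite mul_mx_scalar.
- apply/convex_setP => _ _ b b0 b1 [x1 Kx1 <-] [x2 Kx2 <-].
  exists (b *: x1 + (1 - b) *: x2); first exact: vK.
  by rewrite scalerDr !scalerA ![a * _]mulrC.
Qed.

Lemma translate_body K x : convex_body K -> convex_body (translate K x).
Proof.
move=> bK; rewrite (_ : translate K x = minkowski_add K [set x]).
  apply: minkowski_add_body => //; split; [by exists x|exact: compact_set1|].
  by apply/convex_setP => _ _ a _ _ -> ->; rewrite -scalerDl addrC subrK scale1r.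
apply/seteqP; split=> z; first by move=> [y Ky <-]; exists y => //; exists x.
by move=> [y Ky [_ -> <-]]; exists y.
Qed.

Lemma eball_body : convex_body (eball R n).
Proof.
split; [by exists 0; rewrite /eball/= enorm0|exact: eball_compact|].
apply/convex_setP => x y a a0 a1; rewrite /eball/= => hx hy.
have b0 : 0 <= 1 - a by rewrite subr_ge0.
apply: le_trans (enormD _ _) _; rewrite !enormZ !ger0_norm//.
rewrite -[leRHS](subrK a) addrC lerD//; first by rewrite ler_piMr.
by rewrite ler_piMr.
Qed.

Lemma support_fun_eball u : support_fun (eball R n) u = enorm u.
Proof.
apply/eqP; rewrite eq_le; apply/andP; split.
  apply: support_fun_le; first exact: eball_body.
  move=> x hx; apply: le_trans (dot_le _ _) _.
  by rewrite ler_piMr ?enorm_ge0.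
have [->|u0] := eqVneq u 0.
  have := @le_support_fun (eball R n) 0 0 eball_body; rewrite dot0l enorm0; apply.
  by rewrite /eball/= enorm0.
have -> : enorm u = dot u ((enorm u)^-1 *: u).
  by rewrite dotZr -enorm_sqr expr2 mulKf// enorm_eq0.
apply: le_support_fun; first exact: eball_body.
by rewrite /eball/= (sphere_normalize u0).
Qed.

Lemma support_fun_minkowski K L u : convex_body K -> convex_body L ->
  support_fun (minkowski_add K L) u = support_fun K u + support_fun L u.
Proof.
move=> bK bL; have bKL := minkowski_add_body bK bL.
apply/eqP; rewrite eq_le; apply/andP; split.
  apply: support_fun_le => // _ [x Kx [y Ly <-]]; rewrite dotDr.
  by apply: lerD; exact: le_support_fun.
have [x Kx ->] := support_fun_attained u bK; have [y Ly ->] := support_fun_attained u bL.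
by rewrite -dotDr; apply: le_support_fun => //; exists x => //; exists y.
Qed.

Lemma support_fun_dilate K a u : convex_body K ->
  support_fun (dilate a K) u = support_fun K (a *: u).
Proof.
move=> bK; have bD := dilate_body a bK; apply/eqP; rewrite eq_le; apply/andP; split.
  apply: support_fun_le => // _ [x Kx <-]; rewrite dotZr -dotZl.
  exact: le_support_fun.
have [x Kx ->] := support_fun_attained (a *: u) bK.
by rewrite dotZl -dotZr; apply: le_support_fun => //; exists x.
Qed.

Lemma support_fun_translate K c u : convex_body K ->
  support_fun (translate K c) u = support_fun K u + dot u c.
Proof.
move=> bK; have bT := translate_body c bK; apply/eqP; rewrite eq_le; apply/andP; split.
  apply: support_fun_le => // _ [x Kx <-]; rewrite dotDr lerD2r.
  exact: le_support_fun.
have [x Kx ->] := support_fun_attained u bK.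
by rewrite -dotDr; apply: le_support_fun => //; exists x.
Qed.

Lemma sub_minkowski_support K L r u : convex_body K -> convex_body L -> 0 <= r ->
  sphere R n u -> K `<=` minkowski_add L (dilate r (eball R n)) ->
  support_fun K u <= support_fun L u + r.
Proof.
move=> bK bL r0 hu sub; have bD := dilate_body r eball_body.
have bM := minkowski_add_body bL bD.
apply: support_fun_le => // x /sub Mx; apply: le_trans (le_support_fun u bM Mx) _.
rewrite support_fun_minkowski// support_fun_dilate; last exact: eball_body.
by rewrite support_fun_eball enormZ ger0_norm// hu mulr1.
Qed.

Lemma support_minkowski_sub K L r : convex_body K -> convex_body L -> 0 <= r ->
  (forall u, sphere R n u -> support_fun K u <= support_fun L u + r) ->
  K `<=` minkowski_add L (dilate r (eball R n)).
Proof.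
move=> bK bL r0 h; have bD := dilate_body r eball_body.
have bM := minkowski_add_body bL bD.
apply: support_fun_sub => // u hu; rewrite support_fun_minkowski// support_fun_dilate; last exact: eball_body.
by rewrite support_fun_eball enormZ ger0_norm// (hu : enorm u = 1) mulr1 h.
Qed.

Lemma hausdorff_support_le K L d : convex_body K -> convex_body L -> hausdorff_dist K L < d ->
  forall u, sphere R n u -> `|support_fun K u - support_fun L u| <= d.
Proof.
move=> bK bL hd u hu.
have [r [r0 h1 h2] rd] : exists2 r : R, [set r : R | [/\ 0 <= r,
    K `<=` minkowski_add L (dilate r (eball R n)) &
    L `<=` minkowski_add K (dilate r (eball R n))]] r & r < d.
  (* A radius below d exists only if some radius is admissible at all: the sum of radii of centred
     balls containing K and L is, by comparing support functions. *)
  suff hi : has_inf [set r : R | [/\ 0 <= r,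
      K `<=` minkowski_add L (dilate r (eball R n)) &
      L `<=` minkowski_add K (dilate r (eball R n))]].
    have := inf_adherent (_ : 0 < d - hausdorff_dist K L) hi.
    by rewrite subr_gt0 => /(_ hd); rewrite /hausdorff_dist addrC subrK.
  split; last by exists 0 => r [].
  have [r r0 hr] := body_bounded bK; have [s s0 hs] := body_bounded bL.
  have habs M c v : convex_body M -> (forall x, M x -> enorm x <= c) -> sphere R n v ->
      `|support_fun M v| <= c.
    move=> bM hM hv; have [x Mx ->] := support_fun_attained v bM.
    by apply: le_trans (cauchy_schwarz _ _) _; rewrite hv mul1r hM.
  exists (r + s); split; first by rewrite ltW// addr_gt0.
    apply: support_minkowski_sub => // [|v hv]; first by rewrite ltW// addr_gt0.
    have := habs K r v bK hr hv; have := habs L s v bL hs hv.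
    by rewrite !ler_norml => /andP[? ?] /andP[? ?]; lra.
  apply: support_minkowski_sub => // [|v hv]; first by rewrite ltW// addr_gt0.
  have := habs K r v bK hr hv; have := habs L s v bL hs hv.
  by rewrite !ler_norml => /andP[? ?] /andP[? ?]; lra.
have := sub_minkowski_support bK bL r0 hu h1.
have := sub_minkowski_support bL bK r0 hu h2.
by rewrite ler_norml => ? ?; apply/andP; split; lra.
Qed.

Lemma hausdorff_parallel_le L d : convex_body L -> 0 <= d ->
  hausdorff_dist L (minkowski_add L (dilate d (eball R n))) <= d.
Proof.
move=> bL d0; apply: ge_inf; first by exists 0 => r [].
have bD := dilate_body d eball_body.
have d00 : dilate d (eball R n) 0 by exists 0; rewrite ?scaler0// /eball/= enorm0.
split=> // x Lx; exists x; last by exists 0; rewrite ?addr0.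
by exists x => //; exists 0; rewrite ?addr0.
Qed.

Lemma parallel_has_ball L d : convex_body L -> 0 < d ->
  has_ball (minkowski_add L (dilate d (eball R n))).
Proof.
move=> [[x Lx] _ _] d0; exists x, d; split=> // y hy; exists x => //.
exists y => //; exists (d^-1 *: y); last by rewrite scalerA divff ?scale1r// gt_eqF.
rewrite /eball/= enormZ gtr0_norm ?invr_gt0//.
by rewrite mulrC ler_pdivrMr// mul1r.
Qed.

End ConvexBodies.

(** * Volumes of projections *)

Section Volume.
Context {R : realType} {m : nat}.
Implicit Types (A B : set 'rV[R]_m).

Lemma compact_measurable_mx p q (A : set 'M[R]_(p, q)) : compact A ->
  measurable (A : set (borel_mx R p q)).
Proof.
by move=> cA; apply: closed_measurable_mx; apply: compact_closed cA; exact: norm_hausdorff.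
Qed.

Lemma compact_enorm_bounded A : compact A -> exists2 r, 0 < r & forall x, A x -> enorm x <= r.
Proof.
move=> cA; have cN : {within A, continuous (@enorm R m)}.
  by apply: continuous_subspaceT; exact: enorm_continuous.
have [M M0 hM] := continuous_compact_bounded cA cN.
by exists M => // x /hM; rewrite ger0_norm// enorm_ge0.
Qed.

Lemma compact_lebesgue_fin A : compact A -> lebesgue_mx m A \is a fin_num.
Proof.
move=> cA; have [r _ hr] := compact_enorm_bounded cA.
rewrite ge0_fin_numE; last exact: measure_ge0.
exact: lebesgue_mx_bounded_lty (compact_measurable_mx cA) hr.
Qed.

Lemma volE A : compact A -> (vol A)%:E = lebesgue_mx m A.
Proof.
move=> cA; rewrite /vol lebesgue_mxE; last exact: compact_measurable_mx.
by rewrite fineK//; exact: compact_lebesgue_fin.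
Qed.

Lemma vol_ge0 A : compact A -> 0 <= vol A.
Proof. by move=> cA; rewrite -lee_fin volE//; exact: measure_ge0. Qed.

Lemma vol_le A B : compact A -> compact B -> A `<=` B -> vol A <= vol B.
Proof.
move=> cA cB AB; rewrite -lee_fin !volE//.
by apply: le_measure; rewrite ?inE//; exact: compact_measurable_mx.
Qed.

Lemma translate_compact A b : compact A -> compact (translate A b).
Proof.
move=> cA; apply: continuous_compact => //; apply: continuous_subspaceT => x.
by apply: (@continuousD R 'rV[R]_m _ id (cst b)); [exact: cvg_id|exact: cst_continuous].
Qed.

Lemma dilate_compact A a : compact A -> compact (dilate a A).
Proof.
move=> cA; rewrite (_ : dilate a A = [set x *m a%:M | x in A]).
  exact: linear_image_compact.
by congr image; apply/funext => y; rewrite mul_mx_scalar.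
Qed.

Lemma vol_translate A b : compact A -> vol (translate A b) = vol A.
Proof.
move=> cA; apply: EFin_inj; rewrite !volE//; last exact: translate_compact.
rewrite -[RHS](lebesgue_mx_translate (- b)); last exact: compact_measurable_mx.
congr (lebesgue_mx m _); apply/seteqP; split=> x /=; first by move=> [y Ay <-]; rewrite addrK.
by move=> h; exists (x - b) => //; rewrite subrK.
Qed.

Lemma vol_dilate A a : compact A -> 0 < a -> vol (dilate a A) = a ^+ m * vol A.
Proof.
move=> cA a0; apply: EFin_inj; rewrite EFinM !volE//; last exact: dilate_compact.
rewrite -lebesgue_mx_scale//; last exact: compact_measurable_mx.
have ane0 : a != 0 by rewrite gt_eqF.
congr (lebesgue_mx m _); apply/seteqP; split=> x /=.
  by move=> [y Ay <-]; rewrite scalerA mulVf// scale1r.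
by move=> h; exists (a^-1 *: x) => //; rewrite scalerA divff// scale1r.
Qed.

Lemma vol_orthogonal A t : compact A -> orthogonal R m t -> vol (mximage A t) = vol A.
Proof.
move=> cA ot; apply: EFin_inj; rewrite !volE//; last exact: linear_image_compact.
rewrite -[RHS](lebesgue_mx_orthogonal (orthogonal_trmx ot)); last exact: compact_measurable_mx.
congr (lebesgue_mx m _); apply/seteqP; split=> x /=.
  by move=> [y Ay <-]; rewrite -mulmxA ot mulmx1.
by move=> h; exists (x *m t^T) => //; rewrite -mulmxA orthogonalC// mulmx1.
Qed.

Lemma kappa_gt0 : 0 < kappa R m.
Proof.
rewrite -lte_fin /kappa volE; last exact: eball_compact.
exact: lebesgue_mx_eball_gt0.
Qed.

Lemma vol_ball_le A p r : compact A -> 0 < r -> (forall y, enorm y <= r -> A (p + y)) ->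
  r ^+ m * kappa R m <= vol A.
Proof.
move=> cA r0 h; rewrite -vol_dilate//; last exact: eball_compact.
have cD := @dilate_compact _ r (@eball_compact R m).
rewrite -(vol_translate p cD); apply: vol_le => //; first exact: translate_compact.
move=> _ [_ [y hy <-] <-]; rewrite addrC; apply: h.
by rewrite enormZ gtr0_norm// ler_piMr// ltW.
Qed.

(* If q = p + r b lies in A for every b in the unit ball, then a point of B,
   being of the form k + (e / r) (q - p) with k in A, lies in the dilate of the
   convex set A from p by the factor 1 + e / r. *)
Lemma vol_enlarge A B p r e : compact A -> compact B ->
  convex_set (A : set (convex_lmodType 'rV[R]_m)) -> 0 < r -> 0 <= e ->
  (forall y, enorm y <= r -> A (p + y)) ->
  (forall z, B z -> exists2 k, A k & enorm (z - k) <= e) ->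
  vol B <= (1 + e / r) ^+ m * vol A.
Proof.
move=> cA cB /convex_setP vA r0 e0 hA hB; pose a := 1 + e / r.
have er0 : 0 <= e / r by rewrite divr_ge0// ltW.
have a0 : 0 < a by rewrite ltr_pwDl.
have ane0 : a != 0 by rewrite gt_eqF.
have rne0 : r != 0 by rewrite gt_eqF.
have cT := @translate_compact _ (- p) cA; have cD := @dilate_compact _ a cT.
have cT2 := @translate_compact _ p cD.
rewrite -(vol_translate (- p) cA) -(vol_dilate cT a0) -(vol_translate p cD).
apply: vol_le => // z Bz; have [k Ak hk] := hB z Bz.
have [e00|ene0] := eqVneq e 0.
  have zk : z = k.
    apply/eqP; rewrite -subr_eq0 -enorm_eq0; apply/eqP/le_anti.
    by rewrite enorm_ge0 andbT -e00.
  have a1 : a = 1 by rewrite /a e00 mul0r addr0.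
  exists (k - p); last by rewrite zk subrK.
  by exists (k - p); [exists k|rewrite a1 scale1r].
pose q := p + (r / e) *: (z - k).
have Aq : A q.
  have epos : 0 < e by rewrite lt_def ene0.
  apply: hA; rewrite enormZ gtr0_norm ?divr_gt0//.
  by rewrite mulrAC ler_pdivrMr// ler_pM2l.
have b0 : 0 <= a^-1 by rewrite invr_ge0 ltW.
have b1 : a^-1 <= 1 by rewrite invf_le1// lerDl.
have Aw := vA k q a^-1 b0 b1 Ak Aq.
exists (z - p); last by rewrite subrK.
exists (a^-1 *: k + (1 - a^-1) *: q - p); first by exists (a^-1 *: k + (1 - a^-1) *: q).
have re0 : r + e != 0 by rewrite gt_eqF// ltr_pwDl.
by apply/rowP => j; rewrite /a /q !mxE; field; rewrite rne0 ene0 re0.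
Qed.

End Volume.

Section ProjectionVolume.
Context {R : realType} {i n : nat}.
Implicit Types (K L : set 'rV[R]_n) (E t : 'M[R]_n) (F : 'M[R]_(i, n)).

(** Two orthonormal bases F and F' of E differ by the orthogonal matrix F F'^T of size i, which
    preserves volume; so the basis picked by [xget] is immaterial. *)
Lemma proj_volE K E F : compact K -> orthonormal_basis E F ->
  proj_vol i K E = vol [set x *m F^T | x in K].
Proof.
move=> cK hF; rewrite /proj_vol; set F' := xget _ _.
have [F1' F2'] : orthonormal_basis E F'.
  by rewrite /F'; case: xgetP => [F0 -> //|] /(_ F).
have [F1 F2] := hF.
have -> : [set y *m F'^T | y in mximage K E] = mximage [set x *m F^T | x in K] (F *m F'^T).
  have e x : x *m E *m F'^T = x *m F^T *m (F *m F'^T).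
    by rewrite -F2 !mulmxA.
  apply/seteqP; split=> z /=.
    by move=> [_ [x Kx <-] <-]; exists (x *m F^T); [exists x|rewrite e].
  by move=> [_ [x Kx <-] <-]; exists (x *m E); [exists x|rewrite e].
apply: vol_orthogonal; first exact: linear_image_compact.
rewrite /orthogonal/= trmx_mul trmxK mulmxA -(mulmxA F) F2'.
by rewrite -F2 mulmxA F1 mul1mx F1.
Qed.

(** For y = x F^T one has |y|^2 = <x, y F> <= |x| |y|, since F embeds isometrically. *)
Lemma frame_contract F x : F *m F^T = 1%:M -> enorm (x *m F^T) <= enorm x.
Proof.
move=> F1; have eF (y : 'rV[R]_i) : enorm (y *m F) = enorm y.
  by rewrite /enorm dot_mulmx -mulmxA F1 mulmx1.
set y := x *m F^T; have [->|y0] := eqVneq (enorm y) 0; first exact: enorm_ge0.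
have ypos : 0 < enorm y by rewrite lt_def y0 enorm_ge0.
rewrite -(ler_pM2r ypos) -expr2 enorm_sqr {1}/y dot_mulmx trmxK.
by apply: le_trans (dot_le _ _) _; rewrite eF.
Qed.

Lemma frame_isometry F (y : 'rV[R]_i) : F *m F^T = 1%:M -> enorm (y *m F) = enorm y.
Proof. by move=> F1; rewrite /enorm dot_mulmx -mulmxA F1 mulmx1. Qed.

Lemma proj_vol_eball E : Gr R i n E -> proj_vol i (eball R n) E = kappa R i.
Proof.
move=> hE; have [F hF] := Gr_basis hE; have [F1 F2] := hF.
rewrite (proj_volE (@eball_compact R n) hF); congr vol; apply/seteqP; split=> y /=.
  by move=> [x hx <-]; apply: le_trans hx; exact: frame_contract.
move=> hy; exists (y *m F); last by rewrite -mulmxA F1 mulmx1.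
by rewrite /eball/= frame_isometry.
Qed.

Lemma frame_image_ball K F x0 r : F *m F^T = 1%:M ->
  (forall y, enorm y <= r -> K (x0 + y)) ->
  forall y, enorm y <= r -> [set x *m F^T | x in K] (x0 *m F^T + y).
Proof.
move=> F1 hK y hy; exists (x0 + y *m F); first by apply: hK; rewrite frame_isometry.
by rewrite mulmxDl -mulmxA F1 mulmx1.
Qed.

Lemma enorm_mulmx_le x t : enorm (x *m t) <= n%:R * (n%:R * enorm x * `|t|).
Proof.
apply: le_trans (enorm_le_norm _) _; rewrite ler_wpM2l//.
rewrite [leLHS]/Num.norm/= mx_normrE; apply/bigmax_leP; split=> [|[a j] _ /=].
  by rewrite mulr_ge0// mulr_ge0// enorm_ge0.
rewrite ord1 mxE; apply: le_trans (ler_norm_sum _ _ _) _.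
rewrite -mulrA mulr_natl -[n in _ *+ n]card_ord -sumr_const; apply: ler_sum => k _.
rewrite normrM; apply: ler_pM => //; first exact: coord_le.
by rewrite [leRHS]/Num.norm/= mx_normrE; apply/bigmax_geP; right; exists (k, j).
Qed.

Lemma linear_image_convex m K (G : 'M[R]_(n, m)) :
  convex_set (K : set (convex_lmodType 'rV[R]_n)) ->
  convex_set ([set x *m G | x in K] : set (convex_lmodType 'rV[R]_m)).
Proof.
move=> /convex_setP vK; apply/convex_setP => _ _ a a0 a1 [x Kx <-] [y Ky <-].
by exists (a *: x + (1 - a) *: y); [exact: vK|rewrite mulmxDl -!scalemxAl].
Qed.

Lemma frame_vol_gt0 K F : convex_body K -> has_ball K -> F *m F^T = 1%:M ->
  0 < vol [set x *m F^T | x in K].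
Proof.
move=> [_ cK _] [x0 [r [r0 hr]]] F1.
apply: lt_le_trans (vol_ball_le _ r0 (frame_image_ball F1 hr)).
  by rewrite mulr_gt0 ?exprn_gt0// kappa_gt0.
exact: linear_image_compact.
Qed.

(** Each point of one image is close to the point of the other coming from the same x, and
    [vol_enlarge] turns this distance into a multiplicative bound by means of the ball inside the
    image. *)
Lemma frame_vol_lipschitz K F : convex_body K -> has_ball K -> F *m F^T = 1%:M ->
  exists2 C, 0 <= C & forall s t, orthogonal R n s -> orthogonal R n t ->
    vol [set x *m (F *m s)^T | x in K] <=
    (1 + C * `|s - t|) ^+ i * vol [set x *m (F *m t)^T | x in K].
Proof.
move=> bK [x0 [r [r0 hr]]] F1; have [_ cK vK] := bK.
have [M M0 hM] := body_bounded bK.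
have rne0 : r != 0 by rewrite gt_eqF.
(* M bounds the norms in K and r is the radius of a ball inside K; the two factors n compare the
   Euclidean norm of x (s - t) with the sup norm of s - t. *)
exists (n%:R * (n%:R * M) / r).
  by rewrite divr_ge0 ?mulr_ge0// ltW.
move=> s t os ot.
have Ft : F *m t *m (F *m t)^T = 1%:M.
  by rewrite trmx_mul mulmxA -(mulmxA F) ot mulmx1.
rewrite mulrAC.
apply: (@vol_enlarge _ _ _ _ (x0 *m (F *m t)^T)) => //.
- exact: linear_image_compact.
- exact: linear_image_compact.
- exact: linear_image_convex.
- by rewrite !mulr_ge0// ltW.
- exact: frame_image_ball.
move=> _ [x Kx <-]; exists (x *m (F *m t)^T); first by exists x.
rewrite -mulmxBr -raddfB/= -mulmxBr trmx_mul mulmxA.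
apply: le_trans (frame_contract _ F1) _; apply: le_trans (enorm_mulmx_le _ _) _.
have nt : `|(s - t)^T| <= `|s - t|.
  rewrite [leLHS]/Num.norm/= mx_normrE; apply/bigmax_leP; split=> [|[a b] _ /=]; first exact: normr_ge0.
  rewrite mxE [leRHS]/Num.norm/= mx_normrE; apply/bigmax_geP; right.
  by exists (b, a).
rewrite -[leRHS]mulrA ler_wpM2l//; apply: ler_pM => //.
  by rewrite mulr_ge0// enorm_ge0.
by rewrite ler_wpM2l// hM.
Qed.

Lemma frame_vol_continuous K F : convex_body K -> has_ball K -> F *m F^T = 1%:M ->
  {within SO R n, continuous (fun t => vol [set x *m (F *m t)^T | x in K])}.
Proof.
move=> bK hK F1; set f := fun t => _.
have [C C0 hC] := frame_vol_lipschitz bK hK F1.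
have f0 t : 0 <= f t by apply: vol_ge0; apply: linear_image_compact; case: bK.
apply/subspace_continuousP => t ht.
(* Entries of orthogonal matrices lie in [-1, 1], so |s - t| <= 2 and V bounds both f s and f t.
   This makes the multiplicative estimate additive, with error [phi] |s - t|. *)
pose V := (1 + C * 2) ^+ i * f t.
have V0 : 0 <= V by rewrite mulr_ge0// exprn_ge0// addr_ge0// mulr_ge0.
pose phi (y : R) : R := ((1 + C * y) ^+ i - 1) * V.
pose g (s : 'M[R]_n) : R := phi `|s - t|.
have cg : continuous g.
  have cphi : continuous phi.
    rewrite (_ : phi = horner (((1 + C *: 'X) ^+ i - 1) * V%:P)).
      exact: continuous_horner.
    by apply/funext => y; rewrite /phi !hornerE.
  move=> s; apply: (@continuous_comp _ _ _ (fun s : 'M[R]_n => `|s - t|) phi); last exact: cphi.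
  apply: (@continuous_comp _ _ _ (fun s : 'M[R]_n => s - t) (fun y => `|y|)); last exact: norm_continuous.
  by apply: (@continuousB R 'M[R]_n _ id (cst t)); [exact: cvg_id|exact: cst_continuous].
have gt : g t = 0 by rewrite /g /phi subrr normr0 mulr0 addr0 expr1n subrr mul0r.
have fg s : SO R n s -> `|f t - f s| <= g s.
  move=> hs; have os := SO_orthogonal hs; have ot := SO_orthogonal ht.
  have st2 : `|s - t| <= 2.
    rewrite [leLHS]/Num.norm/= mx_normrE; apply/bigmax_leP; split=> // -[a b] _ /=.
    rewrite !mxE; apply: le_trans (ler_normB _ _) _.
    have := orthogonal_entry a b os; have := orthogonal_entry a b ot; lra.
  have b1 : 1 <= 1 + C * `|s - t| by rewrite lerDl mulr_ge0.
  have b2 : 1 + C * `|s - t| <= 1 + C * 2 by rewrite lerD2l ler_wpM2l.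
  have p1 : 1 <= (1 + C * `|s - t|) ^+ i by exact: exprn_ege1.
  have p2 : (1 + C * `|s - t|) ^+ i <= (1 + C * 2) ^+ i.
    by apply: lerXn2r => //; rewrite nnegrE; apply: le_trans ler01 _ => //; exact: le_trans b2.
  have fsV : f s <= V by apply: le_trans (hC s t os ot) _; rewrite ler_wpM2r// f0.
  have ftV : f t <= V.
    by rewrite -[leLHS]mul1r ler_wpM2r// ?f0//; exact: le_trans p2.
  have h1 := hC s t os ot; have h2 := hC t s ot os.
  rewrite -/(f s) -/(f t) in h1; rewrite distrC -/(f s) -/(f t) in h2.
  rewrite /g /phi; set P := (1 + C * `|s - t|) ^+ i in p1 h1 h2 *.
  have h3 : (P - 1) * f s <= (P - 1) * V by rewrite ler_wpM2l// subr_ge0.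
  have h4 : (P - 1) * f t <= (P - 1) * V by rewrite ler_wpM2l// subr_ge0.
  by rewrite ler_norml; apply/andP; split; lra.
move=> A /nbhs_ballP[e /= e0 eA]; rewrite /nbhs/= /within/=.
have : nbhs t (g @^-1` ball (g t) e) by apply: cg; exact: nbhsx_ballx.
apply: filterS => s /= hs SOs; apply: eA; rewrite /ball/=.
apply: le_lt_trans (fg s SOs) _; move: hs; rewrite gt /ball/= sub0r normrN.
exact: le_lt_trans (ler_norm _).
Qed.

Lemma parallel_vol_cvg L F e : convex_body L -> F *m F^T = 1%:M -> 0 < e ->
  exists2 d0, 0 < d0 & forall d, 0 < d -> d <= d0 ->
    vol [set x *m F^T | x in minkowski_add L (dilate d (eball R n))] <=
    vol [set x *m F^T | x in L] + e.
Proof.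
move=> bL F1 e0; have bP d : convex_body (minkowski_add L (dilate d (eball R n))).
  by apply: minkowski_add_body => //; apply: dilate_body; exact: eball_body.
pose S d := [set x *m F^T | x in minkowski_add L (dilate d (eball R n))].
have cS d : compact (S d) by apply: linear_image_compact; case: (bP d).
have mono d d' : 0 <= d -> d <= d' -> S d `<=` S d'.
  move=> d0 dd' _ [_ [x Lx [_ [b hb <-] <-]] <-].
  exists (x + d *: b) => //; exists x => //; exists (d *: b) => //.
  have [d'0|d'0] := eqVneq d' 0.
    by exists b => //; rewrite d'0; have -> : d = 0 by apply/le_anti; rewrite d0 -d'0 dd'.
  have d'pos : 0 < d' by rewrite lt_def d'0 (le_trans d0).
  exists ((d / d') *: b); last by rewrite scalerA mulrCA divff// mulr1.
  rewrite /eball/= enormZ ger0_norm ?divr_ge0// ?(ltW d'pos)//.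
  by rewrite mulr_ile1 ?enorm_ge0 ?divr_ge0 ?(ltW d'pos)// ler_pdivrMr// mul1r.
have inter : \bigcap_k S (k.+1%:R^-1) = [set x *m F^T | x in L].
  apply/seteqP; split=> z.
    move=> hz; apply: contrapT => nLz.
    have bLF : convex_body [set x *m F^T | x in L].
      case: bL => -[x Lx] cL vL; split; [by exists (x *m F^T), x|exact: linear_image_compact|].
      exact: linear_image_convex.
    (* A point outside the image of L is separated by a gap larger than some 1 / (k + 1), whereas
       enlarging L by that radius raises the support function by at most 1 / (k + 1). *)
    have [u hu hsep] := separation bLF nLz.
    have /ltr_add_invr[k] : support_fun [set x *m F^T | x in L] u < dot u z by [].
    rewrite ltNge => /negP; apply.
    have [_ [x Lx [_ [b hb <-] <-]] <-] := hz k I.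
    rewrite mulmxDl dotDr lerD//; first by apply: le_support_fun => //; exists x.
    apply: le_trans (dot_le _ _) _; rewrite hu mul1r; apply: le_trans (frame_contract _ F1) _.
    by rewrite enormZ ger0_norm ?invr_ge0// ler_piMr// invr_ge0.
  move=> [x Lx <-] k _; exists x => //; exists x => //; exists 0; last by rewrite addr0.
  by exists 0; [rewrite /eball/= enorm0|rewrite scaler0].
have : lebesgue_mx i (S k.+1%:R^-1) @[k --> \oo] --> lebesgue_mx i (\bigcap_k S (k.+1%:R^-1)).
  apply: nonincreasing_cvg_mu.
  - by rewrite -ge0_fin_numE ?measure_ge0//; exact: compact_lebesgue_fin.
  - by move=> k; exact: compact_measurable_mx.
  - by apply: bigcap_measurable => // k _; exact: compact_measurable_mx.
  - move=> k l kl; apply/subsetPset; apply: mono; first by rewrite invr_ge0.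
    by rewrite lef_pV2 ?posrE// ler_nat.
rewrite inter -volE; last by apply: linear_image_compact; case: bL.
under eq_fun do rewrite -volE//.
move=> /fine_cvgP[_] /cvgrPdist_lt/(_ e e0)[N _ hN].
exists (N.+1%:R^-1); first by rewrite invr_gt0.
move=> d d0 dN; apply: (@le_trans _ _ (vol (S N.+1%:R^-1))).
  exact: (vol_le (cS d) (cS _) (mono _ _ (ltW d0) dN)).
have := hN N (leqnn N); rewrite /= ltr_norml => /andP[h _].
by lra.
Qed.

End ProjectionVolume.

Lemma vol_segment {R : realType} (A : set 'rV[R]_1) (a b : R) : a <= b ->
  (forall x, A x <-> a <= x 0 0 /\ x 0 0 <= b) -> vol A = b - a.
Proof.
move=> ab hA; rewrite /vol/=.
rewrite (_ : (\int[_]_t _)%E = (\int[@lebesgue_measure R]_t (\1_(`[a, b]%classic) t)%:E)%E); last first.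
  apply: eq_integral => t _; rewrite indicE; congr ((nat_of_bool _)%:R%:E).
  apply/idP/idP; rewrite !inE/= in_itv/= => h.
    by have /hA := h; rewrite row_scalar_l => -[-> ->].
  by apply/hA; rewrite row_scalar_l; apply/andP.
rewrite integral_indic// setIT/= lebesgue_measure_itv/= lte_fin.
case: ltP => [//|ba]; have -> : a = b by apply/le_anti; rewrite ab ba.
by rewrite subrr.
Qed.

Section Width.
Context {R : realType} {n : nat}.

(** In the frame u the projection is the interval from - h(- u) to h(u): the ends are attained at
    support points, and convexity fills the gap. *)
Lemma proj_vol_line (L : set 'rV[R]_n) u : convex_body L -> sphere R n u ->
  proj_vol 1 L (u^T *m u) = support_fun L u + support_fun L (- u).
Proof.
move=> bL hu; have [_ cL /convex_setP vL] := bL.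
have hF : orthonormal_basis (u^T *m u) u by split=> //; rewrite dotE dot_sphere.
rewrite (proj_volE cL hF) -[support_fun L (- u)]opprK.
have [x1 Lx1 h1] := support_fun_attained u bL.
have [x2 Lx2 h2] := support_fun_attained (- u) bL.
rewrite dotNl in h2.
have le12 : dot u x2 <= dot u x1 by rewrite -h1; exact: le_support_fun.
apply: vol_segment; first by rewrite h1 h2 opprK.
have e (x : 'rV[R]_n) : (x *m u^T) 0 0 = dot u x.
  by rewrite dotE mxE eqxx mulr1n dotC.
move=> y; split.
  move=> [x Lx <-]; rewrite e; split; last exact: le_support_fun.
  by rewrite lerNl -dotNl; exact: le_support_fun.
rewrite h1 h2 opprK => -[y2 y1].
suff [x Lx hx] : exists2 x, L x & dot u x = y 0 0.
  by exists x => //; apply/rowP => j; rewrite ord1 e.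
have [eq12|ne12] := eqVneq (dot u x1) (dot u x2).
  by exists x1 => //; apply/le_anti; rewrite y1 eq12 y2.
have d0 : 0 < dot u x1 - dot u x2 by rewrite subr_gt0 lt_def ne12.
pose a := (y 0 0 - dot u x2) / (dot u x1 - dot u x2).
exists (a *: x1 + (1 - a) *: x2).
  apply: vL => //; first by rewrite divr_ge0 ?subr_ge0// ltW.
  by rewrite ler_pdivrMr// mul1r lerD2r.
rewrite dotDr !dotZr /a; field.
by rewrite gt_eqF.
Qed.

End Width.

(** * Polynomials on the sphere *)

Section PuncturedRational.
Context {R : realType} {n : nat}.
Implicit Types (x v : 'rV[R]_n).

(* Expressions in the coordinates and 1 / |x|: a class closed under partial
   derivatives that contains the degree 0 extensions of polynomials. *)
Inductive pexpr :=
| PConst of R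
| PCoord of 'I_n
| PInvNorm
| PAdd of pexpr & pexpr
| PMul of pexpr & pexpr.

Fixpoint peval e x : R := match e with
| PConst a => a
| PCoord k => x 0 k
| PInvNorm => (enorm x)^-1
| PAdd e1 e2 => peval e1 x + peval e2 x
| PMul e1 e2 => peval e1 x * peval e2 x
end.

Fixpoint pderiv j e := match e with
| PConst _ => PConst 0
| PCoord k => PConst (k == j)%:R
| PInvNorm => PMul (PMul (PConst (-1)) (PCoord j)) (PMul PInvNorm (PMul PInvNorm PInvNorm))
| PAdd e1 e2 => PAdd (pderiv j e1) (pderiv j e2)
| PMul e1 e2 => PAdd (PMul e1 (pderiv j e2)) (PMul e2 (pderiv j e1))
end.

Lemma peval_continuous e x : x != 0 -> {for x, continuous (peval e)}.
Proof.
move=> x0; elim: e => [a|k||e1 h1 e2 h2|e1 h1 e2 h2].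
- exact: cst_continuous.
- exact: coord_continuous.
- have e0 : enorm x != 0 by rewrite enorm_eq0.
  exact: (cvgV e0 (@enorm_continuous R n x)).
- exact: (continuousD h1 h2).
- exact: (continuousM h1 h2).
Qed.

Lemma is_derive_line (f : 'rV[R]_n -> R) x v df :
  is_derive (0 : R) (1 : R) (fun h : R => f (h *: v + x)) df -> is_derive x v f df.
Proof.
move=> [d1 d2]; apply: DeriveDef; first exact/derivable1P.
rewrite -d2 /derive.
suff -> : (fun h : R => h^-1 *: ((f \o shift x) (h *: v) - f x)) =
  (fun h : R => h^-1 *: (((fun h : R => f (h *: v + x)) \o shift 0) (h *: 1) - f (0 *: v + x))).
  by [].
by apply/funext => h /=; rewrite addr0 scale0r add0r [_%:A]mulr1.
Qed.

(** Along a coordinate line the squared norm is a quadratic polynomial q of the parameter, positive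
    at 0, so the chain rule for sqrt and the inverse applies. *)
Lemma is_derive_enormV x j : x != 0 ->
  is_derive x (delta_mx 0 j) (fun y => (enorm y)^-1) (- x 0 j * (enorm x)^-1 ^+ 3).
Proof.
move=> x0; apply: is_derive_line.
pose q : {poly R} := (dot x x)%:P + (2 * x 0 j) *: 'X + 'X^2.
have qE h : dot (h *: delta_mx 0 j + x) (h *: delta_mx 0 j + x) = q.[h].
  have -> : q.[h] = dot x x + 2 * x 0 j * h + h ^+ 2 by rewrite /q !hornerE.
  rewrite dotDl !dotDr !dotZl !dotZr (dotC x).
  have -> : dot (delta_mx 0 j) (delta_mx 0 j) = 1 :> R.
    rewrite /dot (bigD1 j)//= big1 => [|k kj]; first by rewrite !mxE !eqxx mulr1 addr0.
    by rewrite !mxE (negPf kj) andbF mulr0.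
  have -> : dot (delta_mx 0 j) x = x 0 j.
    rewrite /dot (bigD1 j)//= big1 => [|k kj]; first by rewrite !mxE !eqxx mul1r addr0.
    by rewrite !mxE (negPf kj) andbF mul0r.
  by ring.
have q0 : q.[0] = dot x x by rewrite -qE scale0r add0r.
have q0pos : 0 < q.[0] by rewrite q0 lt_def dot_ge0 dot_eq0 x0.
rewrite (_ : (fun h => _) = (fun h => (Num.sqrt q.[h])^-1)); last first.
  by apply/funext => h; rewrite /enorm qE.
have dq : is_derive (0 : R) (1 : R) (horner q) (q^`()).[0] by exact: is_derive_poly.
have ds := is_derive1_sqrt q0pos.
have dc := is_derive1_comp ds dq.
have sne : (Num.sqrt \o horner q) 0 != 0 by rewrite /= gt_eqF// sqrtr_gt0.
apply: (is_derive_eq (is_deriveV sne dc)).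
have -> : (q^`()).[0] = 2 * x 0 j.
  rewrite /q !derivD derivC derivZ derivX derivXn !hornerE.
  by rewrite /= !addr0.
have se : Num.sqrt q.[0] = enorm x by rewrite q0.
rewrite /= se /GRing.scale/=; field.
by rewrite enorm_eq0.
Qed.

Lemma peval_is_derive e x j : x != 0 ->
  is_derive x (delta_mx 0 j) (peval e) (peval (pderiv j e) x).
Proof.
move=> x0; elim: e => [a|k||e1 h1 e2 h2|e1 h1 e2 h2] /=.
- exact: is_derive_cst.
- apply: is_derive_line.
  rewrite (_ : (fun h : R => _) = horner ((k == j)%:R *: 'X + (x 0 k)%:P)).
    apply: (is_derive_eq (is_derive_poly _ _)).
    by rewrite derivD derivZ derivX derivC addr0 !hornerE.
  by apply/funext => h; rewrite !hornerE !mxE eqxx andTb mulrC.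
- apply: (is_derive_eq (is_derive_enormV j x0)).
  by rewrite mulN1r exprS expr2.
- exact: (is_deriveD h1 h2).
- exact: (is_deriveM h1 h2).
Qed.

Lemma partials_peval f e s : (forall x, x != 0 -> f x = peval e x) ->
  forall x, x != 0 -> partials s f x = peval (foldr pderiv e s) x.
Proof.
move=> hf; elim: s => [|j s IH] x x0 //=; first exact: hf.
(* The identity is known only off the origin; that set is open, which suffices for a derivative at
   x. *)
have nx : \near x, partials s f x = peval (foldr pderiv e s) x.
  have : open [set y : 'rV[R]_n | y != 0].
    rewrite (_ : mkset _ = ~` [set 0]).
      by apply: closed_openC; apply: accessible_closed_set1; apply: hausdorff_accessible; exact: norm_hausdorff.
    by apply/seteqP; split=> y /= /eqP.
  move=> o0; apply: filterS (open_nbhs_nbhs (conj o0 x0)) => y; exact: IH.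
rewrite (near_eq_derive _ nx).
by have [_ ->] := peval_is_derive (foldr pderiv e s) j x0.
Qed.

Lemma peval_sphere_smooth (g : 'rV[R]_n -> R) e :
  (forall x, x != 0 -> homogeneous_ext g x = peval e x) -> sphere_smooth g.
Proof.
move=> hg s x x0.
have nx : \near x, peval (foldr pderiv e s) x = partials s (homogeneous_ext g) x.
  have : open [set y : 'rV[R]_n | y != 0].
    rewrite (_ : mkset _ = ~` [set 0]).
      by apply: closed_openC; apply: accessible_closed_set1; apply: hausdorff_accessible; exact: norm_hausdorff.
    by apply/seteqP; split=> y /= /eqP.
  move=> o0; apply: filterS (open_nbhs_nbhs (conj o0 x0)) => y y0.
  by rewrite (partials_peval s hg y0).
split.
  move=> A hA; have cA := @peval_continuous (foldr pderiv e s) x x0 A.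
  rewrite -(partials_peval s hg x0) in cA.
  by apply: filterS2 nx (cA hA) => y /= <-.
move=> j; apply: near_eq_derivable nx _.
by have [] := peval_is_derive (foldr pderiv e s) j x0.
Qed.

End PuncturedRational.

Section SpherePoly.
Context {R : realType} {n : nat}.
Implicit Types (g f : 'rV[R]_n -> R) (x u : 'rV[R]_n).

(** Polynomial functions of the coordinates. They are smooth on the sphere, stable under x -> x t
    and dense among continuous functions, so delta is needed on this class only. *)
Inductive sphere_poly : ('rV[R]_n -> R) -> Prop :=
| SPconst a : sphere_poly (fun=> a)
| SPcoord k : sphere_poly (fun x => x 0 k)
| SPadd g f : sphere_poly g -> sphere_poly f -> sphere_poly (fun x => g x + f x)
| SPmul g f : sphere_poly g -> sphere_poly f -> sphere_poly (fun x => g x * f x).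

Lemma sphere_poly_smooth g : sphere_poly g -> sphere_smooth g.
Proof.
suff H : sphere_poly g -> exists e, forall x, homogeneous_ext g x = peval e x.
  by move=> /H[e he]; apply: (@peval_sphere_smooth _ _ _ e) => x _.
elim=> [a|k|{}g f _ [e1 h1] _ [e2 h2]|{}g f _ [e1 h1] _ [e2 h2]].
- by exists (PConst a).
- exists (PMul PInvNorm (PCoord k)) => x.
  by rewrite /homogeneous_ext mxE.
- by exists (PAdd e1 e2) => x; rewrite /= -h1 -h2.
- by exists (PMul e1 e2) => x; rewrite /= -h1 -h2.
Qed.

Lemma sphere_poly_continuous g : sphere_poly g -> continuous g.
Proof.
elim=> [a|k|{}g f _ h1 _ h2|{}g f _ h1 _ h2] x.
- exact: cst_continuous.
- exact: coord_continuous.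
- exact: (continuousD (h1 x) (h2 x)).
- exact: (continuousM (h1 x) (h2 x)).
Qed.

Lemma sphere_polyZ a g : sphere_poly g -> sphere_poly (fun x => a * g x).
Proof. by move=> hg; apply: (SPmul (SPconst a)). Qed.

Lemma sphere_poly_sum (I : Type) (r : seq I) (G : I -> 'rV[R]_n -> R) :
  (forall k, sphere_poly (G k)) -> sphere_poly (fun x => \sum_(k <- r) G k x).
Proof.
move=> hG; elim: r => [|k r IH].
  rewrite (_ : (fun x => _) = (fun=> 0)); first exact: SPconst.
  by apply/funext => x; rewrite big_nil.
rewrite (_ : (fun x => _) = (fun x => G k x + \sum_(k <- r) G k x)).
  exact: SPadd.
by apply/funext => x; rewrite big_cons.
Qed.

Lemma sphere_poly_mulmx g (t : 'M[R]_n) : sphere_poly g -> sphere_poly (fun x => g (x *m t)).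
Proof.
elim=> [a|k|{}g f _ h1 _ h2|{}g f _ h1 _ h2].
- exact: SPconst.
- rewrite (_ : (fun x => _) = (fun x => \sum_l t l k * x 0 l)).
    by apply: sphere_poly_sum => l; apply: sphere_polyZ; exact: SPcoord.
  by apply/funext => x; rewrite mxE; apply: eq_bigr => l _; rewrite mulrC.
- exact: SPadd.
- exact: SPmul.
Qed.

Lemma sphere_poly_dot w : sphere_poly (dot w).
Proof.
rewrite (_ : dot w = (fun x => \sum_l w 0 l * x 0 l)); last by [].
by apply: sphere_poly_sum => l; apply: sphere_polyZ; exact: SPcoord.
Qed.

End SpherePoly.

(** * Continuous functions on compact sets and their integrals *)

Section WithinContinuity.
Context {R : realType} {T : topologicalType} (D : set T).
Implicit Types F G : T -> R.

Lemma wc_cst a : {within D, continuous (fun=> a : R)}.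
Proof. by move=> x; exact: cst_continuous. Qed.

Lemma wcD F G : {within D, continuous F} -> {within D, continuous G} ->
  {within D, continuous (fun x => F x + G x)}.
Proof. by move=> cF cG x; exact: (continuousD (cF x) (cG x)). Qed.

Lemma wcM F G : {within D, continuous F} -> {within D, continuous G} ->
  {within D, continuous (fun x => F x * G x)}.
Proof. by move=> cF cG x; exact: (continuousM (cF x) (cG x)). Qed.

Lemma wcN F : {within D, continuous F} -> {within D, continuous (fun x => - F x)}.
Proof. by move=> cF x; exact: (continuousN (cF x)). Qed.

Lemma wcB F G : {within D, continuous F} -> {within D, continuous G} ->
  {within D, continuous (fun x => F x - G x)}.
Proof. by move=> cF cG; apply: wcD => //; exact: wcN. Qed.

Lemma wcZ a F : {within D, continuous F} -> {within D, continuous (fun x => a * F x)}.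
Proof. by move=> cF; apply: wcM => //; exact: wc_cst. Qed.

Lemma wcX k F : {within D, continuous F} -> {within D, continuous (fun x => F x ^+ k)}.
Proof.
move=> cF; elim: k => [|k IH]; first exact: wc_cst.
rewrite (_ : (fun x => _) = (fun x => F x * F x ^+ k)); first exact: wcM.
by apply/funext => x; rewrite exprS.
Qed.

Lemma wc_norm F : {within D, continuous F} -> {within D, continuous (fun x => `|F x|)}.
Proof.
move=> cF x; apply: (@continuous_comp (subspace D) R R F (fun y => `|y|)); first exact: cF.
exact: norm_continuous.
Qed.

Lemma wc_sum (I : Type) (r : seq I) (F : I -> T -> R) :
  (forall k, {within D, continuous (F k)}) ->
  {within D, continuous (fun x => \sum_(k <- r) F k x)}.
Proof.
move=> cF; elim: r => [|k r IH].
  rewrite (_ : (fun x => _) = (fun=> 0)); first exact: wc_cst.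
  by apply/funext => x; rewrite big_nil.
rewrite (_ : (fun x => _) = (fun x => F k x + \sum_(k <- r) F k x)); first exact: wcD.
by apply/funext => x; rewrite big_cons.
Qed.

Lemma wc_eq F G : (forall x, D x -> F x = G x) -> {within D, continuous F} ->
  {within D, continuous G}.
Proof. by move=> FG; apply: subspace_eq_continuous => x /set_mem; exact: FG. Qed.

End WithinContinuity.

Lemma wc_comp {R : realType} {T U : topologicalType} (D : set T) (E : set U) (f : T -> U) (G : U -> R) :
  continuous f -> (forall x, D x -> E (f x)) -> {within E, continuous G} ->
  {within D, continuous (fun x => G (f x))}.
Proof.
move=> cf DE /subspace_continuousP cG; apply/subspace_continuousP => x Dx A hA.
have := cG (f x) (DE x Dx) A hA; rewrite /nbhs/= /within/= => h.
have h2 : nbhs x [set y | E (f y) -> A (G (f y))] by exact: (cf x _ h).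
suff : nbhs x [set y | D y -> A (G (f y))] by [].
by apply: filterS h2 => y /= hy Dy; apply: hy; exact: DE.
Qed.

Section CompactIntegral.
Context {R : realType} {p q : nat} (P : probability (borel_mx R p q) R) (X : set 'M[R]_(p, q)).
Hypothesis cX : compact X.
Hypothesis PX : P X = 1%E.
Implicit Types F G : 'M[R]_(p, q) -> R.

Lemma ci_measurable : measurable (X : set (borel_mx R p q)).
Proof. exact: compact_measurable_mx. Qed.

Lemma ci_integrable F : {within X, continuous F} -> P.-integrable X (EFin \o F).
Proof.
move=> cF; have [M _ hM] := continuous_compact_bounded cX cF.
apply: (@bounded_integrable _ _ _ _ _ _ M) => //; first exact: ci_measurable.
apply: continuous_measurable_within => //; apply: compact_closed cX; exact: norm_hausdorff.
Qed.

Lemma ciD F G : {within X, continuous F} -> {within X, continuous G} ->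
  \int[P]_(x in X) (F x + G x) = \int[P]_(x in X) F x + \int[P]_(x in X) G x.
Proof.
by move=> cF cG; apply: RintegralD; [exact: ci_measurable|exact: ci_integrable|exact: ci_integrable].
Qed.

Lemma ciB F G : {within X, continuous F} -> {within X, continuous G} ->
  \int[P]_(x in X) (F x - G x) = \int[P]_(x in X) F x - \int[P]_(x in X) G x.
Proof.
by move=> cF cG; apply: RintegralB; [exact: ci_measurable|exact: ci_integrable|exact: ci_integrable].
Qed.

Lemma ciZ a F : {within X, continuous F} ->
  \int[P]_(x in X) (a * F x) = a * \int[P]_(x in X) F x.
Proof. by move=> cF; apply: RintegralZl; [exact: ci_measurable|exact: ci_integrable]. Qed.

Lemma ci_cst a : \int[P]_(x in X) a = a.
Proof.
have -> : \int[P]_(x in X) a = a * fine (P X) by exact: (Rintegral_cst P ci_measurable).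
by rewrite PX mulr1.
Qed.

Lemma ci_sum (I : Type) (r : seq I) (F : I -> 'M[R]_(p, q) -> R) :
  (forall k, {within X, continuous (F k)}) ->
  \int[P]_(x in X) (\sum_(k <- r) F k x) = \sum_(k <- r) \int[P]_(x in X) F k x.
Proof.
move=> cF; elim: r => [|k r IH].
  under eq_Rintegral do rewrite big_nil.
  by rewrite ci_cst big_nil.
under eq_Rintegral do rewrite big_cons.
by rewrite big_cons ciD ?IH//; exact: wc_sum.
Qed.

Lemma ci_le F G : {within X, continuous F} -> {within X, continuous G} ->
  (forall x, X x -> F x <= G x) -> \int[P]_(x in X) F x <= \int[P]_(x in X) G x.
Proof.
by move=> cF cG FG; apply: le_Rintegral => //; [exact: ci_measurable|exact: ci_integrable|exact: ci_integrable].
Qed.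

Lemma ci_eq F G : (forall x, X x -> F x = G x) ->
  \int[P]_(x in X) F x = \int[P]_(x in X) G x.
Proof. by move=> FG; apply: eq_Rintegral => x /set_mem; exact: FG. Qed.

Lemma ci_ge0 F : (forall x, X x -> 0 <= F x) -> 0 <= \int[P]_(x in X) F x.
Proof. by move=> F0; apply: Rintegral_ge0 => x; exact: F0. Qed.

Lemma ci_norm F : {within X, continuous F} ->
  `|\int[P]_(x in X) F x| <= \int[P]_(x in X) `|F x|.
Proof. by move=> cF; apply: le_normr_Rintegral; [exact: ci_measurable|exact: ci_integrable]. Qed.

End CompactIntegral.

Lemma compact_unif_continuous {R : realType} {p q : nat} (X : set 'M[R]_(p, q)) (G : 'M[R]_(p, q) -> R) e :
  compact X -> {within X, continuous G} -> 0 < e ->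
  exists2 d, 0 < d & forall u v, X u -> X v -> `|u - v| < d -> `|G u - G v| <= e.
Proof.
move=> cX /subspace_continuousP cG e0.
pose Pd (d : R) (x : 'M[R]_(p, q)) := X x -> forall v, X v -> `|x - v| < d -> `|G x - G v| <= e.
have /compact_near_coveringP/(_ R (0^'+) Pd) := cX.
move=> cov; have h : \forall d \near 0^'+, X `<=` Pd d.
  apply: cov => x Xx.
  have e20 : 0 < e / 2 by rewrite divr_gt0.
  have hx : nbhs x [set y | X y -> ball (G x) (e / 2) (G y)].
    exact: (cG x Xx (ball (G x) (e / 2)) (nbhsx_ballx _ _ e20)).
  move/nbhs_ballP : hx => [d /= d0 hd].
  have d20 : 0 < d / 2 by rewrite divr_gt0.
  (* Half for the distance to the centre x and half for the distance of the pair, so both points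
     stay within d of x. *)
  exists (ball x (d / 2), [set d' : R | d' < d / 2]) => /=.
    split; first exact: nbhsx_ballx.
    exact: nbhs_right_lt.
  move=> [x' d'] /= [hx' hd'] Xx' v Xv hv.
  have hh y : X y -> `|x - y| < d -> `|G x - G y| < e / 2.
    by move=> Xy hy; apply: hd => //; rewrite -ball_normE.
  have h1 : `|x - x'| < d / 2 by move: hx'; rewrite -ball_normE.
  have h2 : `|x - v| < d.
    rewrite (_ : x - v = (x - x') + (x' - v)); last by rewrite addrA subrK.
    by apply: le_lt_trans (ler_normD _ _) _; rewrite [ltRHS]splitr ltrD// (lt_trans hv).
  have h3 := hh x' Xx' (lt_trans h1 _); have h4 := hh v Xv h2.
  rewrite (_ : G x' - G v = (G x - G v) - (G x - G x')); last by ring.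
  apply: le_trans (ler_normB _ _) _; rewrite [leRHS]splitr lerD//; first exact: ltW.
  by apply/ltW/h3; rewrite ltr_pdivrMr// ltr_pMr// ltr1n.
have [d [d0 hd]] : exists d : R, 0 < d /\ X `<=` Pd d.
  have h2 : \forall d \near (0 : R)^'+, 0 < d /\ X `<=` Pd d.
    by apply: filterS2 (nbhs_right_gt (0 : R)) h => d d0 hd.
  by have [d hd] := filter_ex h2; exists d.
by exists d => // u v Xu Xv; exact: hd.
Qed.

(** * Approximation by polynomials on the sphere *)

Section SphereDensity.
Context {R : realType} {n : nat}.
Variables (mu : probability (borel_mx R n n) R) (sigma : probability (borel_mx R 1 n) R).
Hypothesis hn : (2 <= n)%N.
Hypothesis hmu : SO_invariant_measure mu.
Hypothesis hs : sphere_invariant_measure sigma.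
Implicit Types (F G : 'rV[R]_n -> R) (u v : 'rV[R]_n).

Let cS := @sphere_compact R n.
Let cO := @SO_compact R n.
Let mS := @measurable_sphere R n.
Let mO := @measurable_SO R n.

Lemma sphere_orbit_continuous e F : sphere R n e -> {within sphere R n, continuous F} ->
  {within SO R n, continuous (fun t => F (e *m t))}.
Proof.
move=> he cF; apply: (@wc_comp _ _ _ _ (sphere R n) (mulmx e)) => //; first exact: mulmx_continuousl.
by move=> t ht; exact: SO_sphere.
Qed.

Lemma mulmxr_continuous t : continuous (fun u => u *m t : 'rV[R]_n).
Proof.
move=> u; apply: (@mulmx_continuous_at _ _ 1 n n id (cst t)); last exact: cst_continuous.
exact: cvg_id.
Qed.

Lemma sphere_integral_SO e F : sphere R n e -> {within sphere R n, continuous F} ->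
  \int[sigma]_(u in sphere R n) F u = \int[mu]_(t in SO R n) F (e *m t).
Proof.
move=> he cF; have [M _ hM] := continuous_compact_bounded cS cF.
apply: (@Rintegral_image _ _ (borel_mx R n n) (borel_mx R 1 n) R mu sigma (mulmx e) _ _ _ M) => //.
- by move=> _ A mA; rewrite setTI; apply: (@mx_measurable R n n 1 n (mulmx e)) => //; exact: mulmx_continuousl.
- by move=> A mA; exact: (sphere_measureE hmu hn hs he mA).
- exact: hmu.1.
- by move=> t ht; exact: SO_sphere.
- by apply: continuous_measurable_within => //; exact: sphere_closed.
Qed.

Lemma sphere_integral_mulmx t F : SO R n t -> {within sphere R n, continuous F} ->
  \int[sigma]_(u in sphere R n) F (u *m t) = \int[sigma]_(u in sphere R n) F u.
Proof.
move=> ht cF; have [M _ hM] := continuous_compact_bounded cS cF.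
apply/esym.
apply: (@Rintegral_image _ _ (borel_mx R 1 n) (borel_mx R 1 n) R sigma sigma (fun u => u *m t) _ _ _ M) => //.
- move=> _ A mA; rewrite setTI; apply: (@mx_measurable R 1 n 1 n (fun u => u *m t)) => //.
  exact: mulmxr_continuous.
- by move=> A mA; rewrite -(hs.2 t A ht mA).
- exact: hs.1.
- by move=> u hu; exact: SO_sphere.
- by apply: continuous_measurable_within => //; exact: sphere_closed.
Qed.

(** The statement on SO(n) for the orbit map of u itself, evaluated at the identity. *)
Lemma sphere_continuous_eq0 F : {within sphere R n, continuous F} ->
  (forall u, sphere R n u -> 0 <= F u) -> \int[sigma]_(u in sphere R n) F u <= 0 ->
  forall u, sphere R n u -> F u = 0.
Proof.
move=> cF F0 iF u hu; rewrite -[u]mulmx1.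
apply: (SO_continuous_eq0 hmu (F := fun t => F (u *m t))) => //.
- exact: sphere_orbit_continuous.
- by move=> t ht; apply: F0; exact: SO_sphere.
- by rewrite -sphere_integral_SO.
- exact: SO1.
Qed.

Lemma dot_sphere_le1 u v : sphere R n u -> sphere R n v -> `|dot u v| <= 1.
Proof. by move=> hu hv; have := cauchy_schwarz u v; rewrite hu hv mulr1. Qed.

Lemma wc_dot u : {within sphere R n, continuous (dot u)}.
Proof. by apply: continuous_subspaceT; apply: sphere_poly_continuous; exact: sphere_poly_dot. Qed.

(** One factor 1 + <u, v> is expanded; the coordinates of v are absorbed into G, which is why the
    induction quantifies over G, and those of u leave the integral. *)
Lemma sphere_kernel_poly N G : {within sphere R n, continuous G} ->
  sphere_poly (fun u => \int[sigma]_(v in sphere R n) (G v * (1 + dot u v) ^+ N)).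
Proof.
elim: N G => [|N IH] G cG.
  rewrite (_ : (fun u => _) = (fun=> \int[sigma]_(v in sphere R n) G v)); first exact: SPconst.
  by apply/funext => u; apply: ci_eq => v _; rewrite expr0 mulr1.
have cc j : {within sphere R n, continuous (fun v : 'rV[R]_n => v 0 j)}.
  by apply: continuous_subspaceT; exact: coord_continuous.
have ck u : {within sphere R n, continuous (fun v => (1 + dot u v) ^+ N)}.
  by apply: wcX; apply: wcD; [exact: wc_cst|exact: wc_dot].
rewrite (_ : (fun u => _) = (fun u =>
   \int[sigma]_(v in sphere R n) (G v * (1 + dot u v) ^+ N) +
   \sum_j (u 0 j * \int[sigma]_(v in sphere R n) (G v * v 0 j * (1 + dot u v) ^+ N)))).
  apply: SPadd; first exact: IH.
  apply: sphere_poly_sum => j; apply: SPmul; first exact: SPcoord.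
  by apply: (IH (fun v => G v * v 0 j)); exact: wcM.
apply/funext => u.
have cj j : {within sphere R n, continuous (fun v : 'rV[R]_n => G v * v 0 j * (1 + dot u v) ^+ N)}.
  by apply: wcM => //; exact: wcM.
under eq_bigr => j _ do rewrite -(ciZ _ cS _ (cj j)).
rewrite -(ci_sum cS hs.1); last by move=> j; exact: wcZ.
rewrite -(ciD _ cS); last 2 first.
- exact: wcM.
- by apply: wc_sum => j; exact: wcZ.
apply: ci_eq => v _; rewrite exprSr mulrDr mulr1 mulrDr; congr (_ + _).
rewrite [in X in _ * (_ * X) = _]/dot mulrA mulr_sumr; apply: eq_bigr => j _.
by ring.
Qed.

(* The kernel (1 + <u, v>)^N divided by its integral c N is an approximate
   identity; the bump w bounds c N from below. *)
Lemma sphere_poly_dense G e : {within sphere R n, continuous G} -> 0 < e ->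
  exists2 g, sphere_poly g & forall u, sphere R n u -> `|g u - G u| <= e.
Proof.
move=> cG e0; have [M M0 hM] := continuous_compact_bounded cS cG.
have e20 : 0 < e / 2 by rewrite divr_gt0.
have [d d0 hd] := compact_unif_continuous cS cG e20.
(* If <u, v> > 1 - r, then |u - v|^2 = 2 - 2 <u, v> < 2 r < d^2. The cap 1 keeps 2 - r positive. *)
pose r := Num.min 1 (d ^+ 2 / 4).
have r0 : 0 < r by rewrite lt_min ltr01 divr_gt0// exprn_gt0.
have r1 : r <= 1 by rewrite ge_min lexx.
have rd : r <= d ^+ 2 / 4 by rewrite ge_min lexx orbT.
have near_G u v : sphere R n u -> sphere R n v -> 1 - r < dot u v -> `|G v - G u| <= e / 2.
  move=> hu hv huv; apply: hd => //; apply: le_lt_trans (norm_le_enorm _) _.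
  rewrite -(@ltr_pXn2r _ 2)// ?nnegrE ?enorm_ge0// ?(ltW d0)// enorm_sqr.
  rewrite dotBl !dotBr (dot_sphere hu) (dot_sphere hv) (dotC v u).
  have : 0 < d ^+ 2 by rewrite exprn_gt0.
  by lra.
have [e1 he1] : exists e1, sphere R n e1.
  by have [z hz _] := @perp_unit R n 0 hn; exists z.
have ck N u : {within sphere R n, continuous (fun v => (1 + dot u v) ^+ N)}.
  by apply: wcX; apply: wcD; [exact: wc_cst|exact: wc_dot].
pose c N := \int[sigma]_(v in sphere R n) (1 + dot e1 v) ^+ N.
have cE N u : sphere R n u -> \int[sigma]_(v in sphere R n) (1 + dot u v) ^+ N = c N.
  move=> hu; have [t ht etu] := SO_sphere_trans hn he1 hu.
  rewrite /c -(sphere_integral_mulmx (SO_trmx ht) (ck N e1)).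
  by apply: ci_eq => v _; rewrite -etu dot_mulmx.
pose w v := Num.max 0 (dot e1 v - (1 - r / 2)).
have cw : {within sphere R n, continuous w}.
  rewrite (_ : w = (fun v => (dot e1 v - (1 - r / 2) + `|dot e1 v - (1 - r / 2)|) / 2)).
    have cc : {within sphere R n, continuous (fun v => dot e1 v - (1 - r / 2))}.
      by apply: wcB; [exact: wc_dot|exact: wc_cst].
    apply: wcM; last exact: wc_cst.
    by apply: wcD => //; exact: wc_norm.
  by apply/funext => v; rewrite /w; set y := _ - _; case: (leP 0 y) => hy;
     [rewrite ger0_norm|rewrite ltr0_norm]; rewrite ?subrr ?mul0r//; field.
have w0 v : 0 <= w v by rewrite le_max lexx.
pose m0 := \int[sigma]_(v in sphere R n) w v.
have m0pos : 0 < m0.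
  rewrite ltNge; apply/negP => m0le.
  have := sphere_continuous_eq0 cw (fun v _ => w0 v) m0le he1.
  rewrite /w (dot_sphere he1) => /eqP; rewrite eq_le => /andP[+ _].
  by rewrite ge_max => /andP[_]; lra.
have cN N : m0 * (2 - r / 2) ^+ N <= c N.
  rewrite mulrC -ciZ//; apply: ci_le => //; first exact: wcZ.
  move=> v hv; rewrite /w; case: (leP (dot e1 v - (1 - r / 2)) 0) => h.
    rewrite mulr0 exprn_ge0//; have := dot_sphere_le1 he1 hv.
    by rewrite ler_norml => /andP[]; lra.
  have d1 := dot_sphere_le1 he1 hv; rewrite ler_norml in d1; case/andP: d1 => _ d1.
  apply: (@le_trans _ _ ((2 - r / 2) ^+ N)).
    by rewrite ler_piMr ?exprn_ge0//; lra.
  by apply: lerXn2r; rewrite ?nnegrE; lra.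
(* Where <u, v> <= 1 - r the kernel is at most (2 - r)^N, while c N >= m0 (2 - r / 2)^N; so the
   relative weight of that region decays like q^N. *)
pose q := (2 - r) / (2 - r / 2).
have q1 : `|q| < 1.
  rewrite ger0_norm; last by rewrite divr_ge0//; lra.
  by rewrite ltr_pdivrMr; lra.
have [N hN] : exists N, q ^+ N < e / 2 * m0 / (2 * M).
  have := @cvg_expr R q q1 => /cvgrPdist_lt /(_ (e / 2 * m0 / (2 * M))).
  case; first by rewrite divr_gt0 ?mulr_gt0.
  move=> N _ /(_ N (leqnn N)); rewrite /= sub0r normrN => h.
  by exists N; apply: le_lt_trans h; exact: ler_norm.
have cpos : 0 < c N.
  by apply: lt_le_trans (cN N); rewrite mulr_gt0// exprn_gt0//; lra.
exists (fun u => (c N)^-1 * \int[sigma]_(v in sphere R n) (G v * (1 + dot u v) ^+ N)).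
  by apply: sphere_polyZ; exact: sphere_kernel_poly.
move=> u hu.
have cGk : {within sphere R n, continuous (fun v => G v * (1 + dot u v) ^+ N)} by exact: wcM.
have -> : (c N)^-1 * \int[sigma]_(v in sphere R n) (G v * (1 + dot u v) ^+ N) - G u =
    (c N)^-1 * \int[sigma]_(v in sphere R n) (G v * (1 + dot u v) ^+ N - G u * (1 + dot u v) ^+ N).
  rewrite ciB//; last exact: wcZ.
  by rewrite (ciZ _ cS _ (ck N u)) cE// mulrBr [_ * (G u * _)]mulrCA mulVf ?mulr1// gt_eqF.
rewrite normrM gtr0_norm ?invr_gt0// mulrC ler_pdivrMr//.
have cGk2 : {within sphere R n, continuous (fun v => G v * (1 + dot u v) ^+ N - G u * (1 + dot u v) ^+ N)}.
  by apply: wcB => //; exact: wcZ.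
apply: (le_trans (@ci_norm _ _ _ sigma _ cS _ cGk2)).
apply: (@le_trans _ _ (\int[sigma]_(v in sphere R n) (e / 2 * (1 + dot u v) ^+ N + 2 * M * (2 - r) ^+ N))).
  apply: ci_le => //; first exact: wc_norm.
    by apply: wcD; [exact: wcZ|exact: wc_cst].
  move=> v hv; have := dot_sphere_le1 hu hv; rewrite ler_norml => /andP[dm1 d1].
  have k0 : 0 <= 1 + dot u v by lra.
  rewrite -mulrBl normrM [X in _ * X]ger0_norm ?exprn_ge0//.
  have p2 : 0 <= 2 * M * (2 - r) ^+ N by rewrite mulr_ge0 ?exprn_ge0//; lra.
  have p1 : 0 <= e / 2 * (1 + dot u v) ^+ N by rewrite mulr_ge0 ?exprn_ge0// ltW.
  case: (ltP (1 - r) (dot u v)) => h.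
    have := near_G u v hu hv h => h2.
    have : `|G v - G u| * (1 + dot u v) ^+ N <= e / 2 * (1 + dot u v) ^+ N.
      by rewrite ler_wpM2r// exprn_ge0.
    by lra.
  have : `|G v - G u| * (1 + dot u v) ^+ N <= 2 * M * (2 - r) ^+ N.
    apply: ler_pM => //; first exact: exprn_ge0.
      apply: le_trans (ler_normB _ _) _.
      by have := hM u hu; have := hM v hv; lra.
    by apply: lerXn2r; rewrite ?nnegrE; lra.
  by lra.
rewrite ciD//; [|exact: wcZ|exact: wc_cst].
rewrite (ciZ _ cS _ (ck N u)) cE// (ci_cst cS hs.1).
suff : 2 * M * (2 - r) ^+ N <= e / 2 * c N by lra.
apply: (@le_trans _ _ (e / 2 * (m0 * (2 - r / 2) ^+ N))); last by rewrite ler_wpM2l// ltW.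
have z0 : 0 < 2 - r / 2 by lra.
have qN : (2 - r) ^+ N = q ^+ N * (2 - r / 2) ^+ N.
  by rewrite -exprMn /q divfK// gt_eqF.
rewrite qN !mulrA ler_wpM2r ?(exprn_ge0 _ (ltW z0))//.
by move: (ltW hN); rewrite ler_pdivlMr ?mulr_gt0// mulrC.
Qed.

End SphereDensity.

(** * Quotient maps and the tangent inequality for x^-n *)

(** A continuous map from a compact set to a Hausdorff space sends closed subsets to closed sets,
    hence is a quotient map onto its image. Continuity of projection volumes thus descends from
    SO(n) to the sphere and the Grassmannian. *)
Lemma quotient_continuous {R : realType} (T U : topologicalType) (D : set T) (E : set U)
    (phi : T -> U) (F : U -> R) :
  hausdorff_space U -> compact D -> continuous phi -> phi @` D = E ->
  {within D, continuous (fun x => F (phi x))} -> {within E, continuous F}.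
Proof.
move=> hU cD cphi DE /continuous_closedP cF; apply/continuous_closedP => C cC.
have /closed_subspaceP[V cV VD] := cF C cC.
apply/closed_subspaceP; exists (phi @` (D `&` V)).
  apply: (compact_closed hU); apply: continuous_compact; first exact: continuous_subspaceT.
  exact: compact_closedI.
rewrite -DE; apply/seteqP; split=> y.
  move=> [[x [Dx Vx] <-] [x' Dx' xx']]; split; last by exists x'.
  have : (V `&` D) x by split.
  by rewrite VD => -[].
move=> [Cy [x Dx xy]]; split; last by exists x.
exists x => //; split=> //.
suff : (V `&` D) x by case.
by rewrite VD; split=> //=; move: Cy; rewrite -xy.
Qed.

(** Weighted arithmetic-geometric mean inequality with a quadratic remainder. The induction step
    multiplies by a and adds (n + 2) x^(n+1) (x - a)^2. *)
Lemma tangent_polynomial {R : realDomainType} (n : nat) (x a : R) : 0 <= x -> 0 <= a ->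
  (x - a) ^+ 2 * a ^+ n <= n.+1%:R * x ^+ n.+2 - n.+2%:R * x ^+ n.+1 * a + a ^+ n.+2.
Proof.
move=> x0 a0; elim: n => [|n IH].
  by rewrite !exprS !expr0 mulr1 (_ : 2%:R = 1 + 1)//; lra.
have : 0 <= n.+2%:R * x ^+ n.+1 * (x - a) ^+ 2.
  by rewrite mulr_ge0 ?sqr_ge0// mulr_ge0 ?exprn_ge0.
have := ler_wpM2l a0 IH.
rewrite !exprS !expr0 -![n.+3%:R]natr1 -![n.+2%:R]natr1 -![n.+1%:R]natr1.
set X := x ^+ n; set A := a ^+ n; set N := n%:R; lra.
Qed.

(** [tangent_polynomial], with its index lowered by one, divided by x^n a^(n+1). The remainder on
    the left is kept because it settles the equality case of both inequalities. *)
Lemma tangent_inverse_power {R : realFieldType} (n : nat) (x a : R) : (0 < n)%N -> 0 < x -> 0 < a ->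
  (x - a) ^+ 2 / (a ^+ 2 * x ^+ n) <= x ^- n - n.+1%:R * a ^- n + n%:R * (x * a ^- n.+1).
Proof.
case: n => // n _ x0 a0.
have := tangent_polynomial n (ltW x0) (ltW a0) => h.
have xn : 0 < x ^+ n.+1 by rewrite exprn_gt0.
have an : 0 < a ^+ n.+2 by rewrite exprn_gt0.
have p0 : 0 < x ^+ n.+1 * a ^+ n.+2 by rewrite mulr_gt0.
rewrite -(ler_pM2r p0).
have xne : x != 0 by rewrite gt_eqF.
have ane : a != 0 by rewrite gt_eqF.
have xnne : x ^+ n != 0 by rewrite expf_neq0.
have anne : a ^+ n != 0 by rewrite expf_neq0.
move: h; rewrite !exprS expr0 !mulr1 => h.
apply: le_trans (le_trans _ h) _.
  by rewrite le_eqVlt; apply/orP; left; apply/eqP; field; rewrite xne ane xnne.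
by rewrite le_eqVlt; apply/orP; left; apply/eqP; field; rewrite xne ane xnne anne.
Qed.

Lemma eq_small {R : realFieldType} (x y C : R) :
  (forall e, 0 < e -> `|x - y| <= C * e) -> x = y.
Proof.
move=> h; apply/eqP; rewrite -subr_eq0 -normr_eq0 eq_le normr_ge0 andbT.
apply/ler_addgt0Pr => e e0; rewrite add0r.
have C1 : 0 < `|C| + 1 by rewrite ltr_wpDl.
apply: le_trans (h (e / (`|C| + 1)) _) _; first by rewrite divr_gt0.
rewrite mulrA ler_pdivrMr// mulrC ler_wpM2l ?(ltW e0)//.
by apply: le_trans (ler_norm _) _; rewrite lerDl.
Qed.

(** * Extension of the Crofton distribution to continuous functions *)

Section PositiveFunctional.
Context {R : realType} {n : nat}.
Variables (mu : probability (borel_mx R n n) R) (sigma : probability (borel_mx R 1 n) R).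
Hypothesis hn : (2 <= n)%N.
Hypothesis hmu : SO_invariant_measure mu.
Hypothesis hs : sphere_invariant_measure sigma.
Variable delta : ('rV[R]_n -> R) -> R.
Hypothesis delta_linear : forall a g f, sphere_poly g -> sphere_poly f ->
  delta (fun x => a * g x + f x) = a * delta g + delta f.
Hypothesis delta_ge0 : forall g, sphere_poly g -> (forall u, sphere R n u -> 0 <= g u) ->
  0 <= delta g.
Implicit Types (F G : 'rV[R]_n -> R) (u v : 'rV[R]_n) (s t : 'M[R]_n).

Let cS := @sphere_compact R n.
Let cO := @SO_compact R n.
Let c := delta (fun=> 1).

(* The upper extension of delta from polynomials; on continuous functions it is
   the integral with respect to the measure delta. *)
Definition dhat G : R :=
  inf [set r | exists2 g, sphere_poly g & (forall u, sphere R n u -> G u <= g u) /\ r = delta g].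

Lemma delta_mass_ge0 : 0 <= c.
Proof. by apply: delta_ge0 => //; exact: SPconst. Qed.

Lemma delta_shift g a : sphere_poly g -> delta (fun x => g x + a) = delta g + a * c.
Proof.
move=> hg; rewrite (_ : (fun x => _) = (fun x => a * 1 + g x)).
  by rewrite delta_linear//; [rewrite addrC|exact: SPconst].
by apply/funext => x; rewrite mulr1 addrC.
Qed.

Lemma delta_le g f : sphere_poly g -> sphere_poly f ->
  (forall u, sphere R n u -> g u <= f u) -> delta g <= delta f.
Proof.
move=> hg hf gf; have : 0 <= delta (fun x => -1 * g x + f x).
  apply: delta_ge0; first by apply: SPadd => //; exact: sphere_polyZ.
  by move=> u hu; have := gf u hu; lra.
by rewrite delta_linear//; lra.
Qed.

Lemma delta_cst a : delta (fun=> a) = a * c.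
Proof.
have z : delta (fun=> 0) = 0.
  have := @delta_linear (-1) _ _ (@SPconst R n 0) (@SPconst R n 0).
  rewrite (_ : (fun x => _) = (fun=> 0)); last by apply/funext => x; rewrite mulr0 addr0.
  by rewrite mulN1r addNr.
have := @delta_shift _ a (@SPconst R n 0).
by rewrite z !add0r.
Qed.

(** g + e is a competitor in the infimum, and monotonicity of delta keeps every competitor above g -
    e. Further properties of [dhat] follow from this bound by polynomial approximation. *)
Lemma dhat_approx G g e : sphere_poly g -> (forall u, sphere R n u -> `|g u - G u| <= e) ->
  `|delta g - dhat G| <= c * e.
Proof.
move=> hg hgG.
have gc a : sphere_poly (fun x => g x + a) by apply: SPadd => //; exact: SPconst.
have lb (r : R) : [set r | exists2 g, sphere_poly g &
   (forall u, sphere R n u -> G u <= g u) /\ r = delta g] r -> delta g - e * c <= r.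
  move=> [f hf [Gf ->]]; rewrite -mulNr -delta_shift//; apply: delta_le => // u hu.
  by have := hgG u hu; have := Gf u hu; rewrite ler_norml => ? /andP[]; lra.
have inA : [set r | exists2 g, sphere_poly g &
   (forall u, sphere R n u -> G u <= g u) /\ r = delta g] (delta g + e * c).
  exists (fun x => g x + e) => //; split; last by rewrite delta_shift.
  by move=> u hu; have := hgG u hu; rewrite ler_norml => /andP[]; lra.
have h1 : dhat G <= delta g + e * c by apply: ge_inf => //; exists (delta g - e * c).
have h2 : delta g - e * c <= dhat G by apply: lb_le_inf => //; exists (delta g + e * c).
by rewrite ler_norml; apply/andP; split; lra.
Qed.

Lemma dhat_poly g : sphere_poly g -> dhat g = delta g.
Proof.
move=> hg; apply/esym/eqP; rewrite -subr_eq0 -normr_eq0 eq_le normr_ge0 andbT.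
by rewrite -(mulr0 c); apply: dhat_approx => // u _; rewrite subrr normr0.
Qed.

Lemma dhat_bound G M : (forall u, sphere R n u -> `|G u| <= M) -> `|dhat G| <= c * M.
Proof.
move=> hG; have := @dhat_approx G _ M (@SPconst R n 0).
by rewrite delta_cst mul0r sub0r normrN; apply => u hu; rewrite sub0r normrN hG.
Qed.

Lemma dhat_eq F G : (forall u, sphere R n u -> F u = G u) -> dhat F = dhat G.
Proof.
move=> h; rewrite /dhat; congr inf; apply/seteqP; split=> r [g hg [h1 ->]]; exists g => //; split=> // u hu.
  by rewrite -h// h1.
by rewrite h// h1.
Qed.

Lemma dhat_linear a G F : {within sphere R n, continuous G} -> {within sphere R n, continuous F} ->
  dhat (fun x => a * G x + F x) = a * dhat G + dhat F.
Proof.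
move=> cG cF; apply: (@eq_small _ _ _ (2 * (`|a| + 1) * c)) => e e0.
have [g hg gG] := sphere_poly_dense hn hmu hs cG e0.
have [f hf fF] := sphere_poly_dense hn hmu hs cF e0.
have hgf : sphere_poly (fun x => a * g x + f x) by apply: SPadd => //; exact: sphere_polyZ.
have h1 := dhat_approx hg gG; have h2 := dhat_approx hf fF.
have h3 : `|delta (fun x => a * g x + f x) - dhat (fun x => a * G x + F x)| <= c * ((`|a| + 1) * e).
  apply: dhat_approx => // u hu; rewrite opprD addrACA -mulrBr.
  apply: le_trans (ler_normD _ _) _; rewrite normrM mulrDl mul1r lerD ?fF//.
  by rewrite ler_wpM2l ?gG.
rewrite (_ : _ - _ = a * (delta g - dhat G) + (delta f - dhat F) -
   (delta (fun x => a * g x + f x) - dhat (fun x => a * G x + F x))); last first.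
  by rewrite delta_linear//; ring.
apply: le_trans (ler_normB _ _) _.
apply: le_trans (lerD (ler_normD _ _) h3) _.
have h4 : `|a * (delta g - dhat G)| <= `|a| * (c * e) by rewrite normrM ler_wpM2l.
by lra.
Qed.

Lemma dhatZ a G : {within sphere R n, continuous G} -> dhat (fun x => a * G x) = a * dhat G.
Proof.
move=> cG; have z : dhat (fun=> 0) = 0 by rewrite (dhat_poly (@SPconst R n 0)) delta_cst mul0r.
rewrite -[RHS]addr0 -z -(dhat_linear a cG (@wc_cst R _ _ 0)).
by apply: dhat_eq => u _; rewrite addr0.
Qed.

Lemma dhatB G F : {within sphere R n, continuous G} -> {within sphere R n, continuous F} ->
  dhat (fun x => G x - F x) = dhat G - dhat F.
Proof.
move=> cG cF; rewrite -[RHS]addrC -mulN1r -(dhat_linear (-1) cF cG).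
by apply: dhat_eq => u _; rewrite mulN1r addrC.
Qed.

Lemma dhat_cst a : dhat (fun=> a) = a * c.
Proof. by rewrite (dhat_poly (@SPconst R n a)) delta_cst. Qed.

Lemma dhat_ge0 G : {within sphere R n, continuous G} -> (forall u, sphere R n u -> 0 <= G u) ->
  0 <= dhat G.
Proof.
move=> cG G0; have [g hg gG] := sphere_poly_dense hn hmu hs cG ltr01.
apply: lb_le_inf.
  exists (delta (fun x => g x + 1)), (fun x => g x + 1); first by apply: SPadd => //; exact: SPconst.
  by split=> // u hu; have := gG u hu; rewrite ler_norml => /andP[]; lra.
by move=> r [f hf [Gf ->]]; apply: delta_ge0 => // u hu; apply: le_trans (Gf u hu); exact: G0.
Qed.

Lemma dhat_le F G : {within sphere R n, continuous F} -> {within sphere R n, continuous G} ->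
  (forall u, sphere R n u -> F u <= G u) -> dhat F <= dhat G.
Proof.
move=> cF cG FG; rewrite -subr_ge0 -(dhatB cG cF); apply: dhat_ge0; first exact: wcB.
by move=> u hu; rewrite subr_ge0 FG.
Qed.

Lemma dhat_sum (I : Type) (r : seq I) (q : I -> 'rV[R]_n -> R) :
  (forall k, {within sphere R n, continuous (q k)}) ->
  dhat (fun u => \sum_(k <- r) q k u) = \sum_(k <- r) dhat (q k).
Proof.
move=> cq; elim: r => [|k r IH].
  rewrite big_nil -[RHS](mul0r c) -dhat_cst; apply: dhat_eq => u _; exact: big_nil.
rewrite big_cons -IH -[dhat (q k)]mul1r -(dhat_linear 1 (cq k) (wc_sum (r := r) cq)).
by apply: dhat_eq => u _; rewrite big_cons mul1r.
Qed.

(** The functional is carried by the common zeros of the q k. Where |G| >= e, a compact set,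
    finitely many q k have a positive sum p; hence |G| is at most a multiple of p plus e. *)
Lemma dhat_eq0 (I : choiceType) (D : set I) (q : I -> 'rV[R]_n -> R) G :
  (forall k, continuous (q k)) -> (forall k u, 0 <= q k u) ->
  (forall k, D k -> dhat (q k) = 0) -> {within sphere R n, continuous G} ->
  (forall u, sphere R n u -> G u != 0 -> exists2 k, D k & 0 < q k u) ->
  dhat G = 0.
Proof.
move=> cq q0 hq cG pos; apply: (@eq_small _ _ _ c) => e e0; rewrite subr0.
pose X := sphere R n `&` [set u | e <= `|G u|].
have cX : compact X.
  have /continuous_closedP cN := wc_norm cG.
  have /closed_subspaceP[V cV VX] := cN _ (@closed_ge R e).
  rewrite (_ : X = sphere R n `&` V); first exact: compact_closedI.
  by rewrite [RHS]setIC VX setIC.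
have [B B0 hB] := continuous_compact_bounded cS cG.
move: (cX); rewrite compact_cover => /(_ I D (fun k => [set u | 0 < q k u])).
case.
- by move=> k _; apply: (@open_comp _ _ (q k) [set x | 0 < x]) => [u _|]; [exact: cq|exact: open_gt].
- move=> u [hu]; rewrite /= => he; have [|k Dk qk] := pos u hu; last by exists k.
  by rewrite -normr_gt0 (lt_le_trans e0).
move=> D' D'D covX.
pose p u := \sum_(k <- finmap.enum_fset D') q k u.
have cqS k : {within sphere R n, continuous (q k)} by exact: continuous_subspaceT (cq k).
have cp : {within sphere R n, continuous p} by apply: wc_sum.
have p0 u : 0 <= p u by exact: sumr_ge0.
have dp : dhat p = 0.
  rewrite dhat_sum// big_seq big1// => k kD; apply: hq.
  exact: set_mem (D'D _ kD).
have pX u : X u -> p u != 0.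
  move=> /covX[k /= kD qk]; rewrite gt_eqF// /p (bigD1_seq k)//= ?finmap.fset_uniq//.
  by rewrite ltr_wpDr// sumr_ge0.
have cpX : {within X, continuous (fun u => p u ^- 1)}.
  apply: within_continuous_inv_expr => //.
  by apply: continuous_subspaceW cp => u [].
(* M bounds 1 / p on X, so that B M p >= B >= |G| there. *)
have [M M0 hM] := continuous_compact_bounded cX cpX.
have cb : {within sphere R n, continuous (fun u => B * M * p u + e)}.
  by apply: wcD; [exact: wcZ|exact: wc_cst].
have bound u : sphere R n u -> `|G u| <= B * M * p u + e.
  move=> hu; have [he|he] := leP e `|G u|.
    apply: le_trans (hB u hu) _; rewrite -mulrA; apply: le_trans (_ : B <= B * (M * p u)) _.
      rewrite ler_peMr ?(ltW B0)//.
      have Xu : X u by [].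
      have pu : 0 < p u by rewrite lt_def pX// p0.
      have := hM u Xu; rewrite expr1 ger0_norm ?invr_ge0// => h.
      by rewrite -ler_pdivrMr// mul1r.
    by rewrite lerDl ltW.
  by apply: (le_trans (ltW he)); rewrite lerDr mulr_ge0// mulr_ge0// ltW.
have dbE : dhat (fun u => B * M * p u + e) = c * e.
  by rewrite (dhat_linear _ cp (@wc_cst R _ _ e)) dp mulr0 add0r dhat_cst mulrC.
rewrite -dbE ler_norml; apply/andP; split.
  rewrite lerNl -mulN1r -dhatZ//; apply: dhat_le => //; first exact: wcZ.
  by move=> u hu; rewrite mulN1r; apply: le_trans (bound u hu); rewrite -normrN ler_norm.
by apply: dhat_le => // u hu; apply: le_trans (bound u hu); rewrite ler_norm.
Qed.

Lemma wc_sphere_mulmx G t : orthogonal R n t -> {within sphere R n, continuous G} ->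
  {within sphere R n, continuous (fun u => G (u *m t))}.
Proof.
move=> ot; apply: wc_comp; first exact: mulmxr_continuous.
by move=> u hu; rewrite /sphere/= orthogonal_enorm.
Qed.

Lemma dhat_mulmx G t : orthogonal R n t ->
  (forall g, sphere_poly g -> delta (fun x => g (x *m t)) = delta g) ->
  {within sphere R n, continuous G} -> dhat (fun u => G (u *m t)) = dhat G.
Proof.
move=> ot inv cG; apply: (@eq_small _ _ _ (2 * c)) => e e0.
have [g hg gG] := sphere_poly_dense hn hmu hs cG e0.
have h1 := dhat_approx hg gG.
have : `|delta (fun x => g (x *m t)) - dhat (fun u => G (u *m t))| <= c * e.
  apply: dhat_approx; first exact: sphere_poly_mulmx.
  by move=> u hu; apply: gG; rewrite /sphere/= orthogonal_enorm.
by rewrite inv// distrC => h2; have := ler_distD (delta g) (dhat (fun u => G (u *m t))) (dhat G); lra.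
Qed.

Lemma dhat_orbit_continuous G : {within sphere R n, continuous G} ->
  {within SO R n, continuous (fun t => dhat (fun u => G (u *m t)))}.
Proof.
move=> cG; apply/subspace_continuousP => t ht; apply/cvgrPdist_le => e e0.
(* The mass c may be 0 here, hence c + 1 as divisor. *)
have c1 : 0 < c + 1 by rewrite ltr_wpDl// delta_mass_ge0.
have e1 : 0 < e / (c + 1) by rewrite divr_gt0.
have [d d0 hd] := compact_unif_continuous cS cG e1.
have N0 : 0 < n%:R * n%:R :> R by rewrite mulr_gt0// ltr0n ltnW.
have b0 : 0 < d / (n%:R * n%:R) by rewrite divr_gt0.
apply/nbhs_ballP; exists (d / (n%:R * n%:R)) => //= s; rewrite -ball_normE/= => hts hs'.
have ct r : SO R n r -> {within sphere R n, continuous (fun u => G (u *m r))}.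
  by move=> hr; apply: wc_sphere_mulmx => //; exact: SO_orthogonal.
rewrite -dhatB//; [|exact: ct|exact: ct].
apply: (@le_trans _ _ (c * (e / (c + 1)))); last first.
  rewrite mulrCA ler_piMr ?(ltW e0)// ler_pdivrMr//; lra.
apply: dhat_bound => u hu; apply: hd; [exact: SO_sphere|exact: SO_sphere|].
rewrite -mulmxBr; apply: le_lt_trans (norm_le_enorm _) _; apply: le_lt_trans (enorm_mulmx_le _ _) _.
by rewrite hu mulr1 mulrA -ltr_pdivlMl// mulrC.
Qed.

(** Both sides are Lipschitz in G for the sup norm, with constants Mh and Mf c, and they agree on
    the dense class of polynomials. This admits negative powers of h as test functions. *)
Lemma crofton_continuous (h : 'rV[R]_n -> R) (f : 'M[R]_n -> R) : {within sphere R n, continuous h} -> {within SO R n, continuous f} ->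
  (forall g, sphere_poly g -> \int[sigma]_(u in sphere R n) (h u * g u) =
     \int[mu]_(t in SO R n) (f t * delta (fun x => g (x *m t)))) ->
  forall G, {within sphere R n, continuous G} ->
  \int[sigma]_(u in sphere R n) (h u * G u) =
  \int[mu]_(t in SO R n) (f t * dhat (fun x => G (x *m t))).
Proof.
move=> ch cf H G cG.
have [Mh Mh0 hh] := continuous_compact_bounded cS ch.
have [Mf Mf0 hf] := continuous_compact_bounded cO cf.
apply: (@eq_small _ _ _ (Mh + Mf * c)) => e e0.
have [g hg gG] := sphere_poly_dense hn hmu hs cG e0.
have cg : {within sphere R n, continuous g}.
  by apply: continuous_subspaceT; exact: sphere_poly_continuous.
have E1 : \int[mu]_(t in SO R n) (f t * dhat (fun x => g (x *m t))) =
   \int[sigma]_(u in sphere R n) (h u * g u).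
  by rewrite H//; apply: ci_eq => t _; rewrite dhat_poly//; exact: sphere_poly_mulmx.
have cfG F : {within sphere R n, continuous F} ->
    {within SO R n, continuous (fun t => f t * dhat (fun x => F (x *m t)))}.
  by move=> cF; apply: wcM => //; exact: dhat_orbit_continuous.
have chG F : {within sphere R n, continuous F} -> {within sphere R n, continuous (fun u => h u * F u)}.
  by move=> cF; exact: wcM.
have B1 : `|\int[sigma]_(u in sphere R n) (h u * G u) - \int[sigma]_(u in sphere R n) (h u * g u)| <= Mh * e.
  rewrite -(ciB _ cS (chG _ cG) (chG _ cg)).
  have cc := wcB (chG _ cG) (chG _ cg).
  apply: le_trans (ci_norm _ cS cc) _; rewrite -(ci_cst cS hs.1 (Mh * e)).
  apply: ci_le => //; [exact: wc_norm|exact: wc_cst|] => u hu.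
  by rewrite -mulrBr normrM ler_pM// ?hh// distrC gG.
have B2 : `|\int[sigma]_(u in sphere R n) (h u * g u) -
    \int[mu]_(t in SO R n) (f t * dhat (fun x => G (x *m t)))| <= Mf * c * e.
  rewrite -E1 -(ciB _ cO (cfG _ cg) (cfG _ cG)).
  have cc := wcB (cfG _ cg) (cfG _ cG).
  apply: le_trans (ci_norm _ cO cc) _; rewrite -(ci_cst cO hmu.1 (Mf * c * e)).
  apply: ci_le => //; [exact: wc_norm|exact: wc_cst|] => t ht.
  rewrite -mulrBr normrM -mulrA ler_pM// ?hf//.
  have ct F : {within sphere R n, continuous F} -> {within sphere R n, continuous (fun u => F (u *m t))}.
    by move=> cF; apply: wc_sphere_mulmx => //; exact: SO_orthogonal.
  rewrite -(dhatB (ct _ cg) (ct _ cG)); apply: dhat_bound => u hu; apply: gG; exact: SO_sphere.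
apply: le_trans (ler_distD (\int[sigma]_(u in sphere R n) (h u * g u)) _ _) _; lra.
Qed.

End PositiveFunctional.

(** * Rigidity of functions on the sphere *)

Section LocallyConstant.
Context {R : realType} {n : nat}.
Implicit Types (E s t : 'M[R]_n) (u v w z : 'rV[R]_n).

(* With p = u E, q = p / |p|, z in E a unit vector orthogonal to p and
   w = l q + m z, l^2 + m^2 = 1, the product s of the reflections in q and w
   fixes E and <u, u s> = 1 - 2 |p|^2 m^2. *)
Lemma stabilizer_rotation E u : E^T = E -> E *m E = E -> (2 <= \rank E)%N ->
  sphere R n u -> u *m E != 0 ->
  exists2 r, 0 < r & forall d, 1 - r <= d -> d <= 1 ->
    exists s, [/\ SO R n s, Gr_act s E = E & dot u (u *m s) = d].
Proof.
move=> hT hE rE hu p0; set p := u *m E.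
have pE : p *m E = p by rewrite /p -mulmxA hE.
have dEE x y : dot (x *m E) y = dot x (y *m E) by rewrite dot_mulmx hT.
have up : dot u p = dot p p by rewrite /p [RHS]dEE -mulmxA hE.
have np0 : 0 < enorm p by rewrite enorm_gt0.
pose q := (enorm p)^-1 *: p.
have hq : sphere R n q by exact: sphere_normalize.
have qE : q *m E = q by rewrite -scalemxAl pE.
have uq : dot u q = enorm p by rewrite dotZr up -enorm_sqr expr2 mulKf// gt_eqF.
have pq : p = enorm p *: q by rewrite /q scalerA divff ?scale1r// gt_eqF.
clearbody q.
have [z [hz zE qz]] : exists z, [/\ sphere R n z, z *m E = z & dot q z = 0].
  have [F] := projection_basis hT hE; move: rE F; move: (\rank E) => k hk F [F1 F2].
  have [y hy Fy] : exists2 y, sphere R k y & y *m (F *m q^T) = 0.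
    by apply: kernel_unit; apply: leq_ltn_trans (rank_leq_col _) hk.
  exists (y *m F); split.
  - by rewrite /sphere/= /enorm dot_mulmx -mulmxA F1 mulmx1.
  - by rewrite -F2 !mulmxA -(mulmxA y) F1 mulmx1.
  - rewrite dotC; have := dotE (y *m F) q; rewrite -mulmxA Fy => /matrixP/(_ 0 0).
    by rewrite !mxE eqxx mulr1n.
have uz : dot u z = 0 by rewrite -zE -dEE -/p pq dotZl qz mulr0.
exists (2 * enorm p ^+ 2); first by rewrite mulr_gt0// exprn_gt0.
move=> d dr d1.
pose m2 := (1 - d) / (2 * enorm p ^+ 2).
have pp : 0 < 2 * enorm p ^+ 2 by rewrite mulr_gt0// exprn_gt0.
have m20 : 0 <= m2 by rewrite divr_ge0 ?subr_ge0// ltW.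
have m21 : m2 <= 1 by rewrite ler_pdivrMr//; lra.
pose l := Num.sqrt (1 - m2); pose m := Num.sqrt m2.
have lE : l ^+ 2 = 1 - m2 by rewrite sqr_sqrtr// subr_ge0.
have mE : m ^+ 2 = m2 by rewrite sqr_sqrtr.
pose w := l *: q + m *: z.
have hw : sphere R n w.
  apply: sphereP; rewrite /w dotDl !dotDr !dotZl !dotZr (dotC z q) qz (dot_sphere hq) (dot_sphere hz).
  by rewrite !mulr1 !mulr0 addr0 add0r -!expr2 lE mE subrK.
have wE : w *m E = w by rewrite mulmxDl -!scalemxAl qE zE.
have uw : dot u w = l * enorm p by rewrite dotDr !dotZr uq uz mulr0 addr0.
have qw : dot q w = l by rewrite dotDr !dotZr (dot_sphere hq) qz mulr1 mulr0 addr0.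
exists (refl q *m refl w); split.
- exact: reflM_SO.
- by rewrite Gr_actM !Gr_act_refl//; left.
- clearbody w; rewrite mulmxA (mul_refl q u) uq mul_refl !dotBr dotZr dotZr dotBl dotZl.
  rewrite uw qw uq (dot_sphere hu).
  have : m2 * (2 * enorm p ^+ 2) = 1 - d by rewrite divfK// gt_eqF.
  have : l ^+ 2 = 1 - m2 by [].
  rewrite !expr2; nra.
Qed.

(* Passing to midpoints doubles r until orthogonal vectors are compared, and any
   two vectors have a common orthogonal one as n >= 3. *)
Lemma sphere_locally_constant (a : 'rV[R]_n -> R) (r : R) : (3 <= n)%N -> 0 < r ->
  (forall v w, sphere R n v -> sphere R n w -> 1 - r <= dot v w -> a v = a w) ->
  forall v w, sphere R n v -> sphere R n w -> a v = a w.
Proof.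
move=> hn r0.
pose P (e : R) := forall v w, sphere R n v -> sphere R n w -> 1 - e <= dot v w -> a v = a w.
rewrite -/(P r) => hr.
have double e : 0 < e -> e < 1 -> P e -> P (2 * e).
  move=> e0 e1 he v w hv hw hvw.
  have nvw : enorm (v + w) ^+ 2 = 2 * (1 + dot v w).
    by rewrite enorm_sqr dotDl !dotDr (dotC w v) (dot_sphere hv) (dot_sphere hw); lra.
  have pos : 0 < enorm (v + w).
    by rewrite enorm_gt0 -enorm_eq0 -sqrf_eq0 nvw gt_eqF//; lra.
  pose m := (enorm (v + w))^-1 *: (v + w).
  have hm : sphere R n m by apply: sphere_normalize; rewrite -enorm_gt0.
  (* The right side is <v, m> = |v + w| / 2 >= |v + w|^2 / 4 = (1 + <v, w>) / 2. *)
  have key : 1 - e <= (enorm (v + w))^-1 * (1 + dot v w).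
    rewrite mulrC ler_pdivlMr//.
    have : enorm (v + w) <= 2.
      by rewrite (le_trans (enormD _ _))// hv hw.
    rewrite (_ : 1 + dot v w = enorm (v + w) ^+ 2 / 2); last by rewrite nvw; field.
    by rewrite expr2; nra.
  rewrite (he v m hv hm); last by rewrite dotZr dotDr (dot_sphere hv).
  apply: he => //; rewrite dotZl dotDl (dot_sphere hw) addrC addrC.
  by rewrite [dot v w + 1]addrC.
(* Doubling requires e < 1, which keeps v + w away from 0, so the range is capped at 1, that is at
   orthogonal pairs. *)
have H k : P (Num.min 1 (2 ^+ k * r)).
  elim: k => [|k IH].
    move=> v w hv hw h; apply: hr => //; apply: le_trans h.
    by rewrite lerD2l lerN2 expr0 mul1r ge_min lexx orbT.
  have [le1|lt1] := leP 1 (2 ^+ k * r).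
    move=> v w hv hw h; apply: IH => //; apply: le_trans h.
    by rewrite lerD2l lerN2 (min_l le1) ge_min lexx.
  move: IH; rewrite min_r ?(ltW lt1)// => /double => IH v w hv hw h.
  apply: (IH _ lt1) => //; first by rewrite mulr_gt0// exprn_gt0.
  by apply: le_trans h; rewrite lerD2l lerN2 mulrA -exprS ge_min lexx orbT.
have [N hN] : exists N, 1 <= 2 ^+ N * r.
  exists (Num.bound r^-1); rewrite -ler_pdivrMr// mul1r ltW//.
  exact: upper_nthrootP.
move: (H N); rewrite min_l// /P subrr => H1 v w hv hw.
have [z [hz vz wz]] := perp_unit2 v w hn.
by rewrite (H1 v z hv hz) ?vz// (H1 w z hw hz) ?wz.
Qed.

End LocallyConstant.

(** * Testing against continuous functions, Jensen's inequality and lines *)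

Section TestFunctions.
Context {R : realType} {n : nat}.
Variables (mu : probability (borel_mx R n n) R) (sigma : probability (borel_mx R 1 n) R).
Hypothesis hn : (2 <= n)%N.
Hypothesis hmu : SO_invariant_measure mu.
Hypothesis hs : sphere_invariant_measure sigma.
Implicit Types F G H : 'rV[R]_n -> R.

Let cS := @sphere_compact R n.

Lemma sphere_test_eq0 H : {within sphere R n, continuous H} ->
  (forall G, {within sphere R n, continuous G} -> \int[sigma]_(u in sphere R n) (H u * G u) = 0) ->
  forall u, sphere R n u -> H u = 0.
Proof.
move=> cH h u hu; apply/eqP; rewrite -sqrf_eq0 expr2; apply/eqP.
apply: (sphere_continuous_eq0 hn hmu hs (F := fun u => H u * H u)) => //.
- exact: wcM.
- by move=> v _; rewrite -expr2 sqr_ge0.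
- by rewrite h.
Qed.

(** The test function G = |H| - H is twice the negative part of H and satisfies G^2 = - 2 H G, so
    the integral of G^2 is at most 0. *)
Lemma sphere_test_ge0 H : {within sphere R n, continuous H} ->
  (forall G, {within sphere R n, continuous G} -> (forall u, sphere R n u -> 0 <= G u) ->
     0 <= \int[sigma]_(u in sphere R n) (H u * G u)) ->
  forall u, sphere R n u -> 0 <= H u.
Proof.
move=> cH h u hu; pose G v := `|H v| - H v.
have cG : {within sphere R n, continuous G} by apply: wcB => //; exact: wc_norm.
have G0 v : 0 <= G v by rewrite subr_ge0 ler_norm.
have HG v : G v * G v = - 2 * (H v * G v).
  by rewrite /G; case: (ger0P (H v)) => _; ring.
have : G u * G u = 0.
  apply: (sphere_continuous_eq0 hn hmu hs (F := fun u => G u * G u)) => //.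
  - exact: wcM.
  - by move=> v _; rewrite mulr_ge0.
  - rewrite (ci_eq _ (fun v _ => HG v)) ciZ//; last exact: wcM.
    by have := h G cG (fun v _ => G0 v); lra.
by move=> /eqP; rewrite mulf_eq0 orbb subr_eq0 => /eqP <-.
Qed.

(* For odd n, -1 is not in SO(n); the two integrals are compared with the orbits
   of e and - e instead. *)
Lemma sphere_integralN G : {within sphere R n, continuous G} ->
  \int[sigma]_(u in sphere R n) G (- u) = \int[sigma]_(u in sphere R n) G u.
Proof.
move=> cG; have [e he _] := @perp_unit R n 0 hn.
have cN : {within sphere R n, continuous (fun u => G (- u))}.
  apply: (@wc_comp _ _ _ _ (sphere R n)) => //; last by move=> u; exact: sphereN.
  by move=> u; exact: (@continuousN R 'rV[R]_n _ id u (cvg_id)).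
rewrite (sphere_integral_SO hn hmu hs he cN) (sphere_integral_SO hn hmu hs (sphereN he) cG).
by apply: ci_eq => t _; rewrite mulNmx.
Qed.

End TestFunctions.

(** The tangent inequality at the mean m is integrated; the remainder q is non-negative and
    continuous, and in case of equality it vanishes everywhere. *)
Lemma sphere_jensen {R : realType} {n : nat} (mu : probability (borel_mx R n n) R)
    (sigma : probability (borel_mx R 1 n) R) (F : 'rV[R]_n -> R) : (2 <= n)%N ->
  SO_invariant_measure mu -> sphere_invariant_measure sigma ->
  {within sphere R n, continuous F} -> (forall u, sphere R n u -> 0 < F u) ->
  let m := \int[sigma]_(u in sphere R n) F u in
  [/\ 0 < m, m ^- n <= \int[sigma]_(u in sphere R n) (F u) ^- n &
      \int[sigma]_(u in sphere R n) (F u) ^- n <= m ^- n -> forall u, sphere R n u -> F u = m].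
Proof.
move=> hn hmu hs cF F0 m; have cS := @sphere_compact R n.
have m0 : 0 < m.
  rewrite ltNge; apply/negP => mle; have [e he _] := @perp_unit R n 0 hn.
  have := sphere_continuous_eq0 hn hmu hs cF (fun u hu => ltW (F0 u hu)) mle he.
  by move=> Fe; have := F0 e he; rewrite Fe ltxx.
have Fn0 u : sphere R n u -> F u != 0 by move=> /F0 /lt0r_neq0.
have cI k : {within sphere R n, continuous (fun u => F u ^- k)}.
  exact: within_continuous_inv_expr.
pose q u := (F u - m) ^+ 2 / (m ^+ 2 * F u ^+ n).
have cq : {within sphere R n, continuous q}.
  rewrite (_ : q = fun u => (m ^+ 2)^-1 * ((F u - m) ^+ 2 * F u ^- n)).
    by apply: wcZ; apply: wcM => //; apply: wcX; apply: wcB => //; exact: wc_cst.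
  by apply/funext => u; rewrite /q invfM mulrCA.
have q0 u : sphere R n u -> 0 <= q u.
  by move=> hu; rewrite divr_ge0 ?sqr_ge0// mulr_ge0 ?sqr_ge0// exprn_ge0// ltW// F0.
have key : \int[sigma]_(u in sphere R n) q u <= \int[sigma]_(u in sphere R n) F u ^- n - m ^- n.
  (* Since F has mean m, the affine part integrates to - (n + 1) m^-n + n m^-(n+1) m = - m^-n. *)
  have -> : \int[sigma]_(u in sphere R n) F u ^- n - m ^- n =
     \int[sigma]_(u in sphere R n) (F u ^- n - n.+1%:R * m ^- n + (n%:R * m ^- n.+1) * F u).
    rewrite ciD//; last 2 first.
    - by apply: wcB => //; exact: wc_cst.
    - exact: wcZ.
    rewrite ciB//; last exact: wc_cst.
    rewrite (ci_cst cS hs.1) ciZ// -/m -addrA; congr (_ + _).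
    have mn : m ^+ n != 0 by rewrite expf_neq0 ?gt_eqF.
    by rewrite -natr1 exprS; field; rewrite mn gt_eqF.
  apply: ci_le => //.
    apply: wcD; last exact: wcZ.
    by apply: wcB => //; exact: wc_cst.
  move=> u hu; have := tangent_inverse_power (ltnW hn) (F0 u hu) m0.
  by rewrite /q (mulrA n%:R) (mulrAC n%:R).
have iq : 0 <= \int[sigma]_(u in sphere R n) q u by exact: ci_ge0.
split=> //; first by lra.
move=> h u hu; have : q u = 0.
  by apply: (sphere_continuous_eq0 hn hmu hs cq q0) => //; lra.
move=> qu0; have : (F u - m) ^+ 2 = q u * (m ^+ 2 * F u ^+ n).
  by rewrite divfK// mulf_neq0// expf_neq0 ?Fn0// gt_eqF.
by rewrite qu0 mul0r => /eqP; rewrite sqrf_eq0 subr_eq0 => /eqP.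
Qed.

Lemma Gr_integral_SO {R : realType} {n i : nat} (mu nu : probability (borel_mx R n n) R)
    (E0 : 'M[R]_n) (F : 'M[R]_n -> R) : (0 < n)%N ->
  SO_invariant_measure mu -> Gr_invariant_measure i nu -> Gr R i n E0 ->
  {within SO R n, continuous (fun t => F (Gr_act t E0))} ->
  \int[nu]_(E in Gr R i n) F E = \int[mu]_(t in SO R n) F (Gr_act t E0).
Proof.
move=> n0 hmu hnu hE0 cF; have imG : (fun t => Gr_act t E0) @` SO R n = Gr R i n.
  apply/seteqP; split=> E.
    by move=> [t ht <-]; apply: Gr_act_Gr => //; exact: SO_orthogonal.
  by move=> hE; have [t ht tE] := SO_Gr_trans n0 hE0 hE; exists t.
have cGr : {within Gr R i n, continuous F}.
  apply: (quotient_continuous _ (@SO_compact R n) (@Gr_act_continuous R n E0) imG cF).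
  exact: norm_hausdorff.
have cG : compact (Gr R i n).
  rewrite -imG; apply: continuous_compact; last exact: SO_compact.
  by apply: continuous_subspaceT; exact: Gr_act_continuous.
have [M _ hM] := continuous_compact_bounded cG cGr.
apply: (@Rintegral_image _ _ (borel_mx R n n) (borel_mx R n n) R mu nu (fun t => Gr_act t E0) _ _ _ M) => //.
- move=> _ A mA; rewrite setTI; apply: (@mx_measurable R n n n n (fun t => Gr_act t E0)) => //.
  exact: Gr_act_continuous.
- by move=> A mA; exact: (Gr_measureE hmu n0 hnu hE0 mA).
- exact: measurable_SO.
- exact: measurable_Gr n0 hE0.
- exact: hmu.1.
- by move=> t ht; rewrite -imG; exists t.
- apply: continuous_measurable_within => //; apply: compact_closed cG; exact: norm_hausdorff.
Qed.

Lemma line_projection {R : realType} {n : nat} (E : 'M[R]_n) : Gr R 1 n E ->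
  exists2 e, sphere R n e & E = e^T *m e.
Proof.
move=> /Gr_basis[e [e1 eE]]; exists e => //; apply: sphereP.
by have := dotE e e; rewrite e1 => /matrixP/(_ 0 0); rewrite !mxE eqxx !mulr1n.
Qed.

Lemma sphere_line {R : realType} {n : nat} (u e : 'rV[R]_n) : sphere R n u -> sphere R n e ->
  u *m (e^T *m e) = u -> u = e \/ u = - e.
Proof.
move=> hu he; rewrite mulmxA dotE mul_scalar_mx => h.
have : `|dot u e| = 1 by rewrite -hu -{2}h enormZ he mulr1.
by case: (ger0P (dot u e)) => _ d1; [left|right]; rewrite -h ?d1 ?scale1r// -[dot u e]opprK d1 scaleN1r.
Qed.

Lemma Gr_act_line {R : realType} {n : nat} (t : 'M[R]_n) (e : 'rV[R]_n) :
  Gr_act t (e^T *m e) = (e *m t)^T *m (e *m t).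
Proof. by rewrite /Gr_act trmx_mul !mulmxA. Qed.

Lemma Gr_act_compl {R : realType} {n : nat} (t E : 'M[R]_n) : orthogonal R n t ->
  Gr_act t (1%:M - E) = 1%:M - Gr_act t E.
Proof. by move=> ot; rewrite /Gr_act mulmxBr mulmx1 mulmxBl orthogonalC. Qed.

Lemma kappa1 (R : realType) : kappa R 1 = 2.
Proof.
rewrite /kappa (@vol_segment _ _ (-1) 1).
- by rewrite opprK.
- by rewrite lerN10 || rewrite (le_trans (lerN10 _) ler01).
move=> x; rewrite /eball/= /enorm /dot big_ord1 -expr2 sqrtr_sqr ler_norml.
by split=> [/andP|h]; last exact/andP.
Qed.

(** * The inequalities and their equality cases *)

Section Crofton.
Context {R : realType} {n i : nat}.
Variables (mu : probability (borel_mx R n n) R) (sigma : probability (borel_mx R 1 n) R).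
Variables (E0 : 'M[R]_n) (Phi : set 'rV[R]_n -> set 'rV[R]_n).
Variable delta : ('rV[R]_n -> R) -> R.
Hypothesis hn : (2 <= n)%N.
Hypothesis hmu : SO_invariant_measure mu.
Hypothesis hs : sphere_invariant_measure sigma.
Hypothesis hE0 : Gr R i n E0.
Hypothesis hPhi : body_map Phi.
Hypothesis hcrofton : spherical_crofton i mu sigma E0 Phi delta.
Hypothesis hdelta : nonneg_distribution delta.
Hypothesis hball : Phi (eball R n) = dilate (kappa R n.-1) (eball R n).
Implicit Types (F G : 'rV[R]_n -> R) (u v : 'rV[R]_n) (s t : 'M[R]_n) (K L : set 'rV[R]_n).

Let cS := @sphere_compact R n.
Let cO := @SO_compact R n.
Let c := kappa R n.-1 / kappa R i.
Let h L := support_fun (Phi L).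
Let f L t := proj_vol i L (Gr_act t E0).
Let dh := dhat delta.

Let delta_linear a g q : sphere_poly g -> sphere_poly q ->
  delta (fun x => a * g x + q x) = a * delta g + delta q.
Proof.
by move=> hg hq; have [[lin _] _ _] := hcrofton; apply: lin; exact: sphere_poly_smooth.
Qed.

Let delta_ge0 g : sphere_poly g -> (forall u, sphere R n u -> 0 <= g u) -> 0 <= delta g.
Proof. by move=> hg; apply: hdelta; exact: sphere_poly_smooth. Qed.

(** One fixed frame of E0, moved by t, serves all subspaces of the orbit; the basis chosen by [xget]
    in [proj_vol] need not depend continuously on t. *)
Lemma brightness_frame : exists2 F : 'M[R]_(i, n), F *m F^T = 1%:M &
  forall L t, compact L -> orthogonal R n t -> f L t = vol [set x *m (F *m t)^T | x in L].
Proof.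
have [F hF] := Gr_basis hE0; exists F; first by case: hF.
by move=> L t cL ht; apply: proj_volE => //; exact: orthonormal_basis_act.
Qed.

Lemma brightness_continuous L : convex_body L -> has_ball L ->
  {within SO R n, continuous (f L)}.
Proof.
move=> bL hL; have [_ cL _] := bL; have [F F1 fE] := brightness_frame.
apply: wc_eq (frame_vol_continuous bL hL F1) => t ht.
by rewrite fE//; exact: SO_orthogonal.
Qed.

Lemma brightness_gt0 L t : convex_body L -> has_ball L -> SO R n t -> 0 < f L t.
Proof.
move=> bL hL ht; have [_ cL _] := bL; have [F F1 fE] := brightness_frame.
rewrite (fE L t cL (SO_orthogonal ht)).
apply: frame_vol_gt0 => //; rewrite trmx_mul mulmxA -(mulmxA F).
by rewrite (SO_orthogonal ht) mulmx1.
Qed.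

Lemma brightness_lower L : convex_body L -> has_ball L ->
  exists2 m, 0 < m & forall t, SO R n t -> m <= f L t.
Proof.
move=> bL hL; have S0 : SO R n !=set0 by exists 1%:M; exact: SO1.
have [t /set_mem ht hmin] := compact_EVT_min S0 cO (brightness_continuous bL hL).
exists (f L t); first exact: brightness_gt0.
by move=> s hs'; apply: hmin; exact: mem_set.
Qed.

Lemma valuation_support_continuous L : convex_body L -> {within sphere R n, continuous (h L)}.
Proof. by move=> bL; apply: continuous_subspaceT; exact: support_fun_continuous (hPhi bL). Qed.

Lemma crofton_formula L G : convex_body L -> has_ball L -> {within sphere R n, continuous G} ->
  \int[sigma]_(u in sphere R n) (h L u * G u) =
  \int[mu]_(t in SO R n) (f L t * dh (fun x => G (x *m t))).
Proof.
move=> bL hL; apply: (crofton_continuous hn hmu hs delta_linear delta_ge0).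
- exact: valuation_support_continuous.
- exact: brightness_continuous.
- by move=> g hg; have [_ _] := hcrofton; apply => //; exact: sphere_poly_smooth.
Qed.

Lemma eball_has_ball : has_ball (eball R n).
Proof. by exists 0, 1; split=> // y hy; rewrite add0r. Qed.

Lemma crofton_ball G : {within sphere R n, continuous G} ->
  \int[mu]_(t in SO R n) dh (fun x => G (x *m t)) = c * \int[sigma]_(u in sphere R n) G u.
Proof.
move=> cG; have := crofton_formula eball_body eball_has_ball cG.
rewrite (@ci_eq _ _ _ sigma _ _ (fun u => kappa R n.-1 * G u)); last first.
  move=> u hu; rewrite /h hball support_fun_dilate; last exact: eball_body.
  by rewrite support_fun_eball enormZ hu mulr1 gtr0_norm// kappa_gt0.
rewrite [in X in _ = X -> _](@ci_eq _ _ _ mu _ _ (fun t => kappa R i * dh (fun x => G (x *m t)))); last first.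
  move=> t ht; rewrite /f proj_vol_eball//; apply: Gr_act_Gr => //; exact: SO_orthogonal.
rewrite !ciZ//; last exact: (dhat_orbit_continuous hn hmu hs delta_linear delta_ge0).
have k0 := @kappa_gt0 R i.
by move=> e; rewrite /c mulrAC e mulrAC divff ?mul1r// gt_eqF.
Qed.

Lemma delta_massE : delta (fun=> 1) = c.
Proof.
have := crofton_ball (@wc_cst R _ _ 1).
rewrite (ci_cst cS hs.1) mulr1 => <-.
rewrite (@ci_eq _ _ _ mu _ _ (fun=> delta (fun=> 1))); first by rewrite (ci_cst cO hmu.1).
by move=> t _; rewrite /dh (dhat_poly delta_linear delta_ge0 (@SPconst R n 1)).
Qed.

Lemma crofton_mass_gt0 : 0 < c.
Proof. by rewrite divr_gt0// kappa_gt0. Qed.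

(** With m a positive lower bound of f, testing h L - m c against G >= 0 gives the average of (f L -
    m) times a non-negative value of the functional; hence h L >= m c. *)
Lemma valuation_support_gt0 L : convex_body L -> has_ball L ->
  forall u, sphere R n u -> 0 < h L u.
Proof.
move=> bL hL u hu; have [m m0 hm] := brightness_lower bL hL.
have ch := valuation_support_continuous bL.
have mc0 : 0 < m * c by rewrite mulr_gt0// crofton_mass_gt0.
suff : 0 <= h L u - m * c by lra.
apply: (sphere_test_ge0 hn hmu hs (H := fun u => h L u - m * c)) => //.
  by apply: wcB => //; exact: wc_cst.
move=> G cG G0.
have cd : {within SO R n, continuous (fun t => dh (fun x => G (x *m t)))}.
  exact: (dhat_orbit_continuous hn hmu hs delta_linear delta_ge0).
rewrite (@ci_eq _ _ _ sigma _ _ (fun v => h L v * G v - m * c * G v)); last by move=> v _; rewrite mulrBl.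
rewrite ciB//; [|exact: wcM|exact: wcZ].
rewrite crofton_formula// ciZ// -mulrA -crofton_ball// -ciZ// -ciB//; last 2 first.
- by apply: wcM => //; exact: brightness_continuous.
- exact: wcZ.
apply: ci_ge0 => t ht; rewrite -mulrBl mulr_ge0 ?subr_ge0 ?hm//.
apply: (dhat_ge0 hn hmu hs delta_ge0).
  by apply: wc_sphere_mulmx => //; exact: SO_orthogonal.
by move=> v hv; apply: G0; exact: SO_sphere.
Qed.

(** The matrix -1 is orthogonal and fixes every subspace, so stabilizer invariance of delta applies
    to it even when its determinant is -1. *)
Lemma dhat_even G : {within sphere R n, continuous G} -> dh (fun u => G (- u)) = dh G.
Proof.
move=> cG; rewrite (_ : (fun u => _) = (fun u => G (u *m (- 1%:M)))); last first.
  by apply/funext => u; rewrite mulmxN mulmx1.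
have tN : (- 1%:M : 'M[R]_n)^T = - 1%:M by rewrite linearN/= trmx1.
have oN : orthogonal R n (- 1%:M) by rewrite /orthogonal/= tN mulNmx mulmxN opprK mulmx1.
apply: (dhat_mulmx hn hmu hs delta_linear delta_ge0) => // g hg.
have [_ inv _] := hcrofton; apply: inv => //; last exact: sphere_poly_smooth.
by rewrite /Gr_act tN mulNmx mul1mx mulNmx mulmxN opprK mulmx1.
Qed.

Lemma wc_sphereN G : {within sphere R n, continuous G} ->
  {within sphere R n, continuous (fun u => G (- u))}.
Proof.
move=> cG; apply: (@wc_comp _ _ _ _ (sphere R n)) => //; last by move=> u; exact: sphereN.
by move=> u; exact: (@continuousN R 'rV[R]_n _ id u (cvg_id)).
Qed.

(** Evenness of the functional passes to h L through the Crofton formula, tested with G and with its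
    reflection. *)
Lemma valuation_support_even L : convex_body L -> has_ball L ->
  forall u, sphere R n u -> h L (- u) = h L u.
Proof.
move=> bL hL u hu; have ch := valuation_support_continuous bL.
have chN := wc_sphereN ch.
apply/eqP; rewrite -subr_eq0; apply/eqP.
apply: (sphere_test_eq0 hn hmu hs (H := fun u => h L (- u) - h L u)) => //; first exact: wcB.
move=> G cG; have cGN := wc_sphereN cG.
rewrite (@ci_eq _ _ _ sigma _ _ (fun v => h L (- v) * G v - h L v * G v)); last by move=> v _; rewrite mulrBl.
rewrite ciB//; [|exact: wcM|exact: wcM].
rewrite -(sphere_integralN hn hmu hs (G := fun v => h L (- v) * G v)); last exact: wcM.
under eq_Rintegral do rewrite opprK.
rewrite !crofton_formula//; apply/eqP; rewrite subr_eq0; apply/eqP; apply: ci_eq => t ht.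
congr (_ * _); rewrite -[RHS]dhat_even; last first.
  by apply: wc_sphere_mulmx => //; exact: SO_orthogonal.
by congr dh; apply/funext => x; rewrite mulNmx.
Qed.

Section Body.
Variable K : set 'rV[R]_n.
Hypothesis bK : convex_body K.
Hypothesis ballK : has_ball K.

Let J := \int[sigma]_(u in sphere R n) (h K u) ^- n.
Let J' := \int[mu]_(t in SO R n) (f K t) ^- n.
Let I := \int[sigma]_(u in sphere R n) h K u.

Let c0 : 0 < c := crofton_mass_gt0.
Let ch := valuation_support_continuous bK.
Let cf := brightness_continuous bK ballK.
Let h0 := valuation_support_gt0 bK ballK.
Let n0 : (0 < n)%N := ltnW hn.

Lemma polar_volE : vol (polar (Phi K)) = kappa R n * J.
Proof.
apply: (sublevel_volE hmu hn hs) => //; first exact: support_fun_continuous (hPhi bK).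
by move=> a x a0; rewrite support_funZ//; exact: hPhi.
Qed.

Lemma quermassintegralE nu : Gr_invariant_measure i nu ->
  quermassintegral i nu K = kappa R n / kappa R n.-1 * I.
Proof.
move=> hnu; rewrite /quermassintegral (Gr_integral_SO n0 hmu hnu hE0 cf).
have := crofton_formula bK ballK (@wc_cst R _ _ 1).
rewrite (@ci_eq _ _ _ sigma _ _ (h K)); last by move=> u _; rewrite mulr1.
rewrite [in X in _ = X -> _](@ci_eq _ _ _ mu _ _ (fun t => c * f K t)); last first.
  by move=> t _; rewrite /dh (dhat_poly delta_linear delta_ge0 (@SPconst R n 1)) delta_massE mulrC.
rewrite ciZ// /I => ->; rewrite mulrA; congr (_ * _).
by rewrite /c; field; rewrite !gt_eqF// kappa_gt0.
Qed.

Lemma affine_quermassintegralE nu : Gr_invariant_measure i nu ->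
  affine_quermassintegral i nu K ^+ n = (kappa R n / kappa R i) ^+ n / J'.
Proof.
move=> hnu.
have f0 t : SO R n t -> f K t != 0 by move=> ht; rewrite gt_eqF// brightness_gt0.
have cI : {within SO R n, continuous (fun t => f K t ^- n)} by exact: within_continuous_inv_expr.
rewrite /affine_quermassintegral exprMn.
rewrite (Gr_integral_SO (F := fun E => proj_vol i K E ^- n) n0 hmu hnu hE0 cI).
congr (_ * _); have J0 : 0 <= J'.
  by apply: ci_ge0 => t ht; rewrite invr_ge0 exprn_ge0// ltW// brightness_gt0.
rewrite -/(f K) -/J' -powR_mulrn ?powR_ge0// -powRrM mulNr mulVf ?powRN ?powRr1//.
by rewrite pnatr_eq0 -lt0n.
Qed.

Let a u := h K u / c.
Let ca : {within sphere R n, continuous a}.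
Proof. by apply: wcM => //; exact: wc_cst. Qed.
Let a0 u : sphere R n u -> 0 < a u.
Proof. by move=> hu; rewrite divr_gt0// h0. Qed.
Let caI k : {within sphere R n, continuous (fun u => a u ^- k)}.
Proof. by apply: within_continuous_inv_expr => // u hu; rewrite gt_eqF// a0. Qed.
Let cat k t : SO R n t -> {within sphere R n, continuous (fun u => a (u *m t) ^- k)}.
Proof.
by move=> ht; apply: (wc_sphere_mulmx (G := fun u => a u ^- k)) => //; exact: SO_orthogonal.
Qed.

(** The integral over u of the pointwise estimate, with the summands nested as a * G + F, the shape
    that [dhat_linear] splits. *)
Let D t := dh (fun u => n%:R * f K t * a (u *m t) ^- n.+1 +
   ((- n.+1%:R) * a (u *m t) ^- n + f K t ^- n)).

Let DE t : SO R n t -> D t = n%:R * (f K t * dh (fun u => a (u *m t) ^- n.+1)) -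
   n.+1%:R * dh (fun u => a (u *m t) ^- n) + c * f K t ^- n.
Proof.
move=> ht; have cc := @cat n.+1 t ht; have cc' := @cat n t ht.
have c2 : {within sphere R n, continuous (fun u => - n.+1%:R * a (u *m t) ^- n + f K t ^- n)}.
  by apply: wcD; [exact: wcZ|exact: wc_cst].
rewrite /D /dh (dhat_linear hn hmu hs delta_linear delta_ge0 _ cc c2).
rewrite (dhat_linear hn hmu hs delta_linear delta_ge0 _ cc' (@wc_cst R _ _ _)).
by rewrite (dhat_cst delta_linear delta_ge0) delta_massE mulNr -mulrA mulrA addrA [c * _]mulrC mulrA.
Qed.

Let cf0 : {within SO R n, continuous (fun t => f K t ^- n)}.
Proof. by apply: within_continuous_inv_expr => // t ht; rewrite gt_eqF// brightness_gt0. Qed.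

Let cdh k : {within SO R n, continuous (fun t => dh (fun u => a (u *m t) ^- k))}.
Proof.
by apply: (dhat_orbit_continuous hn hmu hs delta_linear delta_ge0 (G := fun u => a u ^- k)); exact: caI.
Qed.

Let D_continuous : {within SO R n, continuous D}.
Proof.
apply: (@wc_eq _ _ _ (fun t => n%:R * (f K t * dh (fun u => a (u *m t) ^- n.+1)) -
   n.+1%:R * dh (fun u => a (u *m t) ^- n) + c * f K t ^- n)).
  by move=> t ht; rewrite DE.
apply: wcD; last exact: wcZ.
by apply: wcB; apply: wcZ => //; exact: wcM.
Qed.

(** Since h K = c a, the Crofton formula evaluates the first term to n c^(n+1) J, and the formula
    for the ball evaluates the second to (n + 1) c^(n+1) J. *)
Let D_integral : \int[mu]_(t in SO R n) D t = c * (J' - c ^+ n * J).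
Proof.
rewrite (ci_eq _ DE) ciD//; last 2 first.
- by apply: wcB; apply: wcZ => //; exact: wcM.
- exact: wcZ.
rewrite ciB//; last 2 first.
- by apply: wcZ; exact: wcM.
- exact: wcZ.
rewrite !ciZ//; last exact: wcM.
rewrite -(crofton_formula bK ballK (@caI n.+1)) (crofton_ball (@caI n)) -/J'.
have E1 : \int[sigma]_(u in sphere R n) a u ^- n = c ^+ n * J.
  rewrite -ciZ//; last first.
    by apply: within_continuous_inv_expr => // u hu; rewrite gt_eqF// h0.
  apply: ci_eq => u hu; rewrite /a expr_div_n invf_div.
  by rewrite mulrC.
have E2 : \int[sigma]_(u in sphere R n) (h K u * a u ^- n.+1) = c * (c ^+ n * J).
  rewrite -E1 -ciZ//; apply: ci_eq => u hu.
  have hne : h K u != 0 by rewrite gt_eqF// h0.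
  rewrite (_ : h K u = c * a u); last by rewrite /a mulrCA divff ?mulr1// gt_eqF.
  have ane : a u != 0 by rewrite gt_eqF// a0.
  by rewrite exprS invfM -mulrA mulVKf.
by rewrite E1 E2 -natr1; ring.
Qed.

Let tangent t u : SO R n t -> sphere R n u ->
  (f K t - a (u *m t)) ^+ 2 / (a (u *m t) ^+ 2 * f K t ^+ n) <=
  n%:R * f K t * a (u *m t) ^- n.+1 + ((- n.+1%:R) * a (u *m t) ^- n + f K t ^- n).
Proof.
move=> ht hu; have := tangent_inverse_power n0 (brightness_gt0 bK ballK ht) (a0 (SO_sphere ht hu)).
by rewrite mulNr mulrA -/(f K t) => h1; lra.
Qed.

Let cD t : SO R n t -> {within sphere R n, continuous (fun u => n%:R * f K t * a (u *m t) ^- n.+1 +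
   ((- n.+1%:R) * a (u *m t) ^- n + f K t ^- n))}.
Proof.
move=> ht; apply: wcD; first by apply: wcZ; exact: cat.
by apply: wcD; [apply: wcZ; exact: cat|exact: wc_cst].
Qed.

Let D_ge0 t : SO R n t -> 0 <= D t.
Proof.
move=> ht; apply: (dhat_ge0 hn hmu hs delta_ge0 (cD ht)) => u hu.
apply: le_trans (tangent ht hu); rewrite divr_ge0 ?sqr_ge0// mulr_ge0 ?sqr_ge0// exprn_ge0//.
by rewrite ltW// brightness_gt0.
Qed.

Lemma brightness_inverse_integral_ge : c ^+ n * J <= J'.
Proof.
have : 0 <= c * (J' - c ^+ n * J) by rewrite -D_integral; apply: ci_ge0.
by rewrite pmulr_rge0// subr_ge0.
Qed.

(** D is continuous and non-negative with integral at most 0, so it vanishes at every t. The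
    quadratic remainder, multiplied by M^2 f(t)^n with M a bound for a, then dominates the squared
    difference. *)
Lemma brightness_inverse_integral_eq : J' <= c ^+ n * J ->
  forall t, SO R n t -> dh (fun u => (f K t - h K (u *m t) / c) ^+ 2) = 0.
Proof.
move=> le t ht; have D0 : D t = 0.
  apply: (SO_continuous_eq0 hmu D_continuous D_ge0) => //.
  by rewrite D_integral pmulr_rle0// subr_le0.
have [M M0 hM] := continuous_compact_bounded cS ca.
have cq : {within sphere R n, continuous (fun u => (f K t - a (u *m t)) ^+ 2)}.
  apply: wcX; apply: wcB; first exact: wc_cst.
  by apply: wc_sphere_mulmx => //; exact: SO_orthogonal.
have f0 := brightness_gt0 bK ballK ht.
apply/eqP; rewrite eq_le; apply/andP; split; last first.
  by apply: (dhat_ge0 hn hmu hs delta_ge0 cq) => u _; exact: sqr_ge0.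
rewrite -[leRHS](mulr0 (M ^+ 2 * f K t ^+ n)) -D0 /D /dh.
rewrite -(dhatZ hn hmu hs delta_linear delta_ge0 _ (cD ht)).
apply: (dhat_le hn hmu hs delta_linear delta_ge0 cq); first exact: wcZ (cD ht).
move=> u hu; have hut := SO_sphere ht hu; have aut := a0 hut.
apply: le_trans (ler_wpM2l _ (tangent ht hu)); last first.
  by rewrite mulr_ge0 ?sqr_ge0// exprn_ge0// ltW.
rewrite mulrCA ler_peMr ?sqr_ge0// -mulf_div divff ?gt_eqF ?exprn_gt0// mulr1.
rewrite ler_pdivlMr ?exprn_gt0// mul1r lerXn2r ?nnegrE ?(ltW aut) ?(ltW M0)//.
by apply: le_trans (ler_norm _) _; exact: hM.
Qed.

(** With f constant, the Crofton formula for K is a multiple of the one for the ball. *)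
Lemma constant_brightness_support b : (forall t, SO R n t -> f K t = b) ->
  forall u, sphere R n u -> h K u = c * b.
Proof.
move=> fb u hu; apply/eqP; rewrite -subr_eq0; apply/eqP.
apply: (sphere_test_eq0 hn hmu hs (H := fun u => h K u - c * b)) => //.
  by apply: wcB => //; exact: wc_cst.
move=> G cG; have cd : {within SO R n, continuous (fun t => dh (fun x => G (x *m t)))}.
  exact: (dhat_orbit_continuous hn hmu hs delta_linear delta_ge0).
rewrite (@ci_eq _ _ _ sigma _ _ (fun v => h K v * G v - c * b * G v)); last by move=> v _; rewrite mulrBl.
rewrite ciB//; [|exact: wcM|exact: wcZ].
rewrite crofton_formula// (@ci_eq _ _ _ mu _ _ (fun t => b * dh (fun x => G (x *m t)))); last first.
  by move=> t ht; rewrite fb.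
by rewrite !ciZ// crofton_ball// mulrA [b * c]mulrC subrr.
Qed.

(* The contact set of the pointwise estimate behind the right inequality; in the
   equality case it carries delta. *)
Let Z u := forall t, SO R n t -> h K (u *m t) = c * f K t.

(** A single contact direction forces equality, since e t runs over the sphere with distribution
    sigma. This is the converse half of the equality case. *)
Lemma contact_inverse_integral e : sphere R n e -> Z e -> J' = c ^+ n * J.
Proof.
move=> he Ze; have cI : {within sphere R n, continuous (fun u => h K u ^- n)}.
  by apply: within_continuous_inv_expr => // u hu; rewrite gt_eqF// h0.
rewrite /J (sphere_integral_SO hn hmu hs he cI) -ciZ//; last first.
  exact: (sphere_orbit_continuous (F := fun u => h K u ^- n) he cI).
apply: ci_eq => t ht; rewrite (Ze t ht) [(c * _) ^+ n]exprMn invfM mulrA divff ?mul1r//.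
by rewrite expf_neq0// gt_eqF.
Qed.

Hypothesis equality : forall t, SO R n t -> dh (fun u => (f K t - h K (u *m t) / c) ^+ 2) = 0.

(** Z is the common zero set of the squares (f t - h(u t) / c)^2 over all rotations t, and the
    functional annihilates each of them. *)
Lemma dhat_eq0_off_contact G : {within sphere R n, continuous G} ->
  (forall u, sphere R n u -> Z u -> G u = 0) -> dh G = 0.
Proof.
move=> cG GZ; have c1 : c != 0 by rewrite gt_eqF.
apply: (dhat_eq0 hn hmu hs delta_linear delta_ge0 (D := SO R n)
  (q := fun t u => (f K t - h K (u *m t) / c) ^+ 2)) => //.
- move=> t u; have ct : {for u, continuous (fun v => f K t - h K (v *m t) / c)}.
    apply: (@continuousB R R^o _ (fun=> f K t) (fun v => h K (v *m t) / c)); first exact: cst_continuous.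
    apply: (@continuousM _ _ (fun v => h K (v *m t)) (fun=> c^-1)); last exact: cst_continuous.
    apply: (@continuous_comp _ _ _ (fun v => v *m t) (h K)); first exact: mulmxr_continuous.
    exact: (support_fun_continuous (hPhi bK)).
  exact: (@continuousM _ _ (fun v => f K t - h K (v *m t) / c) _ _ ct ct).
- by move=> t u; exact: sqr_ge0.
- move=> u hu Gu; apply: contrapT => nex; move: Gu; rewrite GZ ?eqxx// => t ht.
  apply/eqP; rewrite eq_sym -subr_eq0; apply: contrapT => /negP ne; apply: nex; exists t => //.
  rewrite exprn_even_gt0//=; apply: contraNN ne => /eqP h1; apply/eqP.
  by rewrite (subr0_eq h1) mulrCA divff// mulr1 subrr.
Qed.

(** Otherwise the functional would annihilate the constant 1, whose value is c > 0. *)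
Lemma contact_nonempty : exists2 u, sphere R n u & Z u.
Proof.
apply: contrapT => nZ; have := @dhat_eq0_off_contact _ (@wc_cst R _ _ 1).
rewrite /dh (dhat_cst delta_linear delta_ge0) delta_massE mul1r => h1.
have := c0; rewrite h1 ?ltxx// => u hu Zu; by case: nZ; exists u.
Qed.

(** The even part of G minus its value at e vanishes on both points, and the functional does not
    distinguish G from its even part; so delta is c times the mean of the two point masses. *)
Lemma dhat_two_points e : sphere R n e -> (forall u, sphere R n u -> Z u -> u = e \/ u = - e) ->
  forall G, {within sphere R n, continuous G} -> dh G = c * ((G e + G (- e)) / 2).
Proof.
move=> he hZ G cG; have cN := wc_sphereN cG.
pose m := (G e + G (- e)) / 2.
have cH : {within sphere R n, continuous (fun u => 2^-1 * (G u + G (- u)))} by apply: wcZ; exact: wcD.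
have : dh (fun u => 2^-1 * (G u + G (- u)) - m) = 0.
  apply: dhat_eq0_off_contact; first by apply: wcB => //; exact: wc_cst.
  by move=> u hu /(hZ u hu)[->|->]; rewrite ?opprK /m; field.
rewrite /dh (dhatB hn hmu hs delta_linear delta_ge0 cH (@wc_cst R _ _ m)).
rewrite (dhat_cst delta_linear delta_ge0) delta_massE.
rewrite (dhatZ hn hmu hs delta_linear delta_ge0) ?wcD//; last exact: wcD.
have -> : dhat delta (fun u => G u + G (- u)) = dh G + dh G.
  rewrite -[X in _ = _ + X](dhat_even cG) -[X in _ = X + _]mul1r.
  rewrite -(dhat_linear hn hmu hs delta_linear delta_ge0 1 cG cN).
  by congr dhat; apply/funext => u; rewrite mul1r.
by rewrite -/(dh G) => h1; rewrite -/m; lra.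
Qed.

(** If s stabilizes E0, then h(u s t) = c f(s t) = c f(t) = h(u t), so h agrees on any two unit
    vectors with inner product <u, u s>. These products fill an interval [1 - r, 1], hence h is
    locally constant. E stands for E0 or its complement. *)
Lemma contact_rotation E u : (3 <= n)%N -> E^T = E -> E *m E = E -> (2 <= \rank E)%N ->
  (forall t, SO R n t -> Gr_act t E = E -> Gr_act t E0 = E0) ->
  sphere R n u -> Z u -> u *m E != 0 -> constant_brightness i K.
Proof.
move=> hn3 hT hE rE hst hu Zu uE.
have [r r0 hr] := stabilizer_rotation hT hE rE hu uE.
have hconst := @sphere_locally_constant R n (h K) r hn3 r0.
have H v w : sphere R n v -> sphere R n w -> h K v = h K w.
  apply: hconst => {}v {}w hv hw hvw.
  have d1 : dot v w <= 1 by apply: le_trans (dot_sphere_le1 hv hw); exact: ler_norm.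
  have [s [hs' sE us]] := hr _ hvw d1.
  have [t [ht <- <-]] := SO_sphere_trans2 hn3 hu (SO_sphere hs' hu) hv hw us.
  rewrite -mulmxA !Zu//; last exact: SOM.
  by rewrite /f Gr_actM (hst s).
exists (h K u / c) => E1 hE1; have [t ht <-] := SO_Gr_trans n0 hE0 hE1.
rewrite (H u (u *m t))//; last exact: SO_sphere.
by rewrite Zu// mulrAC divff ?mul1r// gt_eqF.
Qed.

End Body.

(* If delta is concentrated on {e, - e}, then h L = c V_i(L | E u) for bodies with
   interior points, and for all bodies by passing to L + d B. *)
Lemma degenerate_support e (E : 'rV[R]_n -> 'M[R]_n) : hausdorff_continuous Phi -> sphere R n e ->
  (forall t, SO R n t -> Gr_act t E0 = E (e *m t)) -> (forall u, E (- u) = E u) ->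
  (forall G, {within sphere R n, continuous G} -> dh G = c * ((G e + G (- e)) / 2)) ->
  forall L u, convex_body L -> sphere R n u -> h L u = c * proj_vol i L (E u).
Proof.
move=> hc he EE EN hdh.
have ball_case L u : convex_body L -> has_ball L -> sphere R n u -> h L u = c * proj_vol i L (E u).
  move=> bL ballL hu; have ch := valuation_support_continuous bL.
  have imS : (fun t => e *m t) @` SO R n = sphere R n.
    apply/seteqP; split=> v; first by move=> [t ht <-]; exact: SO_sphere.
    by move=> hv; have [t ht <-] := SO_sphere_trans hn he hv; exists t.
  (* Continuity is known along SO(n) and descends to the sphere through the orbit map of e. *)
  have cV : {within sphere R n, continuous (fun v => proj_vol i L (E v))}.
    have cfL : {within SO R n, continuous (fun t => proj_vol i L (E (e *m t)))}.
      by apply: wc_eq (brightness_continuous bL ballL) => t ht; rewrite /f EE.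
    apply: (quotient_continuous _ cO _ imS cfL); first exact: norm_hausdorff.
    exact: mulmx_continuousl.
  apply/eqP; rewrite -subr_eq0; apply/eqP.
  apply: (sphere_test_eq0 hn hmu hs (H := fun u => h L u - c * proj_vol i L (E u))) => //.
    by apply: wcB => //; exact: wcZ.
  move=> G cG; have cGN := wc_sphereN cG.
  have cVG : {within sphere R n, continuous (fun v => proj_vol i L (E v) * G v)} by exact: wcM.
  have cVGN : {within sphere R n, continuous (fun v => proj_vol i L (E v) * G (- v))} by exact: wcM.
  rewrite (@ci_eq _ _ _ sigma _ _ (fun v => h L v * G v - c * (proj_vol i L (E v) * G v))); last first.
    by move=> v _; rewrite mulrBl mulrA.
  rewrite ciB//; [|exact: wcM|exact: wcZ].
  rewrite crofton_formula// ciZ//.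
  rewrite (@ci_eq _ _ _ mu _ _ (fun t => c / 2 * ((fun v => proj_vol i L (E v) * G v +
     proj_vol i L (E v) * G (- v)) (e *m t)))); last first.
    move=> t ht; rewrite hdh; last by apply: wc_sphere_mulmx => //; exact: SO_orthogonal.
    by rewrite /f EE// mulNmx; field.
  have cVV := wcD cVG cVGN.
  rewrite ciZ//; last exact: (sphere_orbit_continuous he cVV).
  rewrite -(sphere_integral_SO hn hmu hs he cVV) ciD//.
  (* E is even, so the two point masses contribute equally and the factor c / 2 becomes c. *)
  have -> : \int[sigma]_(v in sphere R n) (proj_vol i L (E v) * G (- v)) =
    \int[sigma]_(v in sphere R n) (proj_vol i L (E v) * G v).
    rewrite -(sphere_integralN hn hmu hs cVG); apply: ci_eq => v _; by rewrite EN.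
  by lra.
move=> L u bL hu; have [t ht tu] := SO_sphere_trans hn he hu.
have [_ cL _] := bL; have [F F1 fE] := brightness_frame.
have bP d : convex_body (minkowski_add L (dilate d (eball R n))).
  by apply: minkowski_add_body => //; apply: dilate_body; exact: eball_body.
have ot := SO_orthogonal ht.
have Ft : (F *m t) *m (F *m t)^T = 1%:M by rewrite trmx_mul mulmxA -(mulmxA F) ot mulmx1.
have c0 := crofton_mass_gt0.
have VE M : convex_body M -> proj_vol i M (E u) = vol [set x *m (F *m t)^T | x in M].
  by move=> [_ cM _]; rewrite -tu -EE// -fE.
apply: (@eq_small _ _ _ (1 + c)) => e' e0.
have [d1 d10 hd1] := hc L bL e' e0.
have [d2 d20 hd2] := parallel_vol_cvg bL Ft e0.
(* d1 controls the error of h, by continuity of Phi, and is halved because the distance must stay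
   strictly below it; d2 controls the projection volume. Together they give the factor 1 + c. *)
pose d := Num.min (d1 / 2) d2.
have d0 : 0 < d by rewrite lt_min d20 divr_gt0.
have dd1 : d < d1 by rewrite /d gt_min ltr_pdivrMr// ltr_pMr// ltr1n.
have dd2 : d <= d2 by rewrite ge_min lexx orbT.
set Ld := minkowski_add L (dilate d (eball R n)).
have hLd := ball_case Ld u (bP d) (parallel_has_ball bL d0) hu.
have B1 : `|h L u - h Ld u| <= e'.
  apply: hausdorff_support_le => //; [exact: hPhi|exact/hPhi/bP|].
  by apply: hd1; [exact: bP|apply: le_lt_trans dd1; apply: hausdorff_parallel_le => //; exact: ltW].
have B2 : proj_vol i Ld (E u) <= proj_vol i L (E u) + e' by rewrite (VE Ld (bP d)) (VE L bL); exact: hd2.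
have B3 : proj_vol i L (E u) <= proj_vol i Ld (E u).
  rewrite (VE Ld (bP d)) (VE L bL); apply: vol_le; [exact: linear_image_compact|apply: linear_image_compact; case: (bP d) => //|].
  move=> _ [x Lx <-]; exists x => //; exists x => //; exists 0; last by rewrite addr0.
  by exists 0; rewrite ?scaler0// /eball/= enorm0.
have B4 : c * (proj_vol i Ld (E u) - proj_vol i L (E u)) <= c * e' by rewrite ler_wpM2l ?(ltW c0)//; lra.
have B5 : 0 <= c * (proj_vol i Ld (E u) - proj_vol i L (E u)) by rewrite mulr_ge0 ?(ltW c0)//; lra.
move: B1; rewrite hLd !ler_norml => /andP[? ?]; apply/andP; split; lra.
Qed.

(** Without constant brightness, contact directions are orthogonal to E0 as soon as dim E0 >= 2, and
    lie in E0 as soon as its complement has dimension at least 2. For n >= 3 at least one of these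
    applies; if both do, no direction is left, and otherwise Z lies in a line. *)
Lemma equality_cases K : (3 <= n)%N -> (1 <= i)%N -> (i <= n.-1)%N -> hausdorff_continuous Phi ->
  convex_body K -> has_ball K ->
  (forall t, SO R n t -> dh (fun u => (f K t - h K (u *m t) / c) ^+ 2) = 0) ->
  [\/ constant_brightness i K,
      i = 1%N /\ (forall L, convex_body L ->
        Phi L = dilate (kappa R n.-1 / 2) (minkowski_add (dilate (-1) L) L)) |
      i = n.-1 /\ (forall L, convex_body L -> is_projection_body L (Phi L))].
Proof.
move=> hn3 hi1 hin hc bK ballK heq.
have [cb|ncb] := pselect (constant_brightness i K); first by constructor 1.
have [hT hE rE] := hE0; have [cT cE rcE] := Gr_compl hE0.
pose Z u := forall t, SO R n t -> h K (u *m t) = c * f K t.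
have ZE u : (2 <= i)%N -> sphere R n u -> Z u -> u *m E0 = 0.
  move=> i2 hu Zu; apply/eqP; apply: contrapT => /negP uE; apply: ncb.
  by apply: (contact_rotation _ _ _ _ _ hu Zu uE) => //; rewrite rE.
have ZC u : (2 <= n - i)%N -> sphere R n u -> Z u -> u *m (1%:M - E0) = 0.
  move=> i2 hu Zu; apply/eqP; apply: contrapT => /negP uE; apply: ncb.
  apply: (contact_rotation _ _ _ _ _ hu Zu uE) => //; first by rewrite rcE.
  move=> t ht; rewrite Gr_act_compl; last exact: SO_orthogonal.
  by move=> /(congr1 (fun A => 1%:M - A)); rewrite !subKr.
have nn : n.-1.+1 = n by rewrite prednK// ltnW.
have n12 : (1 < n - 1)%N by rewrite ltn_subRL.
have NE (u : 'rV[R]_n) : (- u)^T *m (- u) = u^T *m u.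
  have -> : (- u)^T = - u^T by apply/matrixP => a b; rewrite !mxE.
  by rewrite mulNmx mulmxN opprK.
have [i1|i1] := eqVneq i 1%N.
  constructor 2; split=> // L bL.
  have [e he eE] : exists2 e, sphere R n e & E0 = e^T *m e.
    by apply: line_projection; rewrite -[X in Gr R X]i1.
  have hZ u : sphere R n u -> Z u -> u = e \/ u = - e.
    move=> hu Zu; apply: sphere_line => //; rewrite -eE.
    have := ZC u _ hu Zu; rewrite i1 mulmxBr mulmx1 => /(_ n12)/subr0_eq h1.
    by rewrite -h1.
  have hd := dhat_two_points bK heq he hZ.
  have hsupp := degenerate_support (E := fun u => u^T *m u) hc he _ NE hd bL.
  have bLL := minkowski_add_body (dilate_body (-1) bL) bL.
  apply: support_fun_inj; [exact: hPhi|exact: dilate_body|] => u hu.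
  rewrite -/(h L) hsupp//; last by move=> t _; rewrite eE Gr_act_line.
  rewrite i1 proj_vol_line// support_fun_dilate// support_funZ//; last first.
    by rewrite divr_ge0// ltW// kappa_gt0.
  rewrite support_fun_minkowski//; last exact: dilate_body.
  (* The factor in front of the difference body is c itself, since kappa 1 = 2. *)
  by rewrite support_fun_dilate// scaleN1r /c i1 kappa1 addrC.
have [in1|in1] := eqVneq i n.-1.
  constructor 3; split=> // L bL; split; first exact: hPhi.
  have [e he eE] : exists2 e, sphere R n e & 1%:M - E0 = e^T *m e.
    by apply: line_projection; have := Gr_compl hE0; rewrite [X in (n - X)%N]in1 -{1}nn subSnn.
  have hZ u : sphere R n u -> Z u -> u = e \/ u = - e.
    move=> hu Zu; apply: sphere_line => //; rewrite -eE mulmxBr mulmx1 ZE ?subr0//.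
    by rewrite ltn_neqAle eq_sym i1.
  have hd := dhat_two_points bK heq he hZ.
  have hsupp := degenerate_support (E := fun u => 1%:M - u^T *m u) hc he _ _ hd bL.
  move=> u hu; rewrite -/(h L) hsupp//; last 2 first.
  - move=> t /SO_orthogonal ot; rewrite -Gr_act_line -eE Gr_act_compl// subKr//.
  - by move=> v; rewrite NE.
  by rewrite /c in1 divff ?mul1r// gt_eqF// kappa_gt0.
(* Both E0 and its complement now have dimension at least 2, so a contact direction would be the
   zero vector. *)
have [u hu Zu] := contact_nonempty bK heq.
have i2 : (2 <= i)%N by rewrite ltn_neqAle eq_sym i1.
have ni2 : (2 <= n - i)%N.
  by rewrite ltn_subRL addn1 -nn ltnS ltn_neqAle in1.
have := ZC u ni2 hu Zu; rewrite mulmxBr mulmx1 ZE// subr0 => u0.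
by have := sphere_neq0 hu; rewrite u0 eqxx.
Qed.

End Crofton.

(** * Reduction of the two inequalities to the integrals I, J and J' *)

Theorem theorem2 (R : realType) (n i : nat)
    (mu : probability (borel_mx R n n) R)
    (sigma : probability (borel_mx R 1 n) R)
    (nu : probability (borel_mx R n n) R)
    (E0 : 'M[R]_n)
    (Phi : set 'rV[R]_n -> set 'rV[R]_n)
    (delta : ('rV[R]_n -> R) -> R)
    (K : set 'rV[R]_n) :
  (3 <= n)%N -> (1 <= i)%N -> (i <= n.-1)%N ->
  SO_invariant_measure mu ->
  sphere_invariant_measure sigma ->
  Gr_invariant_measure i nu ->
  Gr R i n E0 ->
  body_map Phi ->
  hausdorff_continuous Phi ->
  translation_invariant Phi ->
  SO_equivariant Phi ->
  even_map Phi ->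
  minkowski_valuation Phi ->
  homogeneous i Phi ->
  spherical_crofton i mu sigma E0 Phi delta ->
  nonneg_distribution delta ->
  Phi (eball R n) = dilate (kappa R n.-1) (eball R n) ->
  convex_body K ->
  K° !=set0 ->
  let W := quermassintegral i nu K in
  let A := affine_quermassintegral i nu K in
  let P := kappa R n ^+ n.+1 / kappa R n.-1 ^+ n * (vol (polar (Phi K)))^-1 in
  [/\ W ^+ n >= P,
      P >= A ^+ n,
      W ^+ n = P <-> euclidean_ball (Phi K) &
      P = A ^+ n <->
        [\/ constant_brightness i K,
            i = 1%N /\
            (forall L, convex_body L ->
               Phi L = dilate (kappa R n.-1 / 2) (minkowski_add (dilate (-1) L) L)) |
            i = n.-1 /\
            (forall L, convex_body L -> is_projection_body L (Phi L))]].
Proof.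
move=> hn3 hi1 hin hmu hs hnu hE0 hPhi hc _ _ _ _ _ hcr hd hb bK K0 W A P.
have hn : (2 <= n)%N by exact: ltnW.
have ballK := interior_has_ball K0.
have cS := @sphere_compact R n; have cO := @SO_compact R n.
pose c := kappa R n.-1 / kappa R i.
pose h := support_fun (Phi K).
pose f t := proj_vol i K (Gr_act t E0).
pose q := kappa R n / kappa R n.-1.
pose I := \int[sigma]_(u in sphere R n) h u.
pose J := \int[sigma]_(u in sphere R n) h u ^- n.
pose J' := \int[mu]_(t in SO R n) f t ^- n.
have k0 j : 0 < kappa R j by exact: kappa_gt0.
have q0 : 0 < q by rewrite divr_gt0.
have c0 : 0 < c by rewrite divr_gt0.
have hpos := valuation_support_gt0 hn hmu hs hE0 hPhi hcr hd hb bK ballK.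
have heven := valuation_support_even hn hmu hs hE0 hPhi hcr hd bK ballK.
have hcont := valuation_support_continuous hPhi bK.
have [I0 IJ Ieq] := sphere_jensen hn hmu hs hcont hpos.
have J0 : 0 < J by apply: lt_le_trans IJ; rewrite invr_gt0 exprn_gt0.
have JJ' : c ^+ n * J <= J'.
  exact: (brightness_inverse_integral_ge hn hmu hs hE0 hPhi hcr hd hb bK ballK).
have J'0 : 0 < J' by apply: lt_le_trans JJ'; rewrite mulr_gt0// exprn_gt0.
(* After division by q^n the chain compares I^n, 1 / J and c^n / J', so it amounts to I^-n <= J and
   c^n J <= J'. *)
have WE : W ^+ n = q ^+ n * I ^+ n.
  by rewrite /W (quermassintegralE hn hmu hs hE0 hPhi hcr hd hb bK ballK hnu) exprMn.
have PE : P = q ^+ n / J.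
  rewrite /P (polar_volE hn hmu hs hE0 hPhi hcr hd hb bK ballK) -/h -/J /q expr_div_n exprS.
  by field; rewrite !gt_eqF// exprn_gt0.
have AE : A ^+ n = q ^+ n * c ^+ n / J'.
  rewrite /A (affine_quermassintegralE hn hmu hE0 bK ballK hnu).
  congr (_ / _); rewrite -exprMn; congr (_ ^+ _).
  by rewrite /q /c; field; rewrite !gt_eqF.
have qn0 : 0 < q ^+ n by rewrite exprn_gt0.
have In0 : 0 < I ^+ n by rewrite exprn_gt0.
have IJ1 : 1 <= I ^+ n * J by move: IJ; rewrite -[leLHS]mul1r ler_pdivrMr// mulrC.
have eqWP : W ^+ n = P <-> J <= I ^- n.
  rewrite WE PE; split=> [/(mulfI (lt0r_neq0 qn0)) ->|h1].
    by rewrite invrK.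
  congr (_ * _); apply: invr_inj; rewrite invrK; apply/eqP; rewrite eq_le h1 andbT.
  exact: IJ.
have eqPA : P = A ^+ n <-> J' = c ^+ n * J.
  rewrite AE PE -mulrA; split=> [/(mulfI (lt0r_neq0 qn0)) h1|->].
    have : c ^+ n = J^-1 * J' by rewrite h1 divfK// gt_eqF.
    by move=> ->; rewrite mulrAC mulVf ?mul1r// gt_eqF.
  congr (_ * _); rewrite invfM mulrA divff ?mul1r// gt_eqF// exprn_gt0//.
split.
- by rewrite WE PE ler_pM2l// -[leLHS]mul1r ler_pdivrMr.
- by rewrite AE PE -mulrA ler_pM2l// ler_pdivrMr// mulrC ler_pdivlMr.
- rewrite eqWP; split=> [/Ieq hI|[z [r [r0 PhiE]]]].
    exists 0, I; split=> //.
    apply: support_fun_inj; [exact: hPhi|apply: translate_body; apply: dilate_body; exact: eball_body|].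
    move=> u hu; rewrite support_fun_translate; last by apply: dilate_body; exact: eball_body.
    rewrite support_fun_dilate; last exact: eball_body.
    by rewrite support_fun_eball enormZ hu mulr1 dot0r addr0 gtr0_norm// -[RHS](hI u hu).
  have hE u : sphere R n u -> h u = r + dot u z.
    move=> hu; rewrite /h PhiE support_fun_translate; last by apply: dilate_body; exact: eball_body.
    rewrite support_fun_dilate; last exact: eball_body.
    by rewrite support_fun_eball enormZ hu mulr1 gtr0_norm.
  (* Evenness of h removes the contribution <u, z> of the centre, so the ball is centred and h is
     constant. *)
  have hr u : sphere R n u -> h u = r.
    move=> hu; have := heven u hu; rewrite -/h !hE//; last exact: sphereN.
    by rewrite dotNl; lra.
  have -> : I = r by rewrite /I (ci_eq _ hr) (ci_cst cS hs.1).
  rewrite /J (@ci_eq _ _ _ sigma _ _ (fun=> r ^- n)) ?(ci_cst cS hs.1)//.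
  by move=> u hu; rewrite hr.
- rewrite eqPA; split=> [JE|cases].
    apply: (equality_cases hn hmu hs hE0 hPhi hcr hd hb hn3 hi1 hin hc bK ballK).
    by apply: (brightness_inverse_integral_eq hn hmu hs hE0 hPhi hcr hd hb bK ballK); rewrite -/J' JE.
  (* Each of the three conditions supplies a contact direction: any unit vector, a unit vector
     spanning E0, or one spanning its complement. *)
  suff [e he eK] : exists2 e, sphere R n e & forall t, SO R n t -> h (e *m t) = c * f t.
    exact: (contact_inverse_integral hn hmu hs hE0 hPhi hcr hd hb bK ballK he eK).
  have [_ cK _] := bK.
  case: cases => [[b hb']|[i1 hPhi1]|[in1 hpb]].
  + have [e he _] := @perp_unit R n 0 hn; exists e => // t ht.
    have fb s : SO R n s -> f s = b.
      by move=> hs'; apply: hb'; apply: Gr_act_Gr => //; exact: SO_orthogonal.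
    rewrite fb//; apply: (constant_brightness_support hn hmu hs hE0 hPhi hcr hd hb bK ballK fb).
    exact: SO_sphere.
  + have [e he eE] : exists2 e, sphere R n e & E0 = e^T *m e.
      by apply: line_projection; rewrite -[X in Gr R X]i1.
    exists e => // t ht; have het := SO_sphere ht he.
    have bN := dilate_body (-1) bK.
    rewrite /f eE Gr_act_line i1 proj_vol_line// /h hPhi1//.
    rewrite support_fun_dilate; last exact: minkowski_add_body.
    rewrite support_funZ; [|exact: minkowski_add_body|by rewrite divr_ge0// ltW].
    rewrite support_fun_minkowski// support_fun_dilate// scaleN1r /c i1 kappa1.
    by rewrite [support_fun K (- _) + _]addrC.
  + have nn : n.-1.+1 = n by rewrite prednK// ltnW.
    have [e he eE] : exists2 e, sphere R n e & 1%:M - E0 = e^T *m e.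
      by apply: line_projection; have := Gr_compl hE0; rewrite [X in (n - X)%N]in1 -{1}nn subSnn.
    exists e => // t ht; have het := SO_sphere ht he; have [_ hp] := hpb K bK.
    rewrite /h hp// /f -Gr_act_line -eE Gr_act_compl; last exact: SO_orthogonal.
    by rewrite subKr /c in1 divff ?mul1r// gt_eqF.
Qed.
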